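(* Let $a$ be a nonnegative integer and let $\omega$ be a complex number that is $-1$, a primitive third root of unity, or a primitive sixth root of unity. Consider the weighted count $S=\sum_\pi\omega^{m_1(\pi)}$, summed over all cyclically symmetric plane partitions $\pi$ contained in an $a\times a\times a$ box, where $m_1(\pi)$ is the number of elements of $\pi$ of the form $(i,i,i)$. (i) If $\omega=-1$, then $S=0$ for $a$ odd, and for $a$ even $$S=(-1)^{a/2}\prod_{i=0}^{a/2-1}\frac{i!^4\,(3i+1)!^4}{(2i)!^4\,(2i+1)!^4}.$$ (ii) If $\omega$ is a primitive third root of unity, then $$\begin{aligned}S={}&\frac{(1+\omega)^a\,2^{\lfloor a/2\rfloor}}{\prod_{i=1}^{\lfloor a/2\rfloor}(2i-1)!!\,\prod_{i=1}^{\lfloor(a-1)/2\rfloor}(2i-1)!!}\prod_{i\ge0}\left(3i+1\right)_{\lfloor(a-4i)/2\rfloor}\left(3i+3\right)_{\lfloor(a-4i-3)/2\rfloor}\\&\qquad\cdot\left(a-i+\tfrac12\right)_{\lfloor(a-4i-1)/2\rfloor}\left(a-i-\tfrac12\right)_{\lfloor(a-4i-2)/2\rfloor}.\end{aligned}$$ (iii) If $\omega$ is a primitive sixth root of unity, then $$\begin{aligned}S={}&\frac{(1+\omega)^a\left(\frac23\right)^{\lfloor a/2\rfloor}}{\prod_{i=1}^{\lfloor a/2\rfloor}(2i-1)!!\,\prod_{i=1}^{\lfloor(a-1)/2\rfloor}(2i-1)!!}\prod_{i\ge0}\left(3i+\tfrac32\right)_{\lfloor(a-4i-1)/2\rfl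oor}\left(3i+\tfrac52\right)_{\lfloor(a-4i-2)/2\rfloor}\\&\qquad\cdot\left(a-i\right)_{\lfloor(a-4i)/2\rfloor}\left(a-i\right)_{\lfloor(a-4i-3)/2\rfloor}.\end{aligned}$$
   Context: A plane partition is a finite subset $\pi$ of $\mathbb Z_+^3$ ($\mathbb Z_+$ the positive integers) such that if $(i_1,j_1,k_1)\in\pi$ then every $(i_2,j_2,k_2)$ with $1\le i_2\le i_1$, $1\le j_2\le j_1$, $1\le k_2\le k_1$ is also in $\pi$. It is contained in an $a\times a\times a$ box if all coordinates of its elements are at most $a$. It is cyclically symmetric if $(i,j,k)\in\pi$ implies $(j,k,i)\in\pi$. Notation: $(\alpha)_k=\alpha(\alpha+1)\cdots(\alpha+k-1)$ for $k\ge1$, $(\alpha)_0=1$; $(2i-1)!!=1\cdot3\cdots(2i-1)$; empty products are 1. In the subscripts in (ii) and (iii), $\lfloor\alpha\rfloor$ is the usual floor if $\alpha\ge0$ but is read as $0$ if $\alpha<0$, so that the products over $i\ge0$ are finite. *)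

(* Defs.v *)
From HB Require Import structures.
From mathcomp Require Import all_boot all_order all_algebra.
From mathcomp Require Import finmap boolp reals complex.

Set Implicit Arguments.
Unset Strict Implicit.
Unset Printing Implicit Defensive.

Import Order.TTheory GRing.Theory Num.Theory.

Notation point := (nat * nat * nat)%type.

(* Coordinates are the positive integers, as in Z_+^3, not shifted to start
   at 0. *)
Definition plane_partition (pi : {fset point}) : Prop :=
  (forall i j k, (i, j, k) \in pi -> [/\ 1 <= i, 1 <= j & 1 <= k]) /\
  (forall i1 j1 k1 i2 j2 k2, (i1, j1, k1) \in pi ->
     1 <= i2 <= i1 -> 1 <= j2 <= j1 -> 1 <= k2 <= k1 -> (i2, j2, k2) \in pi).

Definition contained_in_box (a : nat) (pi : {fset point}) : Prop :=
  forall i j k, (i, j, k) \in pi -> [/\ i <= a, j <= a & k <= a].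

Definition cyclically_symmetric (pi : {fset point}) : Prop :=
  forall i j k, (i, j, k) \in pi -> (j, k, i) \in pi.

Definition box (a : nat) : {fset point} :=
  let side := [fset i in iota 1 a]%fset in (side `*` side `*` side)%fset.

(* [box a] only serves to make the collection of candidates finite; see
   [CSPPP] for the membership criterion. *)
Definition CSPP (a : nat) : {fset {fset point}} :=
  [fset pi in fpowerset (box a) |
    `[< [/\ plane_partition pi, contained_in_box a pi
          & cyclically_symmetric pi] >]]%fset.

Lemma mem_box (a i j k : nat) :
  ((i, j, k) \in box a) = [&& 1 <= i <= a, 1 <= j <= a & 1 <= k <= a].
Proof. by rewrite /box !inE /= !mem_iota !add1n !ltnS -!andbA. Qed.

Lemma CSPPP (a : nat) (pi : {fset point}) :
  pi \in CSPP a <->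
  [/\ plane_partition pi, contained_in_box a pi & cyclically_symmetric pi].
Proof.
rewrite !inE /= fpowersetE; split => [/andP[_ /asboolP]//|H].
apply/andP; split; last exact/asboolP.
case: H => -[pos _] ina _; apply/fsubsetP => -[[i j] k] ijk.
by rewrite mem_box; case: (pos _ _ _ ijk) => -> -> ->; case: (ina _ _ _ ijk) => -> ->.
Qed.

Definition m1 (pi : {fset point}) : nat :=
  #|` [fset p in pi | (p.1.1 == p.1.2) && (p.1.2 == p.2)]%fset |.

Local Open Scope ring_scope.

Definition weighted_count (K : nzRingType) (omega : K) (a : nat) : K :=
  \sum_(pi <- CSPP a) omega ^+ m1 pi.

Definition rising_factorial (K : nzRingType) (alpha : K) (k : nat) : K :=
  \prod_(0 <= j < k) (alpha + j%:R).

(* (2 i - 1)!! *)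
Definition odd_double_factorial (i : nat) : nat :=
  (\prod_(1 <= j < i.+1) (2 * j - 1))%N.

(* Main.v *)
Require Import Defs.
From HB Require Import structures.
From mathcomp Require Import all_boot all_order all_fingroup all_algebra.
From mathcomp Require Import finmap boolp reals complex.
From mathcomp Require Import zify ring.

Set Implicit Arguments.
Unset Strict Implicit.
Unset Printing Implicit Defensive.

Import Order.TTheory GRing.Theory Num.Theory.
Local Open Scope ring_scope.

(** The weighted count is a determinant, the determinant is a Gram determinant of
    a moment functional on polynomials, and for the given values of w the moments
    satisfy first order recurrences which turn the Gram matrix into a Hilbert
    matrix with rescaled rows and columns.

    Counting.  A cyclically symmetric plane partition is determined by its points
    whose last coordinate is minimal.  Cut this region along the planes in which
    the difference e of the first two coordinates is constant: each cut is a
    strict partition, whose parts are read as the positions of distinct particles.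
    As e decreases to 0, each particle of the cuts at e and -e advances by at most
    one place per unit; the two cuts have equally many particles and coincide at
    e = 0, where the particles correspond to the diagonal points.  So one counts pairs
    of families of non-intersecting paths with the same end points and the same
    birth times, and the method of Lindstroem, Gessel and Viennot, followed by
    the expansion of a determinant det (1 + w N) in principal minors, gives
    S = det (1 + w P^T P), P the Pascal matrix of order a
    ([weighted_count_det]).

    The functional.  P is unimodular, so that det (1 + w P^T P) = det (1 + w P P^T),
    and 1 + w P P^T is the Gram matrix, on the powers of X, of the form
    <f, h> + w <f (X + 1), h (X + 1)>, where the powers of X are orthonormal for
    <,>.  The operator f |-> (X^2 - X + 1) f' + X f is self-adjoint for both terms:
    in coefficients it is a symmetric tridiagonal matrix, and it stays one after
    the substitution X -> X + 1.  Let T be this operator, suitably translated and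
    scaled.  The polynomials q(T) 1 exhaust all polynomials, and self-adjointness
    gives form (q(T) 1) (r(T) 1) = L (q r) for a linear functional L
    ([form_symbol]).  Hence the wanted determinant is, up to an explicit factor,
    the determinant of the L (phi_i psi_j) for any two polynomial bases
    ([gram_det]).

    Let al and be be the roots of X^2 - X + 1.  Multiplication by
    (X - al) / (X - be) conjugates T into T - 1/3, and the values of this
    multiplier at 0 and 1 are al^2 and be^2, with 1 + al^2 + be^2 = 0.  This yields
    the difference equation of L ([moment_shift]):
    L (q (t + 1/3) + q (t) + q (t - 1/3)) is a combination of two values of q.

    The special values.  If w is a primitive third root of unity one of these two
    values drops out; if w = -1 they combine to a multiple of q (c) - q (-c), which
    makes L an odd functional; if w is a primitive sixth root of unity, L is a
    multiple of q |-> q (0) - M q with M odd of the same type.  In each case a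
    difference of two translates telescopes the left-hand side to translates by
    1/2 ([third_average_half]), and a quadratic or quartic polynomial chosen to
    vanish at the points that remain turns the equation into a first order
    recurrence for the moments of products of shifted factorials, as for the
    continuous Hahn and the Wilson polynomials.  The moments are then products
    r_i c_j / (i + j + 1) and the Hilbert determinant finishes the evaluation;
    for the odd functionals even and odd polynomials are separated first, and
    only the mixed block contributes.

    The formulas.  For w = -1 the result is the stated product.  In the two other
    cases it is a product of ratios of factorials, one per unit of a, and the four
    families of shifted factorials in the statement telescope to the same ratios
    when a grows by 1 ([third_root_formula], [sixth_root_formula]). *)

(** * Determinants whose entries are sums *)

Lemma det_sum_rows (K : comNzRingType) (I : finType) (n : nat)
    (B : 'I_n -> pred I) (F : 'I_n -> I -> 'I_n -> K) :
  \det (\matrix_(i, j) \sum_(b | B i b) F i b j) =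
  \sum_(f in family B) \det (\matrix_(i, j) F i (f i) j).
Proof.
rewrite /determinant exchange_big /=; apply: eq_bigr => s _.
rewrite -mulr_sumr; congr (_ * _).
under eq_bigr do rewrite mxE.
rewrite bigA_distr_big_dep; apply: eq_bigr => f _.
by apply: eq_bigr => i _; rewrite mxE.
Qed.

(** Expanding rows and columns at once keeps the result in the form of a sum over
    pairs of configurations, one for each side of a family of path pairs. *)
Lemma det_sum_rows_cols (K : comNzRingType) (I : finType) (n : nat)
    (B C : 'I_n -> pred I) (F : 'I_n -> I -> 'I_n -> I -> K) :
  \det (\matrix_(i, j) \sum_(b | B i b) \sum_(c | C j c) F i b j c) =
  \sum_(f in family B) \sum_(g in family C)
     \det (\matrix_(i, j) F i (f i) j (g j)).
Proof.
rewrite det_sum_rows; apply: eq_bigr => f _.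
rewrite -det_tr.
transitivity (\det (\matrix_(j, i) \sum_(c | C j c) F i (f i) j c)).
  by congr (\det _); apply/matrixP => i j; rewrite !mxE.
rewrite det_sum_rows; apply: eq_bigr => g _; rewrite -det_tr.
by congr (\det _); apply/matrixP => i j; rewrite !mxE.
Qed.

(** * Families of non-intersecting paths *)

Section Configurations.
Variable a : nat.

(** Position of each of the [a] particles, [0] standing for a particle that is not
    present. *)
Definition config := {ffun 'I_a -> 'I_a.+1}.

(** The truncated predecessor makes the positive positions distinct while letting
    any number of particles sit at [0]. *)
Definition strict (x : config) :=
  [forall i : 'I_a, forall j : 'I_a, (i < j)%N ==> (x j <= (x i).-1)%N].

Definition step (x z : config) := [forall i, (z i <= x i <= (z i).+1)%N].

Definition same_support (x y : config) :=
  [forall i, ((x i : nat) == 0%N) == ((y i : nat) == 0%N)].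

Definition vacuum : config := [ffun => ord0].

Lemma strictP (x : config) : reflect (forall i j : 'I_a, (i < j -> x j <= (x i).-1)%N) (strict x).
Proof.
apply: (iffP forallP) => [H i j ij|H i]; first by move/forallP: (H i) => /(_ j); rewrite ij.
by apply/forallP => j; apply/implyP; exact: H.
Qed.

Lemma stepP (x z : config) : reflect (forall i, (z i <= x i <= (z i).+1)%N) (step x z).
Proof. exact: forallP. Qed.

Lemma same_supportP (x y : config) :
  reflect (forall i, ((x i : nat) == 0%N) = ((y i : nat) == 0%N)) (same_support x y).
Proof.
by apply: (iffP forallP) => H i; [have /eqP := H i | rewrite H].
Qed.

End Configurations.

Section Transfer.
Variable K : comNzRingType.

(** Number of pairs of paths from the heights [p] and [q] to [0] in [r] steps of
    size [0] or [1], the two paths reaching [0] at the same step. *)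
Fixpoint kern (r p q : nat) : K :=
  match p, q with
  | 0, 0 => 1
  | p'.+1, q'.+1 =>
      if r is r'.+1 then
        kern r' p q + kern r' p q' + kern r' p' q + kern r' p' q'
      else 0
  | _, _ => 0
  end.

Lemma kern00 r : kern r 0 0 = 1. Proof. by case: r. Qed.
Lemma kern0S r q : kern r 0 q.+1 = 0. Proof. by case: r. Qed.
Lemma kernS0 r p : kern r p.+1 0 = 0. Proof. by case: r. Qed.
Definition kern0 := (kern00, kern0S, kernS0).

Lemma kernC r p q : kern r p q = kern r q p.
Proof.
elim: r p q => [|r IH] [|p] [|q] //=.
by rewrite (IH p.+1 q.+1) (IH p.+1 q) (IH p q.+1) (IH p q); ring.
Qed.

(** [s] is the number of steps before the common last descent from [1] to [0]; among
    them the two paths choose their other [p] and [q] descents. *)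
Lemma kernE r p q :
  kern r p.+1 q.+1 = \sum_(s < r) 'C(s, p)%:R * 'C(s, q)%:R.
Proof.
elim: r p q => [|r IH] p q; first by rewrite big_ord0.
have shift m n : (\sum_(s < r.+1) 'C(s, m)%:R * 'C(s, n)%:R =
    'C(0, m)%:R * 'C(0, n)%:R +
    \sum_(s < r) 'C(s.+1, m)%:R * 'C(s.+1, n)%:R :> K).
  by rewrite big_ord_recl.
rewrite shift.
case: p q => [|p] [|q] /=; rewrite ?kern0 ?IH ?bin0n ?bin0 /= ?mul0r ?mulr0 ?mul1r ?addr0 ?add0r.
- by rewrite addrC; congr (_ + _); apply: eq_bigr => i _; rewrite !bin0 mulr1.
- by rewrite -big_split /=; apply: eq_bigr => i _; rewrite !bin0 binS natrD; ring.
- by rewrite -big_split /=; apply: eq_bigr => i _; rewrite !bin0 binS natrD; ring.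
rewrite -!big_split /=; apply: eq_bigr => i _.
by rewrite !binS !natrD; ring.
Qed.

(** Absent particles are matched by the identity; this makes the matrix below of
    constant size [a], whatever the number of particles present. *)
Definition entry (r p q : nat) (b : bool) : K :=
  if (p == 0%N) && (q == 0%N) then b%:R else kern r p q.

Definition config_mx (a r : nat) (x y : config a) : 'M[K]_a :=
  \matrix_(i, j) entry r (x i) (y j) (i == j).

Fixpoint families (a r : nat) (x y : config a) : K :=
  if r is r'.+1 then
    \sum_(z | step x z && strict z)
       \sum_(w | [&& step y w, strict w & same_support z w]) families r' z w
  else ((x == vacuum a) && (y == vacuum a))%:R.

(** The predecessors of a height are itself and, if it is positive, the height
    below. *)
Lemma sum_step (n : nat) (p : 'I_n.+1) (G : nat -> K) :
  \sum_(b : 'I_n.+1 | (b <= p <= b.+1)%N) G b =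
  G p + (if (p : nat) is p'.+1 then G p' else 0).
Proof.
rewrite (bigD1 p) /=; last by rewrite leqnn leqnSn.
congr (_ + _); case: p => [[|p] lt_p] /=.
  rewrite big1 // => b /andP[/andP[b0 _]] /eqP nb.
  by case: nb; apply: val_inj => /=; move: b0; case: (b : nat).
rewrite (bigD1 (Ordinal (ltnW lt_p))) /=; last first.
  by rewrite leqnSn ltnSn /= -val_eqE /= neq_ltn leqnn.
rewrite big1 ?addr0 // => b /andP[/andP[/andP[b1 b2]]].
by rewrite -!val_eqE /= => /eqP nb1 /eqP nb2; lia.
Qed.

(** One step of both paths, on the level of a matrix entry.  The only delicate case
    is that of two heights [1], which may both drop to [0]: by strictness they then
    belong to the same particle, so that the two conventions of [entry] agree. *)
Lemma entry_recr a r (x y : config a) i j :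
  strict x -> strict y -> same_support x y ->
  entry r.+1 (x i) (y j) (i == j) =
  \sum_(b : 'I_a.+1 | (b <= x i <= b.+1)%N)
    \sum_(c : 'I_a.+1 | (c <= y j <= c.+1)%N) entry r b c (i == j).
Proof.
move=> /strictP sx /strictP sy /same_supportP sxy.
under eq_bigr => b _ do rewrite (sum_step _ (fun c => entry r b c (i == j))).
rewrite (sum_step _ (fun b => entry r b (y j) (i == j) +
  if (y j : nat) is q.+1 then entry r b q (i == j) else 0)).
have ij1 : (x i : nat) = 1%N -> (y j : nat) = 1%N -> i == j.
  move=> xi yj; rewrite -val_eqE /=; move: (sxy i) (sxy j).
  case: (ltngtP i j) => // ij; first by move: (sx _ _ ij); rewrite xi yj => /=; lia.
  by move: (sy _ _ ij); rewrite xi yj => /=; lia.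
have ij0 : ((x i : nat) == 0%N) != ((y j : nat) == 0%N) -> (i == j) = false.
  by move=> H; apply/eqP => ij; move: H; rewrite ij sxy eqxx.
move: ij1 ij0; case: (x i : nat) (y j : nat) => [|p] [|q] /= ij1 ij0.
- by rewrite /entry /= !addr0.
- by rewrite /entry /= ij0 //; case: q {ij1 ij0} => [|q]; rewrite /= ?kern0 ?addr0 ?mulr0n.
- by rewrite /entry /= ij0 //; case: p {ij1 ij0} => [|p]; rewrite /= ?kern0 ?addr0 ?mulr0n.
rewrite /entry /= !addrA; case: p q ij1 {ij0} => [|p] [|q] ij1 //=.
by rewrite ij1 // kern00.
Qed.

Lemma det_config_mx_not_strict a r (x y : config a) (i j : 'I_a) :
  (i < j)%N -> x i = x j -> x i != ord0 -> \det (config_mx r x y) = 0.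
Proof.
move=> ij xij xi0; apply: (determinant_alternate (i1 := i) (i2 := j)).
  by rewrite -val_eqE /= neq_ltn ij.
move=> k; rewrite !mxE -xij /entry.
by rewrite -val_eqE /= in xi0; rewrite (negbTE xi0).
Qed.

Lemma config_mx_tr a r (x y : config a) : (config_mx r x y)^T = config_mx r y x.
Proof.
apply/matrixP => i j; rewrite !mxE /entry andbC [j == i]eq_sym; case: ifP => // _.
exact: kernC.
Qed.

Lemma step_not_strict a (x z : config a) : strict x -> step x z -> ~~ strict z ->
  exists i j : 'I_a, [/\ (i < j)%N, z i = z j & z i != ord0].
Proof.
move=> /strictP sx /stepP xz; rewrite /strict => /forallPn[k /forallPn[j]].
rewrite negb_imply -ltnNge => /andP[ij zij].
exists k, j; move: (sx _ _ ij) (xz k) (xz j) => ? ? ?.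
by split => //; rewrite -?val_eqE /=; [apply: val_inj => /=; lia|lia].
Qed.

(** The row of [i] is zero: an absent particle is matched neither with a present one
    nor with an absent one of another index. *)
Lemma det_config_mx_support a r (x y : config a) (i : 'I_a) :
  (x i : nat) != 0%N -> (y i : nat) = 0%N -> \det (config_mx r y x) = 0.
Proof.
move=> xi yi.
rewrite (expand_det_row _ i) big1 // => j _; rewrite !mxE /entry yi /=.
case xj0 : ((x j : nat) == 0%N); last first.
  by move: xj0; case: (x j : nat) => // n _; case: r => [|r]; rewrite mul0r.
rewrite (_ : (i == j) = false) ?mul0r //; apply/eqP => ij.
by move: xi; rewrite ij xj0.
Qed.

(** The Lindstroem-Gessel-Viennot argument, one time step after the other.
    Expanding rows and columns of the determinant by [entry_recr] produces all pairs
    of configurations reachable in one step; those with two particles at the same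
    place have two equal rows or columns, those with different supports have a
    zero row or column, and the rest are the admissible ones. *)
Lemma families_det a r (x y : config a) :
  strict x -> strict y -> same_support x y ->
  families r x y = \det (config_mx r x y).
Proof.
elim: r x y => [|r IH] x y sx sy.
  move=> /same_supportP sxy /=.
  have [xv|x0] := eqVneq x (vacuum a); last first.
    have /existsP[k xk] : [exists k, (x k : nat) != 0%N].
      rewrite -negb_forall; apply: contraNN x0 => /forallP x0.
      by apply/eqP/ffunP => k; apply: val_inj; rewrite ffunE /=; apply/eqP.
    rewrite (expand_det_row _ k) big1 // => j _; rewrite !mxE /entry (negbTE xk) /=.
    by move: xk; case: (x k : nat) => // p _; case: (y j : nat) => [|q]; rewrite /= mul0r.
  have y0 : y = vacuum a.
    by apply/ffunP => k; apply: val_inj; move: (sxy k); rewrite xv !ffunE eqxx => /esym/eqP.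
  rewrite xv y0 !eqxx (_ : config_mx _ _ _ = 1%:M) ?det1 //.
  by apply/matrixP => i j; rewrite !mxE !ffunE.
move=> sxy /=; transitivity (\sum_(z in family (fun i (b : 'I_a.+1) => (b <= x i <= b.+1)%N))
   \sum_(w in family (fun i (b : 'I_a.+1) => (b <= y i <= b.+1)%N)) \det (config_mx r z w)); last first.
  rewrite -(det_sum_rows_cols _ _
    (fun i (b : 'I_a.+1) j (c : 'I_a.+1) => entry r b c (i == j))).
  congr (\det _); apply/matrixP => i j.
  by rewrite !mxE entry_recr.
have famE (u z : config a) :
    (z \in family (fun i (b : 'I_a.+1) => (b <= u i <= b.+1)%N)) = step u z.
  exact/familyP/stepP.
under [RHS]eq_bigl do rewrite famE.
rewrite big_mkcondr /=; apply: eq_bigr => z xz.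
under [RHS]eq_bigl do rewrite famE.
case: ifP => sz; last first.
  have [i [j [ij zij zi0]]] := step_not_strict sx xz (negbT sz).
  by rewrite big1 // => w yw; apply: det_config_mx_not_strict ij zij zi0.
rewrite big_mkcond [RHS]big_mkcond /=; apply: eq_bigr => w _.
case: ifP => [/and3P[-> sw zw]|]; first exact: IH.
case yw: (step y w) => //= /negbT; rewrite negb_and.
case sw: (strict w) => /= zw; last first.
  have [i [j [ij wij wi0]]] := step_not_strict sy yw (negbT sw).
  by rewrite -det_tr config_mx_tr (det_config_mx_not_strict _ _ ij wij wi0).
move: zw; rewrite /same_support => /forallPn[i zwi]; apply/esym.
have [zi0|zi0] := eqVneq (z i : nat) 0%N; last have [wi0|wi0] := eqVneq (w i : nat) 0%N.
- apply: (@det_config_mx_support a r w z i) => //.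
  by apply: contraNneq zwi => ->; rewrite zi0.
- by rewrite -det_tr config_mx_tr; apply: (@det_config_mx_support a r z w i).
by move: zwi; rewrite (negbTE zi0) (negbTE wi0) eqxx.
Qed.
End Transfer.

(** * Summation over configurations by principal minors *)

Lemma det_mxsub_inj (K : comNzRingType) (n : nat) (f : 'I_n -> 'I_n) (M : 'M[K]_n) :
  injective f -> \det (mxsub f f M) = \det M.
Proof.
move=> f_inj.
have -> : mxsub f f M = row_perm (perm f_inj) (col_perm (perm f_inj) M).
  by apply/matrixP => i j; rewrite !mxE !permE.
rewrite row_permE col_permE !det_mulmx !det_perm odd_permV mulrCA -signr_addb.
by rewrite addbb mulr1.
Qed.

(** Each row is a sum of a row of the identity and a row of [w *: N]; the set [A]
    records the rows taken from the latter.  Permutations that move a point outside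
    [A] contribute nothing, so the minor may be completed by the identity. *)
Lemma det_1_add_scale (K : comNzRingType) (n : nat) (w : K) (N : 'M[K]_n) :
  \det (1%:M + w *: N) =
  \sum_(A : {set 'I_n}) w ^+ #|A| *
    \det (\matrix_(i, j) if (i \in A) && (j \in A) then N i j else (i == j)%:R).
Proof.
transitivity (\det (\matrix_(i < n, j < n) \sum_(b : bool | true)
    (if b then w * N i j else (i == j)%:R))).
  by congr (\det _); apply/matrixP => i j; rewrite !mxE big_bool addrC.
rewrite (det_sum_rows (fun _ => predT) (fun i (b : bool) j => if b then w * N i j else (i == j)%:R)).
rewrite (reindex (fun A : {set 'I_n} => [ffun i => i \in A])) /=; last first.
  exists (fun f : {ffun 'I_n -> bool} => [set i | f i]) => [A _|f _].
    by apply/setP => i; rewrite inE ffunE.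
  by apply/ffunP => i; rewrite ffunE inE.
rewrite (eq_bigl predT) => [|A]; last by apply/familyP.
apply: eq_bigr => A _; rewrite /determinant mulr_sumr; apply: eq_bigr => s _.
rewrite mulrCA; congr (_ * _).
have [/forallP fixA|/forallPn[k]] := boolP [forall i, (i \notin A) ==> (s i == i)].
  have sA i : (s i \in A) = (i \in A).
    have [iA|iA] := boolP (i \in A); last by rewrite (eqP (implyP (fixA i) iA)) (negbTE iA).
    apply: contraTT iA => siA; move: (implyP (fixA _) siA) => /eqP /perm_inj H.
    by rewrite -H.
  rewrite -prodr_const [X in _ = X * _]big_mkcond -big_split /=; apply: eq_bigr => i _.
  by rewrite !mxE ffunE sA andbb; case: (i \in A); rewrite ?mul1r.
rewrite negb_imply => /andP[kA sk].
rewrite (bigD1 k) //= (bigD1 k (P := predT)) //= !mxE ffunE (negbTE kA) /= eq_sym (negbTE sk).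
by rewrite !mul0r mulr0.
Qed.

Section PrincipalMinors.
Variable a : nat.

Definition sites (x : config a) : {set 'I_a} :=
  [set p : 'I_a | [exists i, (x i : nat) == p.+1]].

(** The elements of [A] in decreasing order, as in a strict configuration, completed
    to an enumeration of all sites so as to be a permutation. *)
Definition arrangement (A : {set 'I_a}) : seq 'I_a :=
  rev (enum A) ++ enum (~: A).

Definition config_of (A : {set 'I_a}) : config a :=
  [ffun i : 'I_a => inord (if (i < #|A|)%N then (nth i (arrangement A) i).+1 else 0)].

Lemma size_arrangement A : size (arrangement A) = a.
Proof. by rewrite size_cat size_rev -!cardE cardsC card_ord. Qed.

Lemma arrangement_uniq A : uniq (arrangement A).
Proof.
rewrite cat_uniq rev_uniq !enum_uniq andbT /=; apply/hasPn => i.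
by rewrite mem_enum inE mem_rev mem_enum.
Qed.

Lemma mem_nth_arrangement A (i : 'I_a) :
  (nth i (arrangement A) i \in A) = (i < #|A|)%N.
Proof.
rewrite nth_cat size_rev -cardE; case: ltnP => iA.
  by rewrite -mem_enum -mem_rev mem_nth // size_rev -cardE.
have : nth i (enum (~: A)) (i - #|A|) \in ~: A.
  rewrite -mem_enum mem_nth // -cardE.
  move: (cardsC A) (ltn_ord i) iA; rewrite card_ord.
  by move: #|A| #|~: A| => u v; lia.
by rewrite in_setC => /negbTE ->.
Qed.

Lemma config_ofE A (i : 'I_a) :
  (config_of A i : nat) = if (i < #|A|)%N then (nth i (arrangement A) i).+1 else 0%N.
Proof. by rewrite ffunE inordK //; case: ifP => // _; rewrite ltnS ltn_ord. Qed.

Lemma sites_config_of A : sites (config_of A) = A.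
Proof.
apply/setP => p; rewrite inE; apply/existsP/idP => [[k]|pA].
  rewrite config_ofE; case: ltnP => // iA; rewrite eqSS => /eqP /val_inj <-.
  by rewrite mem_nth_arrangement.
have pe : p \in rev (enum A) by rewrite mem_rev mem_enum.
have ip : (index p (rev (enum A)) < #|A|)%N by rewrite cardE -size_rev index_mem.
have ia : (index p (rev (enum A)) < a)%N.
  by apply: (leq_trans ip); rewrite -[leqRHS]card_ord max_card.
exists (Ordinal ia); rewrite config_ofE /= ip nth_cat size_rev -cardE ip.
by rewrite nth_index.
Qed.

Lemma strict_config_of A : strict (config_of A).
Proof.
apply/strictP => i j ij; rewrite !config_ofE.
case: (ltnP j) => // jA; rewrite (ltn_trans ij jA) /=.
have srt : sorted (relpre (val : 'I_a -> nat) ltn) (enum A).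
  rewrite /enum_mem -enumT; apply: sorted_filter.
    by move=> u v t; apply: ltn_trans.
  by rewrite -sorted_map val_enum_ord iota_ltn_sorted.
rewrite !nth_cat !size_rev -!cardE jA (ltn_trans ij jA).
have {srt} : sorted (fun u v : 'I_a => (v < u)%N) (rev (enum A)) by rewrite rev_sorted.
have tr : transitive (fun u v : 'I_a => (v < u)%N).
  by move=> u v t vu tv; apply: ltn_trans tv vu.
move=> /(sorted_ltn_nth tr i) H; rewrite (set_nth_default i j) ?size_rev -?cardE //.
by apply: H => //; rewrite inE size_rev -cardE // (ltn_trans ij jA).
Qed.

Lemma sites_inj (x y : config a) : strict x -> strict y -> sites x = sites y -> x = y.
Proof.
move=> sx sy xy; apply/ffunP => i; apply: val_inj => /=.
have [n] := ubnP (i : nat); elim: n i => // n IH i; rewrite ltnS => le_in.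
wlog lt : x y sx sy xy IH / (y i < x i)%N.
  move=> H; case: (ltngtP (x i) (y i)) => // lt.
  - by apply/esym/H => // j jn; rewrite IH.
  - exact: H.
move: sx sy => /strictP sx /strictP sy.
have xia : ((x i).-1 < a)%N by have := ltn_ord (x i); lia.
have /existsP[j /eqP] : [exists j, (y j : nat) == (Ordinal xia).+1].
  have : Ordinal xia \in sites y.
    by rewrite -xy inE; apply/existsP; exists i => /=; rewrite prednK //; lia.
  by rewrite inE.
rewrite /= prednK; last by lia.
move=> yj; case: (ltngtP j i) => [ji|ij|/val_inj ji].
- by have xj := IH j (leq_trans ji le_in); move: (sx _ _ ji); rewrite xj yj; lia.
- by move: (sy _ _ ij); lia.
- by rewrite -ji yj; rewrite ji.
Qed.

Lemma config_ofK x : strict x -> config_of (sites x) = x.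
Proof.
move=> sx; apply: sites_inj => //; first exact: strict_config_of.
by rewrite sites_config_of.
Qed.

(** A strict configuration is the set of its occupied sites, and its matrix is
    a principal minor completed by the identity, up to one permutation applied to
    rows and columns simultaneously. *)
Lemma sum_strict_config_det (K : comNzRingType) (w : K) (r : nat) :
  \sum_(x : config a | strict x) w ^+ #|[pred i | (x i : nat) != 0%N]| * \det (config_mx K r x x) =
  \det (1%:M + w *: \matrix_(p < a, q < a) kern K r p.+1 q.+1).
Proof.
rewrite det_1_add_scale (reindex_onto config_of sites) => [|x sx]; last exact: config_ofK.
rewrite (eq_bigl predT) => [|A]; last by rewrite strict_config_of sites_config_of eqxx.
apply: eq_bigr => A _; set M := (X in _ = _ * \det X).
pose f (i : 'I_a) := nth i (arrangement A) i.
have fA i : (f i \in A) = (i < #|A|)%N by exact: mem_nth_arrangement.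
have f_inj : injective f.
  move=> i j /eqP; rewrite /f (set_nth_default j) ?size_arrangement //.
  by rewrite nth_uniq ?size_arrangement ?arrangement_uniq // => /eqP /val_inj.
congr (w ^+ _ * _).
  rewrite -[RHS](on_card_preimset (onW_bij _ (injF_bij f_inj))).
  apply: eq_card => i; rewrite !inE config_ofE -fA /f.
  by case: ifP.
rewrite -(det_mxsub_inj M f_inj); congr (\det _); apply/matrixP => i j.
rewrite !mxE /entry !config_ofE !fA (inj_eq f_inj).
case: (ltnP i) => iA; case: (ltnP j) => jA //=; rewrite kern0;
  rewrite (_ : (i == j) = false) //; apply/eqP => ij; move: iA jA; rewrite ij; lia.
Qed.
End PrincipalMinors.

(** * Plane partitions built from two arrays of heights *)

(** The pair of height arrays of a cyclically symmetric plane partition.  With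
    coordinates counted from [0], [y k e] is the number of points (j + e, j, k)
    with j >= k and [y' k e] the number of points (j, j + e, k) with j >= k.  The
    equality of supports is what the cyclic symmetry demands on the faces of the
    region where the last coordinate is minimal: (k + e, k, k) is a rotation of
    (k, k + e, k). *)
Record path_arrays (a : nat) (y y' : nat -> nat -> nat) : Prop := PathArrays {
  pa_step : forall k e, (y k e.+1 <= y k e <= (y k e.+1).+1)%N;
  pa_step' : forall k e, (y' k e.+1 <= y' k e <= (y' k e.+1).+1)%N;
  pa_strict : forall k e, (y k.+1 e <= (y k e).-1)%N;
  pa_strict' : forall k e, (y' k.+1 e <= (y' k e).-1)%N;
  pa_start : forall k, y k 0%N = y' k 0%N;
  pa_support : forall k e, (y k e == 0%N) = (y' k e == 0%N);
  pa_end : forall k e, (a <= e)%N -> y k e = 0%N }.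

Definition under_path (y y' : nat -> nat -> nat) (i j k : nat) : bool :=
  if (j <= i)%N then (j - k < y k (i - j))%N else (i - k < y' k (j - i))%N.

(** Membership of (i, j, k), decided after rotating a minimal coordinate into the
    last place. *)
Definition filled (y y' : nat -> nat -> nat) (i j k : nat) : bool :=
  if (k <= i)%N && (k <= j)%N then under_path y y' i j k
  else if (i <= j)%N then under_path y y' j k i
  else under_path y y' k i j.

Section PathArraysTheory.
Variables (a : nat) (y y' : nat -> nat -> nat).
Hypothesis V : path_arrays a y y'.

(** When two coordinates are minimal there are two rotations to choose from; the
    equality of supports makes them agree. *)
Lemma under_path_tie i k : (k <= i)%N -> under_path y y' i k k = under_path y y' k i k.
Proof.
rewrite /under_path subnn; case: (ltngtP k i) => // [_ _|-> _]; last by rewrite !subnn ?(pa_start V).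
by rewrite !lt0n (pa_support V).
Qed.

Lemma filled_rot i j k : filled y y' i j k = filled y y' j k i.
Proof.
rewrite /filled.
case: (ltngtP k i) => ki; case: (ltngtP k j) => kj; case: (ltngtP i j) => ij //=;
  try (by exfalso; move: ki kj ij; clear; lia); subst => //.
all: by rewrite under_path_tie // ltnW.
Qed.

Lemma filled_min i j k : (k <= i)%N -> (k <= j)%N -> filled y y' i j k = under_path y y' i j k.
Proof. by rewrite /filled => -> ->. Qed.

Lemma under_path_down1 i j k : (k <= i)%N -> (k <= j)%N ->
  under_path y y' i.+1 j k -> under_path y y' i j k.
Proof.
move=> ki kj; rewrite /under_path.
case: (ltngtP j i) => ij.
- have -> : (j <= i.+1)%N by lia.
  rewrite (subSn (ltnW ij)).
  by move/leq_trans; apply; case/andP: (pa_step V k (i - j)).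
- case: (ltngtP j i.+1) => ij'; first by exfalso; lia.
    rewrite subnS subSn //; have := pa_step' V k (j - i).-1.
    by rewrite prednK ?subn_gt0 //; lia.
  have := pa_step' V k 0; rewrite ij' subnn (pa_start V) subSnn; lia.
- by rewrite ij leqnSn subnn subSnn; have := pa_step V k 0; lia.
Qed.

Lemma under_path_down2 i j k : (k <= i)%N -> (k <= j)%N ->
  under_path y y' i j.+1 k -> under_path y y' i j k.
Proof.
move=> ki kj; rewrite /under_path.
case: (ltngtP j i) => ij.
- rewrite subnS subSn //; have := pa_step V k (i - j).-1.
  by rewrite prednK ?subn_gt0 //; lia.
- have := pa_step' V k (j - i).
  by rewrite -(subSn (ltnW ij)); lia.
- by subst; rewrite subnn subSnn; have := pa_step' V k 0; rewrite (pa_start V); lia.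
Qed.

Lemma under_path_down3 i j k : (k < i)%N -> (k < j)%N ->
  under_path y y' i j k.+1 -> under_path y y' i j k.
Proof.
move=> ki kj; rewrite /under_path; case: ifP => _.
  by have := pa_strict V k (i - j); lia.
by have := pa_strict' V k (j - i); lia.
Qed.

Lemma filled_down i j k : filled y y' i.+1 j k -> filled y y' i j k.
Proof.
case: (boolP ((k <= i.+1) && (k <= j))%N) => [/andP[ki kj]|nk].
  rewrite filled_min //; case: (leqP k i) => ki'.
    by rewrite filled_min //; apply: under_path_down1.
  have ek : k = i.+1 by lia.
  subst k; rewrite filled_rot filled_min; [|lia..].
  by rewrite -under_path_tie //; apply: under_path_down3.
case: (boolP ((j <= i.+1) && (j <= k))%N) => [/andP[ji jk]|nj].
  rewrite -filled_rot -[filled _ _ i j k]filled_rot filled_min //.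
  case: (leqP j i) => ji'; first by rewrite filled_min //; apply: under_path_down2.
  have ej : j = i.+1 by lia.
  subst j; rewrite filled_rot filled_rot filled_min; [|lia..].
  by rewrite under_path_tie //; apply: under_path_down3; lia.
rewrite filled_rot filled_min; [|lia..].
rewrite filled_rot filled_min; [|lia..].
by apply: under_path_down3; lia.
Qed.

(** A height loses at most one unit per step and vanishes at e = a, so it is at most
    [a - e]; strictness then bounds the later heights. *)
Lemma path_arrays_le k e : (y k e + k + e <= a)%N || (y k e == 0%N).
Proof.
have bound d l : (y l (a - d) <= d)%N.
  elim: d => [|d IH]; first by rewrite (pa_end V) // subn0.
  have [ad|da] := leqP a d.
    by rewrite (_ : a - d.+1 = a - d)%N; [lia|lia].
  by have := pa_step V l (a - d.+1); rewrite (_ : (a - d.+1).+1 = a - d)%N; lia.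
have [ae|ea] := leqP a e; first by rewrite (pa_end V) // orbT.
have le0 : (y 0%N e + e <= a)%N by have := bound (a - e)%N 0%N; rewrite subKn; lia.
have : (y k e + k <= y 0%N e)%N || (y k e == 0%N).
  elim: k => [|k IH]; first by rewrite addn0 leqnn.
  by have := pa_strict V k e; lia.
by lia.
Qed.

Lemma path_arrays_bound k e n : (n < y k e)%N -> (k + n + e < a)%N.
Proof. by have := path_arrays_le k e; lia. Qed.

End PathArraysTheory.

(** * Heights of a cyclically symmetric plane partition *)

(** The size of a bounded initial segment [P] of the integers is the first index
    outside [P]. *)
Lemma ltn_find_iota (P : pred nat) (a n : nat) :
  (forall n, P n.+1 -> P n) -> (forall n, P n -> (n < a)%N) ->
  (n < find (predC P) (iota 0 a))%N = P n.
Proof.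
move=> down bound; set f := find _ _.
have fa : (f <= a)%N by rewrite -[leqRHS](size_iota 0) find_size.
have downle m d : P (m + d)%N -> P m.
  by elim: d => [|d IH]; rewrite ?addn0 ?addnS // => /down.
apply/idP/idP => [nf|Pn].
  have na : (n < a)%N by exact: leq_trans nf fa.
  by have := before_find 0%N nf; rewrite nth_iota //= => /negbFE.
rewrite ltnNge; apply/negP => fn.
have Pf : P f by apply: (downle _ (n - f)%N); rewrite subnKC.
have fa' := bound _ Pf.
have := @nth_find _ 0%N (predC P) (iota 0 a); rewrite has_find size_iota => /(_ fa').
by rewrite nth_iota //= -/f Pf.
Qed.

Lemma leq_of_ltn (m n : nat) : (forall p, (p < m)%N -> (p < n)%N) -> (m <= n)%N.
Proof. by move=> H; rewrite leqNgt; apply/negP => /H; rewrite ltnn. Qed.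

Section HeightsOfCSPP.
Variables (a : nat) (pi : {fset point}).

Definition height (k e : nat) : nat :=
  find (fun n => ((k + n + e).+1, (k + n).+1, k.+1) \notin pi) (iota 0 a).
Definition coheight (k e : nat) : nat :=
  find (fun n => ((k + n).+1, (k + n + e).+1, k.+1) \notin pi) (iota 0 a).

Hypothesis pi_CSPP : pi \in CSPP a.

Lemma CSPP_bound i j k : (i.+1, j.+1, k.+1) \in pi -> [/\ i < a, j < a & k < a]%N.
Proof. by have [_ B _] := (CSPPP a pi).1 pi_CSPP; exact: B. Qed.

Lemma CSPP_down i j k i' j' k' : (i' <= i)%N -> (j' <= j)%N -> (k' <= k)%N ->
  (i.+1, j.+1, k.+1) \in pi -> (i'.+1, j'.+1, k'.+1) \in pi.
Proof.
have [[_ D] _ _] := (CSPPP a pi).1 pi_CSPP.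
by move=> ? ? ? H; apply: (D _ _ _ _ _ _ H).
Qed.

Lemma CSPP_rot i j k : ((i, j, k) \in pi) = ((j, k, i) \in pi).
Proof.
have [_ _ C] := (CSPPP a pi).1 pi_CSPP.
by apply/idP/idP => [/C|/C /C].
Qed.

Lemma ltn_height k e n : (n < height k e)%N = (((k + n + e).+1, (k + n).+1, k.+1) \in pi).
Proof.
rewrite /height.
rewrite (eq_find (a2 := predC (fun n => ((k + n + e).+1, (k + n).+1, k.+1) \in pi))) //.
rewrite (ltn_find_iota (P := fun n => ((k + n + e).+1, (k + n).+1, k.+1) \in pi)) //.
  by move=> m; apply: CSPP_down; lia.
by move=> m /CSPP_bound[]; lia.
Qed.

Lemma ltn_coheight k e n : (n < coheight k e)%N = (((k + n).+1, (k + n + e).+1, k.+1) \in pi).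
Proof.
rewrite /coheight.
rewrite (eq_find (a2 := predC (fun n => ((k + n).+1, (k + n + e).+1, k.+1) \in pi))) //.
rewrite (ltn_find_iota (P := fun n => ((k + n).+1, (k + n + e).+1, k.+1) \in pi)) //.
  by move=> m; apply: CSPP_down; lia.
by move=> m /CSPP_bound[]; lia.
Qed.

Lemma height_path_arrays : path_arrays a height coheight.
Proof.
split.
- move=> k e; apply/andP; split; apply: leq_of_ltn => p.
    by rewrite !ltn_height; apply: CSPP_down; lia.
  case: p => [|p] //; rewrite ltnS !ltn_height; apply: CSPP_down; lia.
- move=> k e; apply/andP; split; apply: leq_of_ltn => p.
    by rewrite !ltn_coheight; apply: CSPP_down; lia.
  case: p => [|p] //; rewrite ltnS !ltn_coheight; apply: CSPP_down; lia.
- move=> k e.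
  have H p : (p < height k.+1 e -> p.+1 < height k e)%N.
    by rewrite !ltn_height; apply: CSPP_down; lia.
  by apply: leq_of_ltn => p /H; lia.
- move=> k e.
  have H p : (p < coheight k.+1 e -> p.+1 < coheight k e)%N.
    by rewrite !ltn_coheight; apply: CSPP_down; lia.
  by apply: leq_of_ltn => p /H; lia.
- by move=> k; rewrite /height /coheight; apply: eq_find => n; rewrite addn0.
- move=> k e; apply: negb_inj; rewrite -!lt0n ltn_height ltn_coheight !addn0.
  by rewrite CSPP_rot CSPP_rot.
move=> k e ae; apply/eqP; rewrite -leqn0; apply: leq_of_ltn => p.
by rewrite ltn_height => /CSPP_bound[]; lia.
Qed.

(** The points with minimal last coordinate determine the plane partition. *)
Lemma filled_height i j k : filled height coheight i j k = ((i.+1, j.+1, k.+1) \in pi).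
Proof.
have min3 u v w : (w <= u)%N -> (w <= v)%N ->
    filled height coheight u v w = ((u.+1, v.+1, w.+1) \in pi).
  move=> wu wv; rewrite filled_min // /under_path ltn_height ltn_coheight.
  case: (leqP v u) => uv.
    have -> : (w + (v - w) + (u - v) = u)%N by lia.
    by rewrite subnKC.
  have -> : (w + (u - w) + (v - u) = v)%N by lia.
  by rewrite subnKC // ltnW.
have [/andP[ki kj]|nk] := boolP ((k <= i) && (k <= j))%N; first exact: min3.
have [/andP[ji jk]|nj] := boolP ((j <= i) && (j <= k))%N.
  rewrite -(filled_rot height_path_arrays) -CSPP_rot; exact: min3.
by rewrite (filled_rot height_path_arrays) CSPP_rot; apply: min3; lia.
Qed.

Lemma m1_height : m1 pi = #|[pred k : 'I_a | height k 0 != 0%N]|.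
Proof.
pose diag (k : 'I_a) : point := (k.+1, k.+1, k.+1).
have diag_inj : injective diag by move=> k l [] /val_inj.
transitivity #|` [fset diag k | k in [pred k : 'I_a | height k 0 != 0%N]]%fset|; last first.
  rewrite card_imfset //= -cardE.
  by [].
rewrite /m1; congr #|` _|; apply/fsetP => -[[i j] k].
rewrite !inE /=; apply/andP/imfsetP => [[ijk /andP[/eqP ij /eqP jk]]|].
  subst j k.
  have [[pos _] _ _] := (CSPPP a pi).1 pi_CSPP.
  have [i0 _ _] := pos _ _ _ ijk.
  case: i i0 ijk => // i _ ijk; have [ia _ _] := CSPP_bound ijk.
  exists (Ordinal ia) => //; suff : height i 0 != 0%N by [].
  by rewrite -lt0n ltn_height !addn0.
case=> l lP [-> -> ->]; have {}lP : height l 0 != 0%N by [].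
by rewrite !eqxx; move: lP; rewrite -lt0n ltn_height !addn0.
Qed.
End HeightsOfCSPP.

(** * The plane partition of two height arrays *)

(** Reflection in the plane where the first two coordinates agree. *)
Lemma path_arrays_sym a y y' : path_arrays a y y' -> path_arrays a y' y.
Proof.
case=> s s' t t' st su en; split=> //.
by move=> k e ae; apply/eqP; rewrite -su en.
Qed.

Lemma filled_swap y y' i j k : y k 0%N = y' k 0%N -> (k <= i)%N -> (k <= j)%N ->
  filled y y' i j k = filled y' y j i k.
Proof.
move=> y0 ki kj; rewrite !filled_min // /under_path.
by case: (ltngtP i j) => // ->; rewrite subnn y0.
Qed.

Section CSPPOfPathArrays.
Variables (a : nat) (y y' : nat -> nat -> nat).
Hypothesis V : path_arrays a y y'.

Definition stack : {fset point} :=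
  [fset p in box a | filled y y' p.1.1.-1 p.1.2.-1 p.2.-1]%fset.

Lemma filled_bound i j k : filled y y' i j k -> [/\ i < a, j < a & k < a]%N.
Proof.
have min3 u v w : (w <= u)%N -> (w <= v)%N -> filled y y' u v w ->
    [/\ u < a, v < a & w < a]%N.
  move=> wu wv; rewrite filled_min // /under_path; case: (leqP v u) => uv H.
    by have := path_arrays_bound V H; split; lia.
  by have := path_arrays_bound (path_arrays_sym V) H; split; lia.
have [/andP[ki kj]|nk] := boolP ((k <= i) && (k <= j))%N; first exact: min3.
have [/andP[ji jk]|nj] := boolP ((j <= i) && (j <= k))%N.
  by rewrite -(filled_rot V) => /min3[].
by rewrite (filled_rot V) => /min3[] //; lia.
Qed.

Lemma mem_stack i j k : ((i.+1, j.+1, k.+1) \in stack) = filled y y' i j k.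
Proof.
rewrite in_fset inE /= mem_box /=. apply/andP/idP => [[]//|H]; split => //.
by have [-> -> ->] := filled_bound H.
Qed.

Lemma filled_leq i j k i' j' k' : (i' <= i)%N -> (j' <= j)%N -> (k' <= k)%N ->
  filled y y' i j k -> filled y y' i' j' k'.
Proof.
have down u v w d : filled y y' (u + d) v w -> filled y y' u v w.
  by elim: d => [|d IH]; rewrite ?addn0 ?addnS // => /(filled_down V).
have down1 u v w u' : (u' <= u)%N -> filled y y' u v w -> filled y y' u' v w.
  by move=> /subnKC <-; apply: down.
move=> ii jj kk; move=> /(down1 _ _ _ _ ii).
rewrite (filled_rot V) => /(down1 _ _ _ _ jj).
rewrite (filled_rot V) => /(down1 _ _ _ _ kk).
by rewrite (filled_rot V).
Qed.

Lemma stack_CSPP : stack \in CSPP a.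
Proof.
have pos i j k : (i, j, k) \in stack -> [/\ (0 < i <= a)%N, (0 < j <= a)%N & (0 < k <= a)%N].
  by rewrite in_fset inE /= mem_box => /andP[/and3P[]].
apply/CSPPP; split; first split.
- by move=> i j k /pos[/andP[-> _] /andP[-> _] /andP[-> _]].
- move=> i j k i' j' k' H.
  have [/andP[i0 _] /andP[j0 _] /andP[k0 _]] := pos _ _ _ H.
  case: i i0 H => // i _; case: j j0 => // j _; case: k k0 => // k _ H.
  case: i' => // i'; case: j' => // j'; case: k' => // k' /= ii jj kk.
  by move: H; rewrite !mem_stack; apply: filled_leq.
- by move=> i j k /pos[/andP[_ ->] /andP[_ ->] /andP[_ ->]].
move=> i j k H.
have [/andP[i0 _] /andP[j0 _] /andP[k0 _]] := pos _ _ _ H.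
case: i i0 H => // i _; case: j j0 => // j _; case: k k0 => // k _.
by rewrite !mem_stack (filled_rot V).
Qed.

Lemma height_stack k e : height a stack k e = y k e.
Proof.
have H n : (n < height a stack k e)%N = (n < y k e)%N.
  rewrite (ltn_height stack_CSPP) mem_stack filled_min /under_path; [|lia..].
  have -> : (k + n <= k + n + e)%N by lia.
  by congr (_ < y k _)%N; lia.
by apply/eqP; rewrite eqn_leq; apply/andP; split; apply: leq_of_ltn => n; rewrite H.
Qed.

Lemma coheight_stack k e : coheight a stack k e = y' k e.
Proof.
have H n : (n < coheight a stack k e)%N = (n < y' k e)%N.
  rewrite (ltn_coheight stack_CSPP) mem_stack (filled_swap (pa_start V k)); [|lia..].
  rewrite filled_min /under_path; [|lia..].
  have -> : (k + n <= k + n + e)%N by lia.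
  by congr (_ < y' k _)%N; lia.
by apply/eqP; rewrite eqn_leq; apply/andP; split; apply: leq_of_ltn => n; rewrite H.
Qed.
End CSPPOfPathArrays.

(** * Plane partitions as pairs of families of paths *)

Section FamilySequences.
Variable a : nat.
Local Notation pair := (config a * config a)%type.

Definition pair_step (c d : pair) :=
  [&& step c.1 d.1, strict d.1, step c.2 d.2, strict d.2 & same_support d.1 d.2].

Definition pair_vacuum : pair := (vacuum a, vacuum a).

(** The objects counted by [families], listed explicitly. *)
Fixpoint descents (r : nat) (c : pair) : seq (seq pair) :=
  if r is r'.+1 then
    [seq d :: t | d <- enum [pred d | pair_step c d], t <- descents r' d]
  else if c == pair_vacuum then [:: [::]] else [::].

Lemma sum_descents (K : comNzRingType) r (x y : config a) :
  families K r x y = \sum_(t <- descents r (x, y)) 1.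
Proof.
elim: r x y => [|r IH] x y /=.
  by rewrite -pair_eqE /=; case: ifP => _; rewrite ?big_nil ?big_seq1.
under eq_bigr => z _ do under eq_bigr => v _ do rewrite IH.
rewrite pair_big_dep big_allpairs_dep big_enum /=.
apply: eq_big => [[z w]|[z w] _] //=.
by rewrite inE /pair_step /= -!andbA.
Qed.

Lemma mem_descents r c t :
  (t \in descents r c) = [&& size t == r, path pair_step c t & last c t == pair_vacuum].
Proof.
elim: r c t => [|r IH] c t /=.
  by case: ifP => cv; rewrite inE; case: t => [|d t] //=; rewrite ?cv ?andbF.
apply/allpairsPdep/idP => [[d [s [cd ds ->]]]|].
  by move: cd ds; rewrite mem_enum inE IH /= eqSS => -> /and3P[-> -> ->].
case: t => [|d t] //=; rewrite eqSS => /and3P[st /andP[cd dt] lt].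
by exists d, t; rewrite mem_enum inE IH st dt lt.
Qed.

Lemma descents_uniq r c : uniq (descents r c).
Proof.
elim: r c => [|r IH] c /=; first by case: ifP.
apply: allpairs_uniq_dep => //; first exact: enum_uniq.
by move=> [d t] [d' t'] _ _ /= [-> ->].
Qed.

Definition all_descents : seq (seq pair) :=
  [seq (x, x) :: t | x <- enum [pred x : config a | strict x], t <- descents a (x, x)].

Lemma all_descents_uniq : uniq all_descents.
Proof.
apply: allpairs_uniq_dep => [|x _|]; [exact: enum_uniq|exact: descents_uniq|].
by move=> [d t] [d' t'] _ _ /= [-> _ ->].
Qed.

(** A configuration extended by [0] beyond [a], so as to be compared with height
    arrays. *)
Definition occupation (x : config a) (k : nat) : nat :=
  if insub k is Some i then x i else 0%N.

Lemma occupationE (x : config a) (i : 'I_a) : occupation x i = x i.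
Proof. by rewrite /occupation valK. Qed.

Lemma occupation0 (x : config a) k : (a <= k)%N -> occupation x k = 0%N.
Proof. by move=> ak; rewrite /occupation insubF // ltnNge ak. Qed.

Definition left_array (s : seq pair) (k e : nat) := occupation (nth pair_vacuum s e).1 k.
Definition right_array (s : seq pair) (k e : nat) := occupation (nth pair_vacuum s e).2 k.

Lemma occupation_vacuum k : occupation (vacuum a) k = 0%N.
Proof. by rewrite /occupation; case: insubP => // i _ _; rewrite ffunE. Qed.

Lemma strict_occupation x k : strict x -> (occupation x k.+1 <= (occupation x k).-1)%N.
Proof.
move=> /strictP sx; have [ak|ka] := leqP a k.+1; first by rewrite occupation0.
by rewrite (occupationE x (Ordinal ka)) (occupationE x (Ordinal (ltnW ka))); apply: sx => /=.
Qed.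

Lemma step_occupation x z k : step x z ->
  (occupation z k <= occupation x k <= (occupation z k).+1)%N.
Proof.
move=> /stepP xz; have [ak|ka] := leqP a k; first by rewrite !occupation0.
by rewrite !(occupationE _ (Ordinal ka)).
Qed.

Lemma same_support_occupation x z k : same_support x z ->
  (occupation x k == 0%N) = (occupation z k == 0%N).
Proof.
move=> /same_supportP xz; have [ak|ka] := leqP a k; first by rewrite !occupation0.
by rewrite !(occupationE _ (Ordinal ka)).
Qed.

Lemma all_descents_path_arrays s : s \in all_descents ->
  size s = a.+1 /\ path_arrays a (left_array s) (right_array s).
Proof.
move=> /allpairsPdep[x [t [+ + ->]]]; rewrite mem_enum inE mem_descents.
move=> sx /and3P[/eqP st pt /eqP lt]; split; first by rewrite /= st.
have nth_step e : (e < a)%N ->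
    pair_step (nth pair_vacuum ((x, x) :: t) e) (nth pair_vacuum ((x, x) :: t) e.+1).
  by move=> ea; have := pathP pair_vacuum pt e; rewrite st; apply.
have nth_end e : (a <= e)%N -> nth pair_vacuum ((x, x) :: t) e = pair_vacuum.
  rewrite leq_eqVlt => /orP[/eqP ea|ae]; last by rewrite nth_default //= st.
  rewrite -ea (_ : nth _ _ a = nth pair_vacuum ((x, x) :: t) (size t)); last by rewrite st.
  by rewrite -last_nth lt.
have nth_ok e : let c := nth pair_vacuum ((x, x) :: t) e in
    [/\ strict c.1, strict c.2 & same_support c.1 c.2].
  case: e => [|e] /=; first by split => //; apply/same_supportP.
  have [ea|ae] := ltnP e a; first by have /and5P[] := nth_step e ea.
  have -> : nth pair_vacuum t e = pair_vacuum by apply: (nth_end e.+1); apply: leqW.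
  by split; [apply/strictP => i j; rewrite !ffunE..|apply/same_supportP].
split.
- move=> k e; rewrite /left_array; have [ea|ae] := ltnP e a.
    by apply: step_occupation; have /and5P[] := nth_step e ea.
  by rewrite !nth_end ?occupation_vacuum // leqW.
- move=> k e; rewrite /right_array; have [ea|ae] := ltnP e a.
    by apply: step_occupation; have /and5P[] := nth_step e ea.
  by rewrite !nth_end ?occupation_vacuum // leqW.
- by move=> k e; apply: strict_occupation; have [] := nth_ok e.
- by move=> k e; apply: strict_occupation; have [] := nth_ok e.
- by [].
- by move=> k e; apply: same_support_occupation; have [] := nth_ok e.
- by move=> k e ae; rewrite /left_array nth_end // occupation_vacuum.
Qed.

Lemma occupation_strict x :
  (forall k, occupation x k.+1 <= (occupation x k).-1)%N -> strict x.
Proof.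
move=> H; apply/strictP => i j ij; rewrite -!occupationE -(subnKC ij).
elim: (j - i.+1)%N => [|d IH]; first by rewrite addn0.
by rewrite addnS; apply: leq_trans (H _) _; apply: leq_trans (leq_pred _) IH.
Qed.

Lemma occupation_inj x z : occupation x =1 occupation z -> x = z.
Proof. by move=> xz; apply/ffunP => i; apply: val_inj; rewrite /= -!occupationE xz. Qed.

Lemma path_arrays_all_descents s : size s = a.+1 ->
  path_arrays a (left_array s) (right_array s) -> s \in all_descents.
Proof.
move=> ss V.
have sc e : strict (nth pair_vacuum s e).1 /\ strict (nth pair_vacuum s e).2.
  by split; apply: occupation_strict => k; [apply: (pa_strict V)|apply: (pa_strict' V)].
have st e : pair_step (nth pair_vacuum s e) (nth pair_vacuum s e.+1).
  have [s1 s2] := sc e.+1; apply/and5P; split => //.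
  - by apply/stepP => i; rewrite -!occupationE; apply: (pa_step V).
  - by apply/stepP => i; rewrite -!occupationE; apply: (pa_step' V).
  - by apply/same_supportP => i; rewrite -!occupationE; apply: (pa_support V).
have V0 := pa_start V.
have Vend : nth pair_vacuum s a = pair_vacuum.
  have o1 k : occupation (nth pair_vacuum s a).1 k = 0%N by apply: (pa_end V).
  have o2 k : occupation (nth pair_vacuum s a).2 k = 0%N.
    by apply/eqP; rewrite -(pa_support V k a) (pa_end V).
  rewrite [LHS]surjective_pairing; congr (_, _); apply: occupation_inj => k.
    by rewrite o1 occupation_vacuum.
  by rewrite o2 occupation_vacuum.
case: s ss {V} sc st V0 Vend => //= -[x x'] t [st] sc sp V0 Vend.
have xx' : x = x' by apply: occupation_inj => k; apply: V0.
rewrite -xx' in sp Vend *.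
apply/allpairsPdep; exists x, t; rewrite mem_enum inE mem_descents st eqxx.
split => //; first by have [] := sc 0%N.
rewrite /=; apply/andP; split; first by apply/(pathP pair_vacuum) => e _; apply: sp.
by rewrite (last_nth pair_vacuum) st Vend.
Qed.

(** The plane sections at distance [e] on both sides of the plane where the first two
    coordinates agree. *)
Definition slice (pi : {fset point}) (e : nat) : pair :=
  ([ffun k : 'I_a => inord (height a pi k e)], [ffun k : 'I_a => inord (coheight a pi k e)]).

Definition slices (pi : {fset point}) : seq pair := mkseq (slice pi) a.+1.

Lemma height_le pi k e : (height a pi k e <= a)%N.
Proof. by rewrite -[leqRHS](size_iota 0) find_size. Qed.

Lemma coheight_le pi k e : (coheight a pi k e <= a)%N.
Proof. by rewrite -[leqRHS](size_iota 0) find_size. Qed.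

Lemma left_array_slices pi k e : pi \in CSPP a -> left_array (slices pi) k e = height a pi k e.
Proof.
move=> piC; have V := height_path_arrays piC; rewrite /left_array.
have [ea|ae] := ltnP e a.+1; last first.
  by rewrite nth_default ?size_mkseq // occupation_vacuum (pa_end V) // ltnW.
rewrite nth_mkseq //; have [ak|ka] := leqP a k.
  by rewrite occupation0 //; have := path_arrays_le V k e; lia.
by rewrite (occupationE _ (Ordinal ka)) ffunE inordK // ltnS height_le.
Qed.

Lemma right_array_slices pi k e : pi \in CSPP a -> right_array (slices pi) k e = coheight a pi k e.
Proof.
move=> piC; have V := path_arrays_sym (height_path_arrays piC); rewrite /right_array.
have [ea|ae] := ltnP e a.+1; last first.
  by rewrite nth_default ?size_mkseq // occupation_vacuum (pa_end V) // ltnW.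
rewrite nth_mkseq //; have [ak|ka] := leqP a k.
  by rewrite occupation0 //; have := path_arrays_le V k e; lia.
by rewrite (occupationE _ (Ordinal ka)) ffunE inordK // ltnS coheight_le.
Qed.

Lemma path_arrays_ext (y1 y2 z1 z2 : nat -> nat -> nat) :
  (forall k e, y1 k e = z1 k e) -> (forall k e, y2 k e = z2 k e) ->
  path_arrays a y1 y2 -> path_arrays a z1 z2.
Proof.
move=> E1 E2 [h1 h2 h3 h4 h5 h6 h7].
by split=> *; rewrite -?E1 -?E2; auto.
Qed.

Lemma slices_stack s : s \in all_descents ->
  slices (stack a (left_array s) (right_array s)) = s.
Proof.
move=> sA; have [ss V] := all_descents_path_arrays sA.
have C := stack_CSPP V.
apply: (@eq_from_nth _ pair_vacuum); first by rewrite size_mkseq ss.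
move=> e _; rewrite [LHS]surjective_pairing [RHS]surjective_pairing.
congr (_, _); apply: occupation_inj => k.
  by have := left_array_slices k e C; rewrite (height_stack V).
by have := right_array_slices k e C; rewrite (coheight_stack V).
Qed.

Lemma slices_inj : {in CSPP a &, injective slices}.
Proof.
move=> pi pi' C C' E.
have H k e : height a pi k e = height a pi' k e.
  by rewrite -!left_array_slices // E.
have H' k e : coheight a pi k e = coheight a pi' k e.
  by rewrite -!right_array_slices // E.
have [[pos _] _ _] := (CSPPP a pi).1 C; have [[pos' _] _ _] := (CSPPP a pi').1 C'.
apply/fsetP => -[[[|i] j] k]; first by apply/idP/idP => [/pos[]|/pos'[]].
case: j => [|j]; first by apply/idP/idP => [/pos[]|/pos'[]].
case: k => [|k]; first by apply/idP/idP => [/pos[]|/pos'[]].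
by rewrite -(filled_height C) -(filled_height C') /filled /under_path !H !H'.
Qed.

(** Slicing is a bijection: [filled_height] gives injectivity and [stack] a preimage
    of every sequence of slices. *)
Lemma perm_slices : perm_eq [seq slices pi | pi <- CSPP a] all_descents.
Proof.
apply: uniq_perm.
- by rewrite map_inj_in_uniq ?fset_uniq //; apply: slices_inj.
- exact: all_descents_uniq.
move=> s; apply/mapP/idP => [[pi piC ->]|sA].
  apply: path_arrays_all_descents; first by rewrite size_mkseq.
  apply: path_arrays_ext (height_path_arrays piC) => k e.
    by rewrite left_array_slices.
  by rewrite right_array_slices.
have [ss V] := all_descents_path_arrays sA.
exists (stack a (left_array s) (right_array s)); first exact: stack_CSPP.
by rewrite slices_stack.
Qed.

Lemma weighted_count_families (K : comNzRingType) (w : K) :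
  weighted_count w a =
  \sum_(x : config a | strict x) w ^+ #|[pred i | (x i : nat) != 0%N]| * families K a x x.
Proof.
transitivity (\sum_(s <- all_descents)
    w ^+ #|[pred i | (nth pair_vacuum s 0).1 i != 0%N :> nat]|).
  rewrite -(perm_big _ perm_slices) big_map; rewrite /weighted_count big_seq [RHS]big_seq.
  apply: eq_bigr => pi piC; rewrite (m1_height piC); congr (w ^+ _).
  apply: eq_card => k; rewrite !inE -(left_array_slices _ _ piC).
  by rewrite /left_array occupationE.
rewrite big_allpairs_dep big_enum; apply: eq_big => [x|x _]; first by rewrite inE.
by rewrite sum_descents mulr_sumr; apply: eq_bigr => t _; rewrite mulr1.
Qed.

End FamilySequences.

(** The [s] of [kernE] is the row index of the Pascal matrix: the entries of
    P^T P are the sums over [s] of C(s, p) C(s, q). *)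
Theorem weighted_count_det (K : comNzRingType) (w : K) (a : nat) :
  let P := \matrix_(s < a, p < a) ('C(s, p)%:R : K) in
  weighted_count w a = \det (1%:M + w *: (P^T *m P)).
Proof.
rewrite /= weighted_count_families.
transitivity (\sum_(x : config a | strict x)
   w ^+ #|[pred i | (x i : nat) != 0%N]| * \det (config_mx K a x x)).
  apply: eq_bigr => x sx; rewrite families_det //.
  by apply/same_supportP.
rewrite sum_strict_config_det; congr (\det (_ + w *: _)).
apply/matrixP => p q; rewrite !mxE kernE; apply: eq_bigr => s _.
by rewrite !mxE.
Qed.

(** * A form for which a first order operator is self-adjoint *)

Section BilinearForm.
Variable K : numFieldType.
Implicit Types f g h q r : {poly K}.

Definition dot f h : K := \sum_(k < size f) f`_k * h`_k.

Lemma dot_widen n f h : (size f <= n)%N -> dot f h = \sum_(k < n) f`_k * h`_k.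
Proof.
move=> fn; rewrite /dot (big_ord_widen n (fun k => f`_k * h`_k)) // big_mkcond.
by apply: eq_bigr => k _; case: ltnP => // kf; rewrite nth_default ?mul0r.
Qed.

Lemma dotC f h : dot f h = dot h f.
Proof.
rewrite (@dot_widen (maxn (size f) (size h))) ?leq_maxl //.
rewrite (@dot_widen (maxn (size f) (size h)) h) ?leq_maxr //.
by apply: eq_bigr => k _; rewrite mulrC.
Qed.

Lemma dotD f g h : dot f (g + h) = dot f g + dot f h.
Proof. by rewrite /dot -big_split; apply: eq_bigr => k _; rewrite coefD mulrDr. Qed.

Lemma dotZ c f h : dot f (c *: h) = c * dot f h.
Proof. by rewrite /dot mulr_sumr; apply: eq_bigr => k _; rewrite coefZ mulrCA. Qed.

Lemma dot1 f : dot f 1 = f.[0].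
Proof.
rewrite horner_coef0 (@dot_widen (size f).+1) // big_ord_recl coef1 mulr1 big1 ?addr0 //.
by move=> k _; rewrite coef1 mulr0.
Qed.

(** The operators in question are the symmetric tridiagonal matrices with
    off-diagonal entries 1, 2, 3, ... and arbitrary diagonal. *)
Lemma jacobi_self_adjoint (c : nat -> K) (D : {poly K} -> {poly K}) :
  (forall f k, (D f)`_k = k%:R * f`_k.-1 + c k * f`_k + k.+1%:R * f`_k.+1) ->
  forall f h, dot (D f) h = dot f (D h).
Proof.
move=> coefD f h.
pose n := maxn (maxn (size f) (size h)) (size (D f)).
have fn : (size f <= n)%N by rewrite !leq_max leqnn.
have hn : (size h <= n)%N by rewrite !leq_max leqnn orbT.
have Dn : (size (D f) <= n)%N by rewrite !leq_max leqnn !orbT.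
have f0 : f`_n = 0 by rewrite nth_default.
have h0 : h`_n = 0 by rewrite nth_default.
rewrite !(@dot_widen n.+1) ?leqW //.
under eq_bigr do rewrite coefD !mulrDl.
under [RHS]eq_bigr do rewrite coefD !mulrDr.
rewrite !big_split /= -addrA [RHS]addrC [X in _ = _ + X]addrC; congr (_ + _).
  rewrite big_ord_recl big_ord_recr /= f0 !mul0r add0r addr0.
  by apply: eq_bigr => k _; rewrite /bump /= !add1n /= mulrCA mulrA.
congr (_ + _); first by apply: eq_bigr => k _ /=; ring.
rewrite big_ord_recr [RHS]big_ord_recl /= h0 !mul0r !mulr0 add0r addr0.
by apply: eq_bigr => k _; rewrite /bump /= !add1n /=; ring.
Qed.

Lemma coef_derivM f k : f^`()`_k = k.+1%:R * f`_k.+1.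
Proof. by rewrite coef_deriv mulr_natl. Qed.

(** The zeros of X^2 - X + 1 are the points where this operator is a multiplication
    by a scalar; the term X f makes its matrix symmetric. *)
Definition raise f : {poly K} := ('X^2 - 'X + 1) * f^`() + 'X * f.

Lemma coef_raise f k : (raise f)`_k = k%:R * f`_k.-1 + (- k%:R) * f`_k + k.+1%:R * f`_k.+1.
Proof.
rewrite /raise !(mulrDl, coefD, mulNr, coefN, mul1r) expr2 -mulrA !coefXM.
by case: k => [|[|k]] /=; rewrite ?coef_derivM -?natr1; ring.
Qed.

Lemma raise_self_adjoint f h : dot (raise f) h = dot f (raise h).
Proof. exact: (jacobi_self_adjoint coef_raise). Qed.

Lemma comp_poly1 f : 1 \Po f = 1.
Proof. by rewrite -polyC1 comp_polyC. Qed.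

(** Under X -> X + 1 the operator becomes (X^2 + X + 1) f' + (X + 1) f, whose matrix
    differs from that of [raise] only on the diagonal. *)
Lemma raise_shift_self_adjoint f h :
  dot (raise f \Po ('X + 1)) (h \Po ('X + 1)) = dot (f \Po ('X + 1)) (raise h \Po ('X + 1)).
Proof.
pose D g : {poly K} := ('X^2 + 'X + 1) * g^`() + ('X + 1) * g.
have raiseE g : raise g \Po ('X + 1) = D (g \Po ('X + 1)).
  rewrite /raise /D deriv_comp derivD derivX derivC addr0 mulr1.
  rewrite expr2 !(comp_polyB, comp_polyD, comp_polyM, comp_polyX) comp_poly1.
  by ring.
rewrite !raiseE; apply: (@jacobi_self_adjoint (fun k => k.+1%:R)) => g k.
rewrite /D !(mulrDl, coefD, mul1r) expr2 -mulrA !coefXM.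
by case: k => [|[|k]] /=; rewrite ?coef_derivM -?natr1; ring.
Qed.

Variable w : K.

Definition form f h : K := dot f h + w * dot (f \Po ('X + 1)) (h \Po ('X + 1)).

Lemma formD f g h : form f (g + h) = form f g + form f h.
Proof. by rewrite /form rmorphD /= !dotD; ring. Qed.

Lemma formZ c f h : form f (c *: h) = c * form f h.
Proof. by rewrite /form linearZ /= !dotZ; ring. Qed.

Lemma formC f h : form f h = form h f.
Proof. by rewrite /form dotC [X in _ + _ * X]dotC. Qed.

Lemma form1 f : form f 1 = f.[0] + w * f.[1].
Proof. by rewrite /form rmorph1 !dot1 horner_comp !hornerE. Qed.

Lemma form_raise f h : form (raise f) h = form f (raise h).
Proof. by rewrite /form raise_self_adjoint raise_shift_self_adjoint. Qed.

Definition pascal n : 'M[K]_n := \matrix_(s, p) 'C(s, p)%:R.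
Definition form_mx n : 'M[K]_n := 1%:M + w *: (pascal n *m (pascal n)^T).

Lemma coefXaddn1 i k : ((('X : {poly K}) + 1) ^+ i)`_k = 'C(i, k)%:R.
Proof.
elim: i k => [|i IH] [|k]; rewrite ?expr0 ?coef1 ?bin0 ?bin0n //.
  by rewrite exprS mulrDl mul1r coefD coefXM IH bin0 add0r.
by rewrite exprS mulrDl mul1r coefD coefXM /= !IH binS natrD addrC.
Qed.

Lemma coef_comp_Xadd1 n f k : (size f <= n)%N ->
  (f \Po ('X + 1))`_k = \sum_(i < n) f`_i * 'C(i, k)%:R.
Proof.
move=> fn; rewrite comp_polyE coef_sum (big_ord_widen n
  (fun i => (f`_i *: ('X + 1) ^+ i)`_k)) // big_mkcond.
apply: eq_bigr => i _; rewrite coefZ coefXaddn1; case: ltnP => // fi.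
by rewrite nth_default ?mul0r.
Qed.

Lemma size_comp_Xadd1 n f : (size f <= n)%N -> (size (f \Po ('X + 1)) <= n)%N.
Proof.
by move=> fn; rewrite size_comp_poly2 // -polyC1 size_XaddC.
Qed.

(** The Pascal matrix is the matrix of the substitution X -> X + 1. *)
Lemma form_mxE n (f h : 'I_n -> {poly K}) :
  (forall i, size (f i) <= n)%N -> (forall i, size (h i) <= n)%N ->
  \matrix_(i, j) form (f i) (h j) =
  (\matrix_(i, k) (f i)`_k) *m form_mx n *m (\matrix_(i, k) (h i)`_k)^T.
Proof.
move=> fn hn; set A := \matrix_(i, k) _; set B := \matrix_(i, k) _.
rewrite /form_mx mulmxDr mulmxDl mulmx1 -scalemxAr -scalemxAl.
rewrite mulmxA -[_ *m pascal n *m _ *m _]mulmxA -trmx_mul.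
have AP (C : 'I_n -> {poly K}) i k : (forall i, size (C i) <= n)%N ->
    ((\matrix_(i, k) (C i)`_k) *m pascal n) i k = (C i \Po ('X + 1))`_k.
  move=> Cn; rewrite !mxE (@coef_comp_Xadd1 n) //; apply: eq_bigr => l _.
  by rewrite !mxE.
apply/matrixP => i j; rewrite [LHS]mxE [RHS]mxE /form; congr (_ + _).
  by rewrite (@dot_widen n) // !mxE; apply: eq_bigr => k _; rewrite !mxE.
rewrite [RHS]mxE (@dot_widen n) ?size_comp_Xadd1 // mxE; congr (_ * _).
by apply: eq_bigr => k _; rewrite [(_^T) _ _]mxE !AP.
Qed.

End BilinearForm.

(** * The moment functional and its difference equation *)

Section Functional.
Variable K : numFieldType.
(* [al] and [be] are the two roots of X^2 - X + 1. *)
Variables (al be mu w : K).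
Hypotheses (albeD : al + be = 1) (albeM : al * be = 1).
Implicit Types f g h q r : {poly K}.

Definition delta : K := be - al.
Let dl := delta.

Lemma delta2 : dl ^+ 2 = - 3.
Proof.
have -> : dl ^+ 2 = (al + be) ^+ 2 - 4 * (al * be) by rewrite /dl /delta; ring.
by rewrite albeD albeM; ring.
Qed.

Lemma delta_neq0 : dl != 0.
Proof.
apply/eqP => d0; have := delta2; rewrite d0 expr0n /= => /eqP.
by rewrite eq_sym oppr_eq0 pnatr_eq0.
Qed.

(** The translation by [mu] only moves the origin of the variable of the functional;
    the scale is such that the eigenvalues at [al] and [be], (al - mu) / (3 delta)
    and (be - mu) / (3 delta), differ by 1/3. *)
Definition position f : {poly K} := (3 * dl)^-1 *: (raise f - mu *: f).

Fixpoint position_seq (s : seq K) : {poly K} :=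
  if s is c :: s' then c%:P + position (position_seq s') else 0.

(** The polynomial q (position) 1, computed by the Horner scheme. *)
Definition symbol q : {poly K} := position_seq q.

Lemma raiseD f g : raise (f + g) = raise f + raise g.
Proof. by rewrite /raise derivD; ring. Qed.

Lemma raiseZ c f : raise (c *: f) = c *: raise f.
Proof. by rewrite /raise derivZ -!mul_polyC; ring. Qed.

Lemma positionD f g : position (f + g) = position f + position g.
Proof. by rewrite /position raiseD -!mul_polyC; ring. Qed.

Lemma positionZ c f : position (c *: f) = c *: position f.
Proof. by rewrite /position raiseZ -!mul_polyC; ring. Qed.

Lemma position0 : position 0 = 0.
Proof. by rewrite -(scale0r 0) positionZ !scale0r. Qed.

Lemma symbol_cons q c : symbol (q * 'X + c%:P) = position (symbol q) + c%:P.
Proof.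
rewrite /symbol -cons_poly_def polyseq_cons; case: nilP => [q0|_] /=; last by rewrite addrC.
rewrite q0 /= position0 add0r polyseqC; case: eqP => [->|_] //=.
by rewrite position0 addr0.
Qed.

Lemma symbol0 : symbol 0 = 0. Proof. by rewrite /symbol polyseq0. Qed.

Lemma symbolC c : symbol c%:P = c%:P.
Proof. by have := symbol_cons 0 c; rewrite mul0r add0r symbol0 position0 add0r. Qed.

Lemma symbolD q r : symbol (q + r) = symbol q + symbol r.
Proof.
elim/poly_ind: q r => [|q c IH] r; first by rewrite symbol0 !add0r.
elim/poly_ind: r => [|r d _]; first by rewrite symbol0 !addr0.
have -> : q * 'X + c%:P + (r * 'X + d%:P) = (q + r) * 'X + (c + d)%:P.
  by rewrite polyCD; ring.
by rewrite !symbol_cons IH positionD polyCD; ring.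
Qed.

Lemma symbolZ c q : symbol (c *: q) = c *: symbol q.
Proof.
elim/poly_ind: q => [|q d IH]; first by rewrite scaler0 symbol0 scaler0.
have -> : c *: (q * 'X + d%:P) = (c *: q) * 'X + (c * d)%:P.
  by rewrite polyCM -!mul_polyC; ring.
by rewrite !symbol_cons IH positionZ polyCM -!mul_polyC; ring.
Qed.

Lemma symbolX q : symbol (q * 'X) = position (symbol q).
Proof. by have := symbol_cons q 0; rewrite polyC0 !addr0. Qed.

(** The value of the form at q (position) 1 and 1. *)
Definition moment q : K := (symbol q).[0] + w * (symbol q).[1].

Lemma momentD q r : moment (q + r) = moment q + moment r.
Proof. by rewrite /moment symbolD !hornerD; ring. Qed.

Lemma momentZ c q : moment (c *: q) = c * moment q.
Proof. by rewrite /moment symbolZ !hornerZ; ring. Qed.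

Lemma form_position f h : form w (position f) h = form w f (position h).
Proof.
have formZl c g : form w (c *: g) h = c * form w g h by rewrite formC formZ formC.
rewrite /position formZl formZ -!scaleNr; congr (_ * _).
by rewrite formC formD formC form_raise formD formC !formZ [form w h f]formC.
Qed.

(** Move the factors of [r] to the other side one by one, [position] being
    self-adjoint: the Gram matrix of the form becomes a Hankel type matrix. *)
Lemma form_symbol q r : form w (symbol q) (symbol r) = moment (q * r).
Proof.
elim/poly_ind: r q => [|r c IH] q.
  by rewrite mulr0 symbol0 /moment symbol0 !horner0 mulr0 addr0 -(scale0r 0) formZ mul0r.
rewrite symbol_cons formD -form_position -symbolX IH -[c%:P]mulr1 mul_polyC formZ form1.
have -> : q * (r * 'X + c *: 1) = q * 'X * r + c *: q by rewrite -!mul_polyC; ring.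
by rewrite momentD momentZ.
Qed.

Lemma coef_positionS f k : (size f <= k.+1)%N ->
  (position f)`_k.+1 = k.+1%:R / (3 * dl) * f`_k.
Proof.
move=> fk; rewrite /position coefZ coefB coefZ coef_raise /=.
rewrite (nth_default 0 fk) (nth_default 0 (leqW fk)) !mulr0 !addr0 subr0 mulrA.
by rewrite [_^-1 * _]mulrC.
Qed.

Lemma size_position f n : (size f <= n)%N -> (size (position f) <= n.+1)%N.
Proof.
move=> fn; apply/leq_sizeP => k nk; rewrite /position coefZ coefB coefZ coef_raise.
have fk m : (k <= m.+1)%N -> f`_m = 0.
  by move=> km; rewrite nth_default // (leq_trans fn) //; lia.
by rewrite !fk ?mulr0 ?addr0 ?subr0 ?mulr0 //; lia.
Qed.

Lemma size_symbol q n : (size q <= n)%N -> (size (symbol q) <= n)%N.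
Proof.
elim/poly_ind: q n => [|q c IH] n; first by rewrite symbol0 size_poly0.
rewrite symbol_cons -cons_poly_def size_cons_poly /nilp size_poly_eq0.
case: ifP => [/andP[/eqP-> /eqP->] _|_].
  by rewrite symbol0 position0 polyC0 addr0 size_poly0.
case: n => // n; rewrite ltnS => qn.
rewrite (leq_trans (size_polyD _ _)) // geq_max size_position ?IH //=.
by rewrite (leq_trans (size_polyC_leq1 _)).
Qed.

Lemma coef_symbol q k : (size q <= k.+1)%N ->
  (symbol q)`_k = k`!%:R / (3 * dl) ^+ k * q`_k.
Proof.
elim/poly_ind: q k => [|q c IH] k; first by rewrite symbol0 !coef0 mulr0.
case: k => [|k] sq.
  by rewrite (size1_polyC sq) symbolC coefC expr0 divr1 mul1r.
move: sq; rewrite symbol_cons -cons_poly_def size_cons_poly /nilp size_poly_eq0.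
case: ifP => [/andP[/eqP-> /eqP->] _|_].
  by rewrite symbol0 position0 polyC0 addr0 coef_cons !coef0 mulr0.
rewrite ltnS => qk; rewrite coefD coefC addr0 coef_cons /= coef_positionS ?size_symbol //.
rewrite IH // factS natrM exprS; field.
by rewrite expf_neq0 ?mulf_neq0 ?pnatr_eq0 ?delta_neq0.
Qed.

(** [symbol] preserves degrees, so its matrix in a graded basis is triangular; the
    permutation [s] gives the order of the degrees. *)
Lemma det_coef_symbol n (s : 'S_n) (phi : 'I_n -> {poly K}) :
  (forall i, size (phi i) = (s i).+1) ->
  \det (\matrix_(i, k) (symbol (phi i))`_k) =
  (-1) ^+ s * (\prod_i lead_coef (phi i)) * \prod_(k < n) (k`!%:R / (3 * dl) ^+ k).
Proof.
move=> sz.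
pose L : 'M[K]_n := \matrix_(i, k) (symbol (phi (s^-1%g i)))`_k.
have -> : (\matrix_(i, k) (symbol (phi i))`_k) = row_perm s L.
  by apply/matrixP => i k; rewrite !mxE permK.
rewrite row_permE det_mulmx det_perm -mulrA; congr (_ * _).
have szL i : size (phi (s^-1%g i)) = i.+1 by rewrite sz permKV.
rewrite det_trig; last first.
  apply/is_trig_mxP => i j ij; rewrite mxE nth_default //.
  by apply: size_symbol; rewrite szL.
transitivity (\prod_(i < n) (lead_coef (phi (s^-1%g i)) * (i`!%:R / (3 * dl) ^+ i))).
  by apply: eq_bigr => i _; rewrite /L mxE coef_symbol ?szL // mulrC lead_coefE szL.
rewrite big_split /=; congr (_ * _).
by rewrite (reindex_inj (@perm_inj _ s)); apply: eq_bigr => i _; rewrite permK.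
Qed.

(** Change of basis in the Gram matrix.  Both bases list their degrees in the same
    order [s], so that its sign disappears.  The numbers (3 delta)^2 = -27 come from
    the scale of [position]. *)
Theorem gram_det n (s : 'S_n) (phi psi : 'I_n -> {poly K}) :
  (forall i, size (phi i) = (s i).+1) -> (forall i, size (psi i) = (s i).+1) ->
  \det (\matrix_(i, j) moment (phi i * psi j)) =
  (\prod_i lead_coef (phi i)) * (\prod_i lead_coef (psi i)) *
  (\prod_(k < n) (k`!%:R ^+ 2 / (- 27) ^+ k)) * \det (form_mx w n).
Proof.
move=> szphi szpsi.
have le (chi : 'I_n -> {poly K}) : (forall i, size (chi i) = (s i).+1) ->
    forall i, (size (symbol (chi i)) <= n)%N.
  by move=> szchi i; apply: size_symbol; rewrite szchi.
transitivity (\det (\matrix_(i, j) form w (symbol (phi i)) (symbol (psi j)))).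
  by congr (\det _); apply/matrixP => i j; rewrite !mxE form_symbol.
rewrite (form_mxE w (le _ szphi) (le _ szpsi)) !det_mulmx det_tr.
rewrite (det_coef_symbol szphi) (det_coef_symbol szpsi).
set A := \prod_i _; set B := \prod_i _; set C := \prod_(k < n) _.
have -> : \prod_(k < n) (k`!%:R ^+ 2 / (- 27) ^+ k) = C * C :> K.
  rewrite -big_split; apply: eq_bigr => k _ /=.
  rewrite mulrACA -expr2 -invfM -exprMn; congr (_ / _ ^+ _).
  by rewrite mulrACA -[dl * dl]expr2 delta2; ring.
have : (-1) ^+ s * (-1) ^+ s = 1 :> K by rewrite -signr_addb addbb.
move: ((-1) ^+ s) A B C (\det _) => e A B C D ee.
transitivity (e * e * (A * B * (C * C) * D)); first by ring.
by rewrite ee mul1r.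
Qed.

Local Notation "q ^> c" := (q \Po ('X + c%:P)) (at level 30).

Lemma position_root f x : x ^+ 2 - x + 1 = 0 ->
  (position f).[x] = (x - mu) / (3 * dl) * f.[x].
Proof.
move=> x0; rewrite /position /raise !hornerE.
by rewrite [x ^+ 2 - x + 1]x0 mul0r add0r; ring.
Qed.

Lemma symbol_root q x : x ^+ 2 - x + 1 = 0 -> (symbol q).[x] = q.[(x - mu) / (3 * dl)].
Proof.
move=> x0; elim/poly_ind: q => [|q c IH]; first by rewrite symbol0 !horner0.
by rewrite symbol_cons !hornerD !hornerC hornerMX position_root // IH mulrC.
Qed.

Lemma al_root : al ^+ 2 - al + 1 = 0.
Proof.
have : al ^+ 2 - al * (al + be) + al * be = 0 by ring.
by rewrite albeD albeM mulr1.
Qed.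

Lemma be_root : be ^+ 2 - be + 1 = 0.
Proof.
have : be ^+ 2 - be * (al + be) + al * be = 0 by ring.
by rewrite albeD albeM mulr1.
Qed.

Lemma raise_factor f : raise f = ('X - al%:P) * ('X - be%:P) * f^`() + 'X * f.
Proof.
rewrite /raise; congr (_ * _ + _).
have -> : ('X - al%:P) * ('X - be%:P) = 'X^2 - (al%:P + be%:P) * 'X + al%:P * be%:P by ring.
by rewrite -polyCD -polyCM albeD albeM polyC1; ring.
Qed.

(** Let m = (X - al) / (X - be).  Conjugation by m turns [position] into
    [position] - 1/3, hence m q (position) 1 = q (position + 1/3) m.  Now
    m = 1 + delta / (X - be), and 1 / (X - be) is an eigenfunction of
    [position] + 1/3, with the eigenvalue of [position] at [be]; this gives the last
    term, which also makes the right-hand side vanish at [be]. *)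
Lemma symbol_shift q :
  ('X - be%:P) * symbol (q ^> (3^-1)) = ('X - al%:P) * symbol q - (dl * (symbol q).[be])%:P.
Proof.
elim/poly_ind: q => [|q c IH].
  by rewrite comp_poly0 !symbol0 horner0 !mulr0 polyC0 subr0.
have -> : (q * 'X + c%:P) ^> 3^-1 = (q ^> 3^-1) * 'X + c%:P + 3^-1 *: (q ^> 3^-1).
  by rewrite comp_polyD comp_polyM comp_polyX comp_polyC -mul_polyC; ring.
rewrite symbolD symbolZ !symbol_cons hornerD hornerC position_root ?be_root //.
move: (symbol q) (symbol _) IH => F G IH.
have dIH : G + ('X - be%:P) * G^`() = F + ('X - al%:P) * F^`().
  have := congr1 (@deriv _) IH.
  by rewrite derivB !derivM !derivB derivX !derivC !subr0 !mul1r.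
have d0 := delta_neq0.
set k := (3 * dl)^-1.
have -> : 3^-1 = k * (be - al) by rewrite /k -/delta -/dl; field.
have -> : (be - mu) / (3 * dl) = (be - mu) * k by [].
rewrite /position -/k !raise_factor /dl /delta.
rewrite -!mul_polyC !(polyCM, polyCB, polyCD).
(* The induction hypothesis enters together with its derivative; the last two
   lines below are the multiples of them to be added. *)
transitivity (('X - al%:P) * (k%:P * (('X - al%:P) * ('X - be%:P) * F^`() + 'X * F - mu%:P * F) + c%:P)
   - (be%:P - al%:P) * ((be%:P - mu%:P) * k%:P * (F.[be])%:P + c%:P)
   + k%:P * (('X - al%:P) * ('X - be%:P) *
        ((G + ('X - be%:P) * G^`()) - (F + ('X - al%:P) * F^`()))
     + (be%:P - mu%:P) * (('X - be%:P) * G - (('X - al%:P) * F - ((be - al) * F.[be])%:P)))).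
  by rewrite !(polyCM, polyCB); ring.
by rewrite dIH IH /dl /delta !subrr !mulr0 addr0 mulr0 addr0.
Qed.

(** The inverse translation, obtained from [symbol_shift] by evaluating at [al] to
    express the value at [be]. *)
Lemma symbol_shiftN q :
  ('X - al%:P) * symbol (q ^> (- 3^-1)) = ('X - be%:P) * symbol q + (dl * (symbol q).[al])%:P.
Proof.
have := symbol_shift (q ^> (- 3^-1)).
rewrite -comp_polyA comp_polyD comp_polyX comp_polyC polyCN addrK comp_polyXr => H.
have := congr1 (horner^~ al) H; rewrite !hornerE subrr mul0r add0r.
rewrite (_ : al - be = - dl) ?mulNr; last by rewrite /dl /delta opprB.
by move=> /oppr_inj E; rewrite H E addrNK.
Qed.

(** At 0 the multiplier (X - al) / (X - be) is al^2 and at 1 it is be^2, because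
    al be = 1 and al + be = 1; the inverse multiplier takes the values be^2 and al^2.
    The values of [symbol q] at 0 and 1 are thus multiplied by
    1 + al^2 + be^2 = 0 and only those at [al] and [be] remain, where [position] acts
    by a scalar. *)
Theorem moment_shift q :
  moment (q ^> (3^-1) + q + q ^> (- 3^-1)) =
  dl * ((al - w * be) * q.[(be - mu) / (3 * dl)] + (w * al - be) * q.[(al - mu) / (3 * dl)]).
Proof.
rewrite !momentD -(symbol_root _ be_root) -(symbol_root _ al_root) /moment.
have HP x : (x - be) * (symbol (q ^> 3^-1)).[x] = (x - al) * (symbol q).[x] - dl * (symbol q).[be].
  by have := congr1 (horner^~ x) (symbol_shift q); rewrite !hornerE.
have HN x : (x - al) * (symbol (q ^> (- 3^-1))).[x] = (x - be) * (symbol q).[x] + dl * (symbol q).[al].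
  by have := congr1 (horner^~ x) (symbol_shiftN q); rewrite !hornerE.
have ab : 1 - be = al by rewrite -albeD addrK.
have ba : 1 - al = be by rewrite -albeD addrAC subrr add0r.
have := HP 0; have := HP 1; have := HN 0; have := HN 1; rewrite ab ba !sub0r.
move: (symbol (q ^> 3^-1)) (symbol (q ^> (- 3^-1))) (symbol q) => P N F N1 N0 P1 P0.
have {}P0 : P.[0] = al * (al * F.[0] + dl * F.[be]).
  by rewrite -[LHS]mul1r -{1}albeM -mulrA -[be * _]opprK -mulNr P0; ring.
have {}P1 : P.[1] = be * (be * F.[1] - dl * F.[be]).
  by rewrite -[LHS]mul1r -{1}albeM [al * be]mulrC -mulrA P1.
have {}N0 : N.[0] = be * (be * F.[0] - dl * F.[al]).
  by rewrite -[LHS]mul1r -{1}albeM [al * be]mulrC -mulrA -[al * _]opprK -mulNr N0; ring.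
have {}N1 : N.[1] = al * (al * F.[1] + dl * F.[al]).
  by rewrite -[LHS]mul1r -{1}albeM -mulrA N1.
rewrite P0 P1 N0 N1 -(addr0 (_ + _)).
have E : al ^+ 2 + be ^+ 2 + 1 = 0.
  have : (al + be) ^+ 2 - 2 * (al * be) + 1 = al ^+ 2 + be ^+ 2 + 1 by ring.
  by rewrite albeD albeM => <-; ring.
transitivity (dl * ((al - w * be) * F.[be] + (w * al - be) * F.[al])
  + (al ^+ 2 + be ^+ 2 + 1) * (F.[0] + w * F.[1])); first by ring.
by rewrite E mul0r addr0.
Qed.

End Functional.

(** * Block and Hilbert determinants *)

(** Non-vanishing of positive integers and factorials, as left by [field]. *)
Ltac nz := repeat (apply/andP; split);
  rewrite -?natrM -?natrD ?nat1r ?expf_neq0 ?pnatr_eq0 -?lt0n ?fact_gt0 //; lia.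

Section Determinants.
Variable K : numFieldType.

(** The two matrices are conjugate by the unitriangular Pascal matrix. *)
Lemma det_form_mx_tr (w : K) n :
  let P := \matrix_(s < n, p < n) ('C(s, p)%:R : K) in
  \det (1%:M + w *: (P^T *m P)) = \det (form_mx w n).
Proof.
move=> P; have detP : \det P = 1.
  rewrite det_trig; first by rewrite big1 // => i _; rewrite mxE binn.
  by apply/is_trig_mxP => i j ij; rewrite mxE bin_small.
apply: (mulfI (x := \det P)); first by rewrite detP oner_neq0.
rewrite [RHS]mulrC -!det_mulmx /form_mx -/P mulmxDr mulmxDl mulmx1 mul1mx.
by rewrite -scalemxAr -scalemxAl mulmxA.
Qed.

Lemma det_antidiag m (A B C D : 'M[K]_m) : A = 0 \/ D = 0 ->
  \det (block_mx A B C D) = (-1) ^+ m * \det B * \det C.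
Proof.
pose J : 'M[K]_(m + m) := block_mx 0 1%:M (- 1%:M) 0.
have detJ : \det J = 1.
  pose U : 'M[K]_(m + m) := block_mx 1%:M 1%:M 0 1%:M.
  pose V : 'M[K]_(m + m) := block_mx 1%:M 0 (- 1%:M) 1%:M.
  have -> : J = U *m V *m U.
    rewrite /U /V /J !mulmx_block !(mulmx1, mul1mx, mulmx0, mul0mx, addr0, add0r, subrr).
    by rewrite addNr.
  by rewrite !det_mulmx !det_ublock det_lblock !det1 !mulr1.
move=> AD; have -> : \det (block_mx A B C D) = \det (block_mx A B C D *m J).
  by rewrite det_mulmx detJ mulr1.
rewrite mulmx_block !(mulmx1, mulmx0, addr0, add0r, mulmxN).
case: AD => ->; rewrite ?oppr0 ?det_lblock ?det_ublock -scaleN1r detZ //.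
Qed.

Lemma det_schur n (M : 'M[K]_(1 + n)) : M 0 0 != 0 ->
  \det M = M 0 0 *
    \det (\matrix_(i < n, j < n) (M (rshift 1 i) (rshift 1 j) -
            M (rshift 1 i) 0 * M 0 (rshift 1 j) / M 0 0)).
Proof.
move=> M0; set S := \matrix_(i, j) _.
pose r := ursubmx M; pose c := dlsubmx M.
have l0 : lshift n ord0 = 0 :> 'I_(1 + n) by apply: val_inj.
have E : M = block_mx (M 0 0)%:M 0 c S *m block_mx 1%:M ((M 0 0)^-1 *: r) 0 1%:M.
  rewrite mulmx_block !(mulmx1, mul1mx, mulmx0, mul0mx, addr0, add0r).
  rewrite -[LHS]submxK; congr block_mx.
  - by apply/matrixP => i j; rewrite !ord1 !mxE eqxx mulr1n; congr (M _ _); apply: val_inj.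
  - by rewrite mul_scalar_mx scalerA divff // scale1r.
  apply/matrixP => i j; rewrite !mxE big_ord1 !mxE.
  by rewrite l0; ring.
rewrite {1}E det_mulmx det_lblock det_ublock !det1 !mulr1 det_scalar1 //.
Qed.

Definition hilbert (q n : nat) : 'M[K]_n := \matrix_(i, j) ((i + j + q).+1%:R)^-1.

(** The ratio of the Hilbert determinants of orders [i.+1] and [i]. *)
Definition hilbert_ratio (q i : nat) : K :=
  (i`!%:R ^+ 2 * (q + i)`!%:R ^+ 2) / ((q + i.*2)`!%:R * (q + i.*2).+1`!%:R).

Lemma natf_neq0 k : (k.+1%:R : K) != 0. Proof. by rewrite pnatr_eq0. Qed.
Lemma factr_neq0 k : (k`!%:R : K) != 0. Proof. by rewrite pnatr_eq0 -lt0n fact_gt0. Qed.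

Lemma det_scale_rows_cols n (r c : 'I_n -> K) (M : 'M[K]_n) :
  \det (\matrix_(i, j) (r i * c j * M i j)) = (\prod_i r i) * (\prod_i c i) * \det M.
Proof.
have -> : \matrix_(i, j) (r i * c j * M i j) =
    diag_mx (\row_i r i) *m M *m diag_mx (\row_i c i).
  apply/matrixP => i j; rewrite mul_mx_diag mul_diag_mx !mxE; ring.
rewrite !det_mulmx !det_diag.
under eq_bigr do rewrite mxE; under [X in _ * X]eq_bigr do rewrite mxE.
by rewrite mulrAC.
Qed.

(** Eliminating the first row and column of a Hilbert matrix leaves, up to factors
    of the rows and columns, the Hilbert matrix with [q] increased by 2. *)
Lemma det_hilbert q n : \det (hilbert q n) = \prod_(i < n) hilbert_ratio q i.
Proof.
elim: n q => [|n IH] q; first by rewrite det_mx00 big_ord0.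
rewrite (@det_schur n); last by rewrite mxE invr_neq0 ?natf_neq0.
rewrite big_ord_recl; congr (_ * _).
  rewrite mxE /hilbert_ratio fact0 /= !addn0 add0n factS natrM; field.
  by rewrite factr_neq0 nat1r natf_neq0.
transitivity (\det (\matrix_(i < n, j < n)
   (i.+1%:R / (i + q).+2%:R * (j.+1%:R / (j + q).+2%:R) * hilbert q.+2 n i j))).
  congr (\det _); apply/matrixP => i j; rewrite !mxE /= !add1n !addSn !addnS !addn0 ?add0n.
  by field; nz.
rewrite (det_scale_rows_cols (fun i => i.+1%:R / (i + q).+2%:R) (fun i => i.+1%:R / (i + q).+2%:R)).
rewrite IH -!big_split; apply: eq_bigr => i _ /=.
rewrite /hilbert_ratio /bump /= add1n doubleS !addnS !addSn (factS i) (factS (q + i).+1) !natrM.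
by field; nz.
Qed.

End Determinants.

(** * Functionals satisfying a three-term difference equation *)

Section ShiftFunctional.
Variable K : numFieldType.
Implicit Types q r : {poly K}.

Definition shift c q : {poly K} := q \Po ('X + c%:P).
Definition third_average q : {poly K} := shift 3^-1 q + q + shift (- 3^-1) q.

Lemma comp_polyN q r : (- q) \Po r = - (q \Po r).
Proof. by rewrite -sub0r comp_polyB comp_poly0 sub0r. Qed.

Lemma shiftD c q r : shift c (q + r) = shift c q + shift c r.
Proof. exact: comp_polyD. Qed.
Lemma shiftB c q r : shift c (q - r) = shift c q - shift c r.
Proof. exact: comp_polyB. Qed.
Lemma shiftM c q r : shift c (q * r) = shift c q * shift c r.
Proof. exact: comp_polyM. Qed.
Lemma shiftX c : shift c 'X = 'X + c%:P.
Proof. exact: comp_polyX. Qed.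
Lemma shiftC c d : shift c d%:P = d%:P.
Proof. exact: comp_polyC. Qed.
Lemma shift_shift c d q : shift c (shift d q) = shift (c + d) q.
Proof.
rewrite /shift -comp_polyA comp_polyD comp_polyX comp_polyC polyCD.
by congr (_ \Po _); rewrite addrA.
Qed.
Lemma shift_horner c q x : (shift c q).[x] = q.[x + c].
Proof. by rewrite horner_comp !hornerE. Qed.

(** The six translates, by 1/2, 1/6, -1/6 and by 1/6, -1/6, -1/2, cancel except for
    the extreme ones. *)
Lemma third_average_half q :
  third_average (shift 6^-1 q - shift (- 6^-1) q) = shift 2^-1 q - shift (- 2^-1) q.
Proof.
rewrite /third_average !shiftB !shift_shift.
have -> : 3^-1 + 6^-1 = 2^-1 :> K by field.
have -> : 3^-1 - 6^-1 = 6^-1 :> K by field.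
have -> : - 3^-1 + 6^-1 = - 6^-1 :> K by field.
have -> : - 3^-1 - 6^-1 = - 2^-1 :> K by field.
by ring.
Qed.

Lemma size_shift_sub c q : q != 0 -> (size (shift c q - q)%R < size q)%N.
Proof.
move=> q0; have sq : size (shift c q) = size q by rewrite size_comp_poly2 // size_XaddC.
have [n sqn] : exists n, size q = n.+1 by exists (size q).-1; rewrite prednK // size_poly_gt0.
rewrite sqn ltnS; apply/leq_sizeP => j; rewrite leq_eqVlt coefB => /orP[/eqP <-|nj].
  have := lead_coef_comp q (_ : (1 < size ('X + c%:P)%R)%N).
  rewrite size_XaddC lead_coefXaddC expr1n mulr1 => /(_ isT).
  by rewrite !lead_coefE -/(shift c q) sq sqn => ->; rewrite subrr.
by rewrite !nth_default ?subrr ?sq ?sqn.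
Qed.

Variable L : {poly K} -> K.
Hypothesis LD : forall q r, L (q + r) = L q + L r.
Hypothesis LZ : forall c q, L (c *: q) = c * L q.

Lemma LB q r : L (q - r) = L q - L r.
Proof. by rewrite LD -scaleN1r LZ mulN1r. Qed.

Section Odd.
Variables (kappa c : K).
Hypothesis Lshift : forall q, L (third_average q) = kappa * (q.[c] - q.[- c]).

(** The functional q |-> L q + L (q (- t)) vanishes on the range of [third_average].
    As [third_average] is 3 plus an operator lowering degrees, it is invertible, so
    this functional is zero. *)
Lemma odd_functional q : L (q \Po (- 'X)) = - L q.
Proof.
apply/eqP; rewrite -subr_eq0 opprK; apply/eqP.
have [n] := ubnP (size q); elim: n q => // n IH q; rewrite ltnS => qn.
have [->|q0] := eqVneq q 0; first by rewrite comp_poly0 -(scale0r 0) LZ mul0r addr0.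
pose t := third_average (3^-1 *: q).
have c3 : 3 * (3^-1)%:P = 1 :> {poly K}.
  by rewrite -(rmorph_nat (@polyC K)) -polyCM mulfV ?pnatr_eq0.
have tE : q - t = - 3^-1 *: ((shift 3^-1 q - q) + (shift (- 3^-1) q - q)).
  rewrite /t /third_average /shift !comp_polyZ -!mul_polyC polyCN.
  apply/eqP; rewrite -subr_eq0; set u := q \Po _; set v := q \Po _.
  have -> : q - ((3^-1)%:P * u + (3^-1)%:P * q + (3^-1)%:P * v) -
    (- (3^-1)%:P) * (u - q + (v - q)) = (1 - 3 * (3^-1)%:P) * q by ring.
  by rewrite c3 subrr mul0r.
have shift_reflect d p : shift d p \Po (- 'X) = shift (- d) (p \Po (- 'X)).
  rewrite /shift -!comp_polyA; congr (_ \Po _).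
  by rewrite comp_polyD comp_polyN !comp_polyX comp_polyC polyCN; ring.
have Lt : L (t \Po (- 'X)) + L t = 0.
  have -> : t \Po (- 'X) = third_average ((3^-1 *: q) \Po (- 'X)).
    by rewrite /t /third_average !comp_polyD !shift_reflect opprK; ring.
  rewrite !Lshift !horner_comp !hornerN !hornerX opprK; ring.
have : (size (q - t)%R < n)%N.
  apply: leq_trans qn; rewrite tE.
  rewrite (leq_ltn_trans (size_scale_leq _ _)) // (leq_ltn_trans (size_polyD _ _)) //.
  by rewrite gtn_max !size_shift_sub.
move=> /IH; rewrite comp_polyB !LB => E.
have -> : L (q \Po (- 'X)) + L q =
  (L (q \Po (- 'X)) - L (t \Po (- 'X)) + (L q - L t)) + (L (t \Po (- 'X)) + L t) by ring.
by rewrite E Lt addr0.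
Qed.

Lemma odd_functional_even q : q \Po (- 'X) = q -> L q = 0.
Proof.
move=> qE; have := odd_functional q; rewrite qE => /eqP; rewrite -subr_eq0 opprK.
by rewrite -mulr2n -mulr_natl mulf_eq0 pnatr_eq0 /= => /eqP.
Qed.

(** The four points are those where the right-hand side of [Lshift] takes the
    translates of [q] by 1/6 and -1/6. *)
Lemma odd_functional_half q :
  q.[c + 6^-1] = 0 -> q.[c - 6^-1] = 0 -> q.[- c + 6^-1] = 0 -> q.[- c - 6^-1] = 0 ->
  L (shift 2^-1 q - shift (- 2^-1) q) = 0.
Proof.
move=> h1 h2 h3 h4; rewrite -third_average_half Lshift !hornerD !hornerN !shift_horner.
by rewrite h1 h2 h3 h4; ring.
Qed.

Lemma odd_moment1 : L 'X = kappa * 2 * c / 3.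
Proof.
have := Lshift 'X; rewrite /third_average !shiftX !hornerX.
have -> : 'X + (3^-1)%:P + 'X + ('X + (- 3^-1)%:P) = 3 *: 'X :> {poly K}.
  by rewrite polyCN -mul_polyC; ring.
by rewrite LZ => E; apply: (mulfI (x := 3)); rewrite ?pnatr_eq0 // E; field.
Qed.
End Odd.

(** The basis (a - t)_i (a + t)_i of the even polynomials. *)
Definition wilson_basis (a : K) (i : nat) : {poly K} :=
  \prod_(k < i) (((a + k%:R) ^+ 2)%:P - 'X^2).

Lemma wilson_basisS a i :
  wilson_basis a i.+1 = wilson_basis a i * (((a + i%:R) ^+ 2)%:P - 'X^2).
Proof. by rewrite /wilson_basis big_ord_recr. Qed.

Lemma wilson_basis_even a i : wilson_basis a i \Po (- 'X) = wilson_basis a i.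
Proof.
elim: i => [|i IH]; first by rewrite /wilson_basis big_ord0 -polyC1 comp_polyC.
rewrite wilson_basisS comp_polyM IH comp_polyB comp_polyC.
by rewrite expr2 comp_polyM comp_polyX mulrNN.
Qed.

(** Both sides are products of the same linear factors. *)
Lemma wilson_basis_shift a i :
  ('X + a%:P) * shift 2^-1 (wilson_basis (a + 2^-1) i) =
  ('X + (a + i%:R)%:P) * wilson_basis a i.
Proof.
elim: i => [|i IH]; first by rewrite /wilson_basis !big_ord0 /shift -polyC1 comp_polyC addr0.
rewrite !wilson_basisS shiftM mulrA IH shiftB shiftC expr2 shiftM shiftX.
have -> : (a + i.+1%:R)%:P = a%:P + i%:R%:P + 1 :> {poly K} by rewrite -natr1 !polyCD addrA.
have -> : ((a + 2^-1 + i%:R) ^+ 2)%:P - ('X + (2^-1)%:P) * ('X + (2^-1)%:P) =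
  ((a + i%:R)%:P - 'X) * ((a + i%:R)%:P + 'X + (2^-1)%:P + (2^-1)%:P) :> {poly K}.
  by rewrite expr2 !(polyCM, polyCD); ring.
have h : (2^-1)%:P + (2^-1)%:P = 1 :> {poly K}.
  by rewrite -polyCD (_ : 2^-1 + 2^-1 = 1) //; field.
rewrite -[_ + _ + (2^-1)%:P]addrA h expr2 !(polyCM, polyCD); ring.
Qed.

Lemma wilson_basis_shiftN a i :
  (a%:P - 'X) * shift (- 2^-1) (wilson_basis (a + 2^-1) i) =
  ((a + i%:R)%:P - 'X) * wilson_basis a i.
Proof.
have := congr1 (fun p => p \Po (- 'X)) (wilson_basis_shift a i).
rewrite !comp_polyM !comp_polyD comp_polyX !comp_polyC wilson_basis_even.
have -> : shift 2^-1 (wilson_basis (a + 2^-1) i) \Po (- 'X) =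
    shift (- 2^-1) (wilson_basis (a + 2^-1) i).
  rewrite -[in RHS](wilson_basis_even _ i) /shift -!comp_polyA; congr (_ \Po _).
  by rewrite comp_polyD comp_polyN !comp_polyX comp_polyC polyCN; ring.
by rewrite ![- 'X + _]addrC.
Qed.

Section Wilson.
Variables (a b c d : K).

Definition wilson_shift (Q : {poly K}) : {poly K} :=
  ('X + a%:P) * ('X + b%:P) * ('X + c%:P) * ('X + d%:P) * shift 2^-1 Q -
  (a%:P - 'X) * (b%:P - 'X) * (c%:P - 'X) * (d%:P - 'X) * shift (- 2^-1) Q.

(* This holds for the Wilson weight with parameters a, b, c, d, divided by t, on the
   imaginary axis, as one sees by moving the path of integration by 1/2 to both sides. *)
Hypothesis W : forall Q, L (wilson_shift Q) = 0.

Definition wilson_moment (i j : nat) : K :=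
  L ('X * (wilson_basis a i * wilson_basis b j)).

(** With A = a + i and B = b + j, [wilson_shift] of the product of the two bases
    translated by 1/2 is the product of the bases times the difference of
    (t + A) (t + B) (t + c) (t + d) and its reflection, which is
    2 t (e1 t^2 + e3) for the elementary symmetric functions of A, B, c, d.  Writing
    t^2 = A^2 - (A^2 - t^2) leaves two neighbouring moments, and A^2 e1 + e3 factors
    as (A + B) (A + c) (A + d). *)
Lemma wilson_moment_recl i j :
  (a + b + c + d + i%:R + j%:R) * wilson_moment i.+1 j =
  (a + b + i%:R + j%:R) * (a + c + i%:R) * (a + d + i%:R) * wilson_moment i j.
Proof.
have := W (wilson_basis (a + 2^-1) i * wilson_basis (b + 2^-1) j).
pose A := a + i%:R; pose B := b + j%:R.
set phi := wilson_basis a i; set psi := wilson_basis b j.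
pose e1 := A + B + c + d.
pose e3 := A * B * c + A * B * d + A * c * d + B * c * d.
have -> : wilson_shift (wilson_basis (a + 2^-1) i * wilson_basis (b + 2^-1) j) =
    (- 2 * e1) *: ('X * (wilson_basis a i.+1 * psi)) +
    (2 * (A ^+ 2 * e1 + e3)) *: ('X * (phi * psi)).
  rewrite /wilson_shift !shiftM.
  set Xa := 'X + a%:P; set Xb := 'X + b%:P; set aX := a%:P - 'X; set bX := b%:P - 'X.
  set u := shift _ _; set v := shift _ _; set u' := shift _ _; set v' := shift _ _.
  have -> : Xa * Xb * ('X + c%:P) * ('X + d%:P) * (u * v) -
     aX * bX * (c%:P - 'X) * (d%:P - 'X) * (u' * v') =
     (Xa * u) * (Xb * v) * ('X + c%:P) * ('X + d%:P) -
     (aX * u') * (bX * v') * (c%:P - 'X) * (d%:P - 'X) by ring.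
  rewrite /Xa /Xb /aX /bX /u /v /u' /v' !wilson_basis_shift !wilson_basis_shiftN.
  rewrite wilson_basisS -/phi -/psi -/A -/B -!mul_polyC /e1 /e3.
  move: phi psi => phi psi; clear; move: A B => A B.
  rewrite !(polyCM, polyCD, polyCN, expr2) ?(rmorph_nat (@polyC K)).
  ring.
rewrite LD !LZ -/(wilson_moment _ _) -/(wilson_moment _ _).
move: (wilson_moment i.+1 j) (wilson_moment i j) => E1 E0 /eqP.
rewrite addr_eq0 => /eqP E; apply: (mulfI (x := 2)); first by rewrite pnatr_eq0.
have -> : 2 * ((a + b + c + d + i%:R + j%:R) * E1) = - (- 2 * e1 * E1) by rewrite /e1 /A /B; ring.
by rewrite E opprK /e1 /e3 /A /B; ring.
Qed.
End Wilson.

End ShiftFunctional.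

(** * Moments in a Wilson basis *)

Section WilsonMoments.
Variable K : numFieldType.
Implicit Types q : {poly K}.

Lemma rising_factorialS (x : K) k :
  rising_factorial x k.+1 = rising_factorial x k * (x + k%:R).
Proof. by rewrite /rising_factorial big_nat_recr. Qed.

Lemma rising_factorial0 (x : K) : rising_factorial x 0 = 1.
Proof. by rewrite /rising_factorial big_geq. Qed.

Lemma size_lead_wilson_factor (c : K) :
  size (c%:P - 'X^2) = 3 /\ lead_coef (c%:P - 'X^2) = -1.
Proof.
rewrite -opprB size_polyN lead_coefN; split; first by rewrite size_XnsubC.
by rewrite lead_coefXnsubC.
Qed.

Lemma size_lead_wilson_basis (a : K) i :
  size (wilson_basis a i) = i.*2.+1 /\ lead_coef (wilson_basis a i) = (-1) ^+ i.
Proof.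
elim: i => [|i [IHs IHl]].
  by rewrite /wilson_basis big_ord0 size_poly1 lead_coef1.
have [s l] := size_lead_wilson_factor ((a + i%:R) ^+ 2).
rewrite wilson_basisS lead_coefM IHl l; split; last by rewrite exprSr.
by rewrite size_mul -?size_poly_gt0 ?s ?IHs // addn3.
Qed.

Lemma size_lead_odd_wilson_basis (a : K) i (e : K) :
  size ('X * wilson_basis a i + e%:P) = i.*2.+2 /\
  lead_coef ('X * wilson_basis a i + e%:P) = (-1) ^+ i.
Proof.
have [s l] := size_lead_wilson_basis a i.
have q0 : wilson_basis a i != 0 by rewrite -size_poly_gt0 s.
have sX : size ('X * wilson_basis a i) = i.*2.+2 by rewrite mulrC size_mulX // s.
have lt : (size e%:P < size ('X * wilson_basis a i)%R)%N.
  by rewrite sX (leq_ltn_trans (size_polyC_leq1 _)).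
by rewrite size_polyDl ?lead_coefDl // sX lead_coefM lead_coefX mul1r.
Qed.

Variable L : {poly K} -> K.
Hypothesis LD : forall q r, L (q + r) = L q + L r.
Hypothesis LZ : forall c q, L (c *: q) = c * L q.

Lemma wilson_moment_sym a b i j : wilson_moment L a b i j = wilson_moment L b a j i.
Proof. by rewrite /wilson_moment [wilson_basis a i * _]mulrC. Qed.

Section WilsonParameters.
Variables (a b c d : K).
Hypotheses (ab1 : a + b = 1) (cd1 : c + d = 1).

(** The recurrences in [i] and [j] coincide up to exchanging [a] and [b]; since
    a + b = c + d = 1, their first factors only depend on [i + j]. *)
Lemma wilson_momentE : (forall Q, L (wilson_shift a b c d Q) = 0) ->
  forall i j, wilson_moment L a b i j = wilson_moment L a b 0 0 *
    (rising_factorial (a + c) i * rising_factorial (a + d) i) *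
    (rising_factorial (b + c) j * rising_factorial (b + d) j) / (i + j).+1%:R.
Proof.
move=> W.
have rec_i i j : (i + j).+2%:R * wilson_moment L a b i.+1 j =
    (i + j).+1%:R * (a + c + i%:R) * (a + d + i%:R) * wilson_moment L a b i j.
  have := wilson_moment_recl LD LZ W i j.
  have -> : a + b + c + d + i%:R + j%:R = (a + b) + (c + d) + i%:R + j%:R by ring.
  rewrite ab1 cd1 (_ : 1 + 1 + _ + _ = (i + j).+2%:R); last by ring.
  by rewrite (_ : 1 + _ + _ = (i + j).+1%:R); last by ring.
have W' Q : L (wilson_shift b a c d Q) = 0.
  by rewrite -(W Q) /wilson_shift; congr (L (_ * _ - _ * _)); ring.
have rec_j i j : (i + j).+2%:R * wilson_moment L a b i j.+1 =
    (i + j).+1%:R * (b + c + j%:R) * (b + d + j%:R) * wilson_moment L a b i j.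
  have := wilson_moment_recl LD LZ W' j i; rewrite !(wilson_moment_sym b a).
  have -> : b + a + c + d + j%:R + i%:R = (b + a) + (c + d) + j%:R + i%:R by ring.
  rewrite [b + a]addrC ab1 cd1 (_ : 1 + 1 + _ + _ = (i + j).+2%:R); last by ring.
  by rewrite (_ : 1 + _ + _ = (i + j).+1%:R); last by ring.
have n0 k : (k.+1%:R : K) != 0 by rewrite pnatr_eq0.
elim=> [|i IHi] j.
  elim: j => [|j IH]; first by rewrite !rising_factorial0; field.
  apply: (mulfI (n0 (0 + j).+1)); rewrite rec_j IH !rising_factorialS addnS.
  by field; nz.
apply: (mulfI (n0 (i + j).+1)); rewrite rec_i IHi !rising_factorialS addSn.
by field; nz.
Qed.

(** The translates of V by 1/2 and -1/2 have the linear factors of [wilson_shift],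
    because 1 - a = b and 1 - c = d. *)
Lemma odd_wilson_shift kappa c0 (V : {poly K}) :
  (forall q, L (third_average q) = kappa * (q.[c0] - q.[- c0])) ->
  V = ('X + (a - 2^-1)%:P) * ('X + (b - 2^-1)%:P) *
      ('X + (c - 2^-1)%:P) * ('X + (d - 2^-1)%:P) ->
  V.[c0 + 6^-1] = 0 -> V.[c0 - 6^-1] = 0 -> V.[- c0 + 6^-1] = 0 -> V.[- c0 - 6^-1] = 0 ->
  forall Q, L (wilson_shift a b c d Q) = 0.
Proof.
move=> Ls VE v1 v2 v3 v4 Q.
have := @odd_functional_half _ L kappa c0 Ls (V * Q).
rewrite !(hornerM V) v1 v2 v3 v4 !mul0r => /(_ erefl erefl erefl erefl) <-; congr L.
have sV e : shift e V = ('X + (a - 2^-1 + e)%:P) * ('X + (b - 2^-1 + e)%:P) *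
           ('X + (c - 2^-1 + e)%:P) * ('X + (d - 2^-1 + e)%:P).
  by rewrite VE !shiftM !shiftD shiftX !shiftC !(polyCD, polyCN); ring.
rewrite !(shiftM _ V) !sV /wilson_shift; congr (_ - _).
  by congr (_ * _ * _ * _ * _); congr ('X + _%:P); ring.
have h (x y : K) : x + y = 1 -> x - 2^-1 - 2^-1 = - y.
  by move=> xy; rewrite (_ : x = 1 - y); [field|rewrite -xy addrK].
rewrite (h a b) // (h b a) 1?addrC // (h c d) // (h d c) 1?addrC // !polyCN.
congr (_ * _); ring.
Qed.

End WilsonParameters.

End WilsonMoments.

(** * Primitive third roots of unity *)

Section ThirdRoot.
Variable K : numFieldType.

Lemma fact_tripleD1 i : (27 ^+ i * (rising_factorial (2 / 3) i * rising_factorial (4 / 3) i) *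
  i`!%:R = (3 * i + 1)`!%:R :> K).
Proof.
elim: i => [|i IH]; first by rewrite !rising_factorial0 !mulr1.
rewrite !rising_factorialS (_ : 3 * i.+1 + 1 = (3 * i + 1).+3)%N; last by lia.
rewrite !(factS _.+2) !(factS _.+1) (factS (3 * i + 1)) (factS i) !natrM -IH exprS.
by field.
Qed.

Lemma fact_triple i : (27 ^+ i * (rising_factorial (1 / 3) i * rising_factorial (2 / 3) i) *
  i`!%:R = (3 * i)`!%:R :> K).
Proof.
elim: i => [|i IH]; first by rewrite !rising_factorial0 !mulr1.
rewrite !rising_factorialS (_ : 3 * i.+1 = (3 * i).+3)%N; last by lia.
rewrite (factS (3 * i).+2) (factS (3 * i).+1) (factS (3 * i)) (factS i) !natrM -IH exprS.
by field.
Qed.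

Lemma fact_tripleD2 i : (27 ^+ i * (rising_factorial (4 / 3) i * rising_factorial (5 / 3) i) *
  i`!%:R = (3 * i + 2)`!%:R / 2 :> K).
Proof.
elim: i => [|i IH]; first by rewrite !rising_factorial0 !mulr1 divff // pnatr_eq0.
rewrite !rising_factorialS (_ : 3 * i.+1 + 2 = (3 * i + 2).+3)%N; last by lia.
rewrite (factS (3 * i + 2).+2) (factS (3 * i + 2).+1) (factS (3 * i + 2)) (factS i) !natrM.
have -> : (3 * i + 2)`!%:R = 2 * (27 ^+ i * (rising_factorial (4 / 3) i * rising_factorial (5 / 3) i) *
  i`!%:R) :> K by rewrite IH mulrC divfK // pnatr_eq0.
by rewrite exprS; field.
Qed.

(** This basis and the next are those of the continuous Hahn polynomials. *)
Definition ascending (x : K) i : {poly K} := \prod_(k < i) ('X + (x + k%:R)%:P).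
Definition descending (x : K) i : {poly K} := \prod_(k < i) ((x + k%:R)%:P - 'X).

Lemma ascendingS x i : ascending x i.+1 = ascending x i * ('X + (x + i%:R)%:P).
Proof. by rewrite /ascending big_ord_recr. Qed.

Lemma descendingS x i : descending x i.+1 = descending x i * ((x + i%:R)%:P - 'X).
Proof. by rewrite /descending big_ord_recr. Qed.

Lemma shift_ascending c x i : shift c (ascending x i) = ascending (x + c) i.
Proof.
elim: i => [|i IH]; first by rewrite /ascending !big_ord0 /shift -polyC1 comp_polyC.
rewrite !ascendingS shiftM IH shiftD shiftX shiftC; congr (_ * _).
by rewrite !polyCD; ring.
Qed.

Lemma shift_descending c x i : shift c (descending x i) = descending (x - c) i.
Proof.
elim: i => [|i IH]; first by rewrite /descending !big_ord0 /shift -polyC1 comp_polyC.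
rewrite !descendingS shiftM IH shiftB shiftX shiftC; congr (_ * _).
by rewrite !polyCD polyCN; ring.
Qed.

Lemma ascending_recl x i : ('X + x%:P) * ascending (x + 1) i = ascending x i.+1.
Proof.
rewrite /ascending big_ord_recl addr0; congr (_ * _); apply: eq_bigr => k _.
by congr ('X + _%:P); rewrite /bump /= -natr1; ring.
Qed.

Lemma descending_recl x i : (x%:P - 'X) * descending (x + 1) i = descending x i.+1.
Proof.
rewrite /descending big_ord_recl addr0; congr (_ * _); apply: eq_bigr => k _.
by congr (_%:P - 'X); rewrite /bump /= -natr1; ring.
Qed.

Lemma size_lead_ascending x i : size (ascending x i) = i.+1 /\ lead_coef (ascending x i) = 1.
Proof.
elim: i => [|i [s l]]; first by rewrite /ascending big_ord0 size_poly1 lead_coef1.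
rewrite ascendingS lead_coefM l lead_coefXaddC mulr1; split => //.
by rewrite size_mul -?size_poly_gt0 ?s ?size_XaddC // addn2.
Qed.

Lemma size_lead_descending x i :
  size (descending x i) = i.+1 /\ lead_coef (descending x i) = (-1) ^+ i.
Proof.
elim: i => [|i [s l]]; first by rewrite /descending big_ord0 size_poly1 lead_coef1.
have sf : size ((x + i%:R)%:P - 'X) = 2 by rewrite -opprB size_polyN size_XsubC.
rewrite descendingS lead_coefM l -opprB lead_coefN lead_coefXsubC exprSr opprB; split => //.
by rewrite size_mul -?size_poly_gt0 ?s ?sf // addn2.
Qed.

Section Recurrence.
Variables (L : {poly K} -> K) (A : K).
Hypothesis LD : forall q r, L (q + r) = L q + L r.
Hypothesis LZ : forall c q, L (c *: q) = c * L q.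
Hypothesis Lshift : forall q, L (third_average q) = A * q.[0].

Let E i j := L (ascending (1 / 3) i * descending (2 / 3) j).

Lemma hahn_moment00 : E 0 0 = A / 3.
Proof.
rewrite /E /ascending /descending !big_ord0 mulr1.
have := Lshift 1; rewrite /third_average /shift !comp_poly1 -polyC1 hornerC.
have -> : 1%:P + 1%:P + 1%:P = 3 *: 1%:P :> {poly K} by rewrite -mul_polyC; ring.
by rewrite LZ mulr1 => <-; field.
Qed.

(** The quadratic factor V vanishes at 1/6 and -1/6, the translates of the point 0
    where the right-hand side of [Lshift] is evaluated; the shifted factorials are
    centered so that its linear factors complete them. *)
Lemma hahn_relation i j :
  L (ascending (1 / 3) i * descending (2 / 3) j *
     ((2 + i%:R + j%:R)%:P * 'X + ((2 * i%:R - j%:R) / 3)%:P)) = 0.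
Proof.
pose V := ('X - (6^-1)%:P) * ('X + (6^-1)%:P) : {poly K}.
pose q := V * (ascending (5 / 6) i * descending (7 / 6) j).
have := Lshift (shift 6^-1 q - shift (- 6^-1) q).
rewrite third_average_half hornerD hornerN !shift_horner !add0r.
have -> : q.[6^-1] = 0 by rewrite /q /V 2!hornerM hornerXsubC subrr !mul0r.
have -> : q.[- 6^-1] = 0 by rewrite /q /V 2!hornerM [('X + _%:P).[_]]hornerD hornerX hornerC addNr mulr0 mul0r.
rewrite subrr mulr0 => <-; congr L.
rewrite /q !shiftM !shiftB !shiftD !shiftX !shiftC !shift_ascending !shift_descending.
have -> : 5 / 6 + 2^-1 = 1 / 3 + 1 :> K by field.
have -> : 7 / 6 - 2^-1 = 2 / 3 :> K by field.
have -> : 5 / 6 - 2^-1 = 1 / 3 :> K by field.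
have -> : 7 / 6 - - 2^-1 = 2 / 3 + 1 :> K by field.
pose t : {poly K} := (1 / 3)%:P.
have t2 : (2 / 3)%:P = t + t by rewrite -polyCD; congr _%:P; field.
have h1 : (2^-1)%:P - (6^-1)%:P = t by rewrite -polyCB; congr _%:P; field.
have h2 : (2^-1)%:P + (6^-1)%:P = t + t by rewrite -polyCD -t2; congr _%:P; field.
have t6 : 2%:P = 6 * t by rewrite -(rmorph_nat (@polyC K)) -polyCM; congr _%:P; field.
have ar := ascending_recl (1 / 3) i; have dr := descending_recl (2 / 3) j.
rewrite ascendingS in ar; rewrite descendingS in dr.
move: ar dr; set u := ascending (1 / 3) i; set u1 := ascending (1 / 3 + 1) i.
set v := descending (2 / 3) j; set v1 := descending (2 / 3 + 1) j => ar dr.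
transitivity ((('X + (1 / 3)%:P) * u1) * v * ('X + (t + t)) - u * (((2 / 3)%:P - 'X) * v1) * (t - 'X)).
  pose I : {poly K} := i%:R%:P; pose J : {poly K} := j%:R%:P.
  have e1 : (1 / 3 + i%:R)%:P = t + I by rewrite polyCD.
  have e2 : (2 / 3 + j%:R)%:P = t + t + J by rewrite polyCD t2.
  have e3 : (2 + i%:R + j%:R)%:P = 6 * t + I + J by rewrite (polyCD _ j%:R) (polyCD 2) t6.
  have e4 : ((2 * i%:R - j%:R) / 3)%:P = (I + I - J) * t.
    by rewrite -polyCD -polyCB -polyCM; congr _%:P; field.
  by rewrite ar dr -/t e1 e2 e3 e4; ring.
rewrite -/t t2.
have -> : 'X + (2^-1)%:P - (6^-1)%:P = 'X + t by rewrite -addrA h1.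
have -> : 'X + (2^-1)%:P + (6^-1)%:P = 'X + (t + t) by rewrite -addrA h2.
have -> : 'X + (- 2^-1)%:P - (6^-1)%:P = 'X - (t + t) by rewrite -h2 polyCN; ring.
have -> : 'X + (- 2^-1)%:P + (6^-1)%:P = 'X - t by rewrite -h1 polyCN; ring.
ring.
Qed.

(** The linear factor of [hahn_relation] is a combination of the next factor of
    [ascending] and a constant. *)
Lemma hahn_moment_recl i j :
  (i + j).+2%:R * E i.+1 j = (2 / 3 + i%:R) * (i + j).+1%:R * E i j.
Proof.
have := hahn_relation i j; rewrite /E ascendingS; set u := ascending _ _; set v := descending _ _.
have -> : u * v * ((2 + i%:R + j%:R)%:P * 'X + ((2 * i%:R - j%:R) / 3)%:P) =
  (i + j).+2%:R *: (u * ('X + (1 / 3 + i%:R)%:P) * v) +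
  (- ((2 / 3 + i%:R) * (i + j).+1%:R)) *: (u * v).
  rewrite -!mul_polyC; set e := (i + j).+2%:R.
  have -> : 2 + i%:R + j%:R = e by rewrite /e; ring.
  have -> : (2 * i%:R - j%:R) / 3 = e * (1 / 3 + i%:R) - (2 / 3 + i%:R) * (i + j).+1%:R.
    by rewrite /e; field.
  by rewrite polyCB !polyCN !polyCM; ring.
by rewrite LD !LZ mulNr => /eqP; rewrite subr_eq0 => /eqP.
Qed.

Lemma hahn_moment_recr i j :
  (i + j).+2%:R * E i j.+1 = (4 / 3 + j%:R) * (i + j).+1%:R * E i j.
Proof.
have := hahn_relation i j; rewrite /E descendingS; set u := ascending _ _; set v := descending _ _.
have -> : u * v * ((2 + i%:R + j%:R)%:P * 'X + ((2 * i%:R - j%:R) / 3)%:P) =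
  (- (i + j).+2%:R) *: (u * (v * ((2 / 3 + j%:R)%:P - 'X))) +
  ((4 / 3 + j%:R) * (i + j).+1%:R) *: (u * v).
  rewrite -!mul_polyC; set e := (i + j).+2%:R.
  have -> : 2 + i%:R + j%:R = e by rewrite /e; ring.
  have -> : (2 * i%:R - j%:R) / 3 = - (e * (2 / 3 + j%:R)) + (4 / 3 + j%:R) * (i + j).+1%:R.
    by rewrite /e; field.
  by move: e (4 / 3 + j%:R) (2 / 3 + j%:R) (i + j).+1%:R => e x y z; rewrite polyCD !polyCN !polyCM; ring.
by rewrite LD !LZ mulNr addrC => /eqP; rewrite subr_eq0 => /eqP.
Qed.

Lemma hahn_momentE i j :
  E i j = A / 3 * rising_factorial (2 / 3) i * rising_factorial (4 / 3) j / (i + j).+1%:R.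
Proof.
have n0 k : (k.+1%:R : K) != 0 by rewrite pnatr_eq0.
elim: i j => [|i IHi] j.
  elim: j => [|j IH]; first by rewrite !rising_factorial0 hahn_moment00; field.
  apply: (mulfI (n0 (0 + j).+1)); rewrite hahn_moment_recr IH !rising_factorialS addnS.
  by field; nz.
apply: (mulfI (n0 (i + j).+1)); rewrite hahn_moment_recl IHi !rising_factorialS addSn.
by field; nz.
Qed.
End Recurrence.

Theorem det_form_mx_third_root (w : K) n : w ^+ 2 + w + 1 = 0 ->
  \det (form_mx w n) = (1 + w) ^+ n *
    \prod_(i < n) ((3 * i + 1)`!%:R * i`!%:R / (i.*2`!%:R * i.*2.+1`!%:R)).
Proof.
(* With this choice of [al] the value of q at one of the two points disappears from
   [moment_shift]; the choice mu = be puts the other point at 0. *)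
move=> w3; pose al := - w; pose be := - w ^+ 2.
have albeD : al + be = 1.
  by rewrite -[RHS]subr0 -w3 /al /be; ring.
have albeM : al * be = 1.
  by rewrite -[RHS]addr0 -[0](mulr0 (w - 1)) -w3 /al /be; ring.
pose L := moment al be be w.
have Lshift q : L (third_average q) = (3 * (1 + w)) * q.[0].
  rewrite /L /third_average /shift (moment_shift _ _ albeD albeM) subrr mul0r.
  have -> : w * al - be = 0 by rewrite /al /be; ring.
  rewrite mul0r addr0 mulrA; congr (_ * _).
  rewrite -[RHS]addr0 -[0](mulr0 (- w ^+ 3 + 2 * w ^+ 2 - 3)) -w3 /delta /al /be; ring.
have LD : forall q r, L (q + r) = L q + L r by exact: momentD.
have LZ : forall c q, L (c *: q) = c * L q by exact: momentZ.
have := @gram_det K al be be w albeD albeM n 1%g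
  (fun i => ascending (1 / 3) i) (fun i => descending (2 / 3) i).
have sz1 (i : 'I_n) : size (ascending (1 / 3) i) = ((1%g : 'S_n) i).+1.
  by rewrite perm1; have [] := size_lead_ascending (1 / 3) i.
have sz2 (i : 'I_n) : size (descending (2 / 3) i) = ((1%g : 'S_n) i).+1.
  by rewrite perm1; have [] := size_lead_descending (2 / 3) i.
move=> /(_ sz1 sz2).
have -> : \matrix_(i < n, j < n) moment al be be w (ascending (1 / 3) i * descending (2 / 3) j) =
   \matrix_(i < n, j < n) (((1 + w) * rising_factorial (2 / 3) i) *
       rising_factorial (4 / 3) j * hilbert K 0 n i j).
  apply/matrixP => i j; rewrite !mxE addn0 -/(L _) (hahn_momentE LD LZ Lshift).
  by field; nz.
rewrite (det_scale_rows_cols (fun i : 'I_n => (1 + w) * rising_factorial (2 / 3) i)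
  (fun j : 'I_n => rising_factorial (4 / 3) j)) det_hilbert.
rewrite -!big_split /=; set C := (X in _ = X * _) => E.
have C0 : C != 0.
  apply/prodf_neq0 => i _.
  have [_ ->] := size_lead_ascending (1 / 3) i; have [_ ->] := size_lead_descending (2 / 3) i.
  by rewrite !mulf_neq0 ?invr_neq0 ?expf_neq0 ?oppr_eq0 ?oner_neq0 ?pnatr_eq0 // -lt0n fact_gt0.
apply: (mulfI C0); rewrite -E (_ : (1 + w) ^+ n = \prod_(i < n) (1 + w)); last first.
  by rewrite prodr_const card_ord.
rewrite /C -!big_split; apply: eq_bigr => i _ /=.
have [_ ->] := size_lead_ascending (1 / 3) i; have [_ ->] := size_lead_descending (2 / 3) i.
rewrite -fact_tripleD1 /hilbert_ratio !add0n [(- 27) ^+ i]exprNn.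
have s0 : (-1) ^+ i != 0 :> K by rewrite expf_neq0 ?oppr_eq0 ?oner_neq0.
have t0 : 27 ^+ i != 0 :> K by rewrite expf_neq0 ?pnatr_eq0.
move: ((-1) ^+ i) (27 ^+ i) s0 t0 => s t s0 t0.
have f0 := factr_neq0 K.
by field; rewrite !f0 s0 t0.
Qed.
End ThirdRoot.

(** * Odd functionals *)

Section ParityGram.
Variable K : numFieldType.
Implicit Types q : {poly K}.

(** The order of degrees in which the even polynomials precede the odd ones. *)
Lemma exists_parity_perm m : exists s : 'S_(m + m),
  (forall i : 'I_m, s (lshift m i) = i.*2 :> nat) /\
  (forall i : 'I_m, s (rshift m i) = i.*2.+1 :> nat).
Proof.
pose g k := if (k < m)%N then k.*2 else (k - m).*2.+1.
have gP (k : 'I_(m + m)) : (g k < m + m)%N by have := ltn_ord k; rewrite /g; case: (ltnP k m); lia.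
have g_inj : injective (fun k => Ordinal (gP k)).
  move=> k l /(congr1 val) /=; rewrite /g => H; apply: val_inj => /=.
  by move: H; case: (ltnP k m); case: (ltnP l m); lia.
exists (perm g_inj); split => i; rewrite permE /= /g; first by rewrite ltn_ord.
by rewrite ltnNge leq_addr addKn.
Qed.

Lemma exists_parity_perm1 m : exists s : 'S_(1 + (m + m)),
  [/\ s (lshift (m + m) ord0) = 0 :> nat,
      forall i : 'I_m, s (rshift 1 (lshift m i)) = i.*2.+2 :> nat &
      forall i : 'I_m, s (rshift 1 (rshift m i)) = i.*2.+1 :> nat].
Proof.
pose g k := if k is k'.+1 then if (k' < m)%N then k'.*2.+2 else (k' - m).*2.+1 else 0%N.
have gP (k : 'I_(1 + (m + m))) : (g k < 1 + (m + m))%N.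
  by have := ltn_ord k; rewrite /g; case: (k : nat) => // k'; case: (ltnP k' m); lia.
have g_inj : injective (fun k => Ordinal (gP k)).
  move=> k l /(congr1 val) /= H; apply: val_inj; move: H; rewrite /g /=.
  case: (k : nat) (l : nat) => [|k'] [|l'] //; try by case: ifP.
  by case: (ltnP k' m); case: (ltnP l' m); lia.
exists (perm g_inj); split; first by rewrite permE.
  by move=> i; rewrite permE /= ltn_ord.
by move=> i; rewrite permE /=; case: (ltnP (m + i) m); lia.
Qed.

Lemma prod_pairs m (F : nat -> K) :
  \prod_(k < m + m) F k = \prod_(i < m) (F i.*2 * F i.*2.+1).
Proof.
elim: m => [|m IH]; first by rewrite !big_ord0.
rewrite addSn addnS !big_ord_recr /= -mulrA; congr (_ * _); last by rewrite addnn.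
exact: IH.
Qed.

Lemma split_lshift m n (i : 'I_m) : split (lshift n i) = inl i.
Proof. exact: (unsplitK (inl i)). Qed.
Lemma split_rshift m n (i : 'I_n) : split (rshift m i) = inr i.
Proof. exact: (unsplitK (inr i)). Qed.

Definition parity_basis (a b : K) m (k : 'I_(m + m)) : {poly K} :=
  match split k with
  | inl i => wilson_basis a i
  | inr j => 'X * wilson_basis b j
  end.

Lemma size_lead_parity_basis a b m (s : 'S_(m + m)) :
  (forall i : 'I_m, s (lshift m i) = i.*2 :> nat) ->
  (forall i : 'I_m, s (rshift m i) = i.*2.+1 :> nat) ->
  forall k, size (parity_basis a b k) = (s k).+1 /\
    lead_coef (parity_basis a b k) * lead_coef (parity_basis a b k) = 1.
Proof.
move=> s1 s2 k; rewrite /parity_basis -(splitK k) unsplitK; case: (split k) => i /=.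
  have [-> ->] := size_lead_wilson_basis a i; rewrite s1; split => //.
  by rewrite -expr2 sqrr_sign.
have := size_lead_odd_wilson_basis b i 0; rewrite polyC0 addr0 => -[-> ->]; rewrite s2; split => //.
by rewrite -expr2 sqrr_sign.
Qed.

(** The block of the products of two odd polynomials vanishes, so only the mixed block
    enters the determinant. *)
Lemma det_parity_gram (L : {poly K} -> K) a b m (E : 'M[K]_m) :
  (forall i j : 'I_m, L (wilson_basis a i * ('X * wilson_basis b j)) = E i j) ->
  (forall i j : 'I_m, L ('X * wilson_basis b i * ('X * wilson_basis b j)) = 0) ->
  \det (\matrix_(k < m + m, l < m + m) L (parity_basis a b k * parity_basis a b l)) =
  (-1) ^+ m * \det E ^+ 2.
Proof.
move=> LE L0; set M := \matrix_(k, l) _.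
have -> : M = block_mx (ulsubmx M) E E^T 0.
  rewrite -[LHS]submxK; congr block_mx; apply/matrixP => i j;
    rewrite !mxE /parity_basis ?split_lshift ?split_rshift.
  - exact: LE.
  - by rewrite mulrC LE.
  - exact: L0.
by rewrite det_antidiag; [rewrite det_tr expr2 mulrA|right].
Qed.

Lemma det_wilson_mx (r c : nat -> K) (e : K) (p m : nat) :
  \det (\matrix_(i < m, j < m) (e * r i * c j / (i + j + p).+1%:R)) =
  \prod_(i < m) (e * r i * c i * hilbert_ratio K p i).
Proof.
transitivity (\det (\matrix_(i < m, j < m) (e * r i * c j * hilbert K p m i j))).
  by congr (\det _); apply/matrixP => i j; rewrite !mxE.
rewrite (det_scale_rows_cols (fun i : 'I_m => e * r i) (fun j : 'I_m => c j)) det_hilbert.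
by rewrite -!big_split.
Qed.

Lemma wilson_moment00 (L : {poly K} -> K) a b : wilson_moment L a b 0 0 = L 'X.
Proof. by rewrite /wilson_moment /wilson_basis !big_ord0 !mulr1. Qed.

Section OddCases.
Variable L : {poly K} -> K.
Hypothesis LD : forall q r, L (q + r) = L q + L r.
Hypothesis LZ : forall c q, L (c *: q) = c * L q.

(** The quartic has to vanish at the four sums of 1/6 or -1/6 with 1/6 or -1/6, that
    is at 1/3, 0, 0, -1/3; adding 1/2 gives the parameters 1/2, 1/2, 1/6, 5/6. *)
Lemma wilson_moment_minus1 kappa :
  (forall q, L (third_average q) = kappa * (q.[6^-1] - q.[- 6^-1])) ->
  forall i j, wilson_moment L (1 / 2) (1 / 2) i j = kappa / 9 *
    (rising_factorial (2 / 3) i * rising_factorial (4 / 3) i) *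
    (rising_factorial (2 / 3) j * rising_factorial (4 / 3) j) / (i + j).+1%:R.
Proof.
move=> Ls i j.
rewrite (@wilson_momentE _ _ LD LZ (1 / 2) (1 / 2) (1 / 6) (5 / 6)).
- rewrite wilson_moment00 (odd_moment1 LZ Ls).
  have -> : 1 / 2 + 1 / 6 = 2 / 3 :> K by field.
  have -> : 1 / 2 + 5 / 6 = 4 / 3 :> K by field.
  by field; nz.
- by field.
- by field.
have ab : 1 / 2 + 1 / 2 = 1 :> K by field.
have cd : 1 / 6 + 5 / 6 = 1 :> K by field.
refine (odd_wilson_shift ab cd Ls erefl _ _ _ _);
  rewrite !hornerM !hornerE /=; by field.
Qed.

(** The quartic has to vanish at the four sums of 1/3 or -1/3 with 1/6 or -1/6, that
    is at 1/2, 1/6, -1/6, -1/2, whence the parameters 0, 1, 1/3, 2/3. *)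
Lemma wilson_moment_sixth :
  (forall q, L (third_average q) = 1 * (q.[3^-1] - q.[- 3^-1])) ->
  forall i j, wilson_moment L 0 1 i j = 2 / 9 *
    (rising_factorial (1 / 3) i * rising_factorial (2 / 3) i) *
    (rising_factorial (4 / 3) j * rising_factorial (5 / 3) j) / (i + j).+1%:R.
Proof.
move=> Ls i j.
rewrite (@wilson_momentE _ _ LD LZ 0 1 (1 / 3) (2 / 3)).
- rewrite wilson_moment00 (odd_moment1 LZ Ls).
  have -> : 1 + 1 / 3 = 4 / 3 :> K by field.
  have -> : 1 + 2 / 3 = 5 / 3 :> K by field.
  by rewrite !add0r; field; nz.
- by field.
- by field.
have ab : 0 + 1 = 1 :> K by field.
have cd : 1 / 3 + 2 / 3 = 1 :> K by field.
refine (odd_wilson_shift ab cd Ls erefl _ _ _ _);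
  rewrite !hornerM !hornerE /=; by field.
Qed.
End OddCases.

Lemma exp_m27 i : (- 27) ^+ i.*2 * (- 27) ^+ i.*2.+1 = - 27 * (27 ^+ i) ^+ 4 :> K.
Proof.
have h : (- 27) ^+ i.*2 = (27 ^+ i) ^+ 2 :> K.
  by rewrite -mul2n exprM sqrrN -!exprM mulnC.
by rewrite exprS h; ring.
Qed.

Lemma odd_wilson_product_even b i j :
  ('X * wilson_basis b i * ('X * wilson_basis b j)) \Po (- 'X) =
  'X * wilson_basis b i * ('X * wilson_basis b j) :> {poly K}.
Proof. by rewrite !comp_polyM !wilson_basis_even comp_polyX; ring. Qed.

Lemma gram_parity (al be mu w : K) a b m : al + be = 1 -> al * be = 1 ->
  \det (\matrix_(k < m + m, l < m + m)
     moment al be mu w (parity_basis a b k * parity_basis a b l)) =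
  (\prod_(i < m) (i.*2`!%:R ^+ 2 * i.*2.+1`!%:R ^+ 2 / (- 27 * (27 ^+ i) ^+ 4))) *
  \det (form_mx w (m + m)).
Proof.
move=> albeD albeM; have [s [s1 s2]] := exists_parity_perm m.
have sl := size_lead_parity_basis a b s1 s2.
rewrite (gram_det mu w albeD albeM (s := s)); try by move=> k; case: (sl k).
rewrite -big_split /= big1 ?mul1r; last by move=> k _; case: (sl k).
congr (_ * _); rewrite (prod_pairs _ (fun k => k`!%:R ^+ 2 / (- 27) ^+ k)).
by apply: eq_bigr => i _; rewrite -exp_m27 mulrACA -invfM.
Qed.

(** * The value -1 *)

(** The choice mu = 1/2, the midpoint of [al] and [be], makes the two points of
    [moment_shift] opposite. *)
Lemma moment_minus1_shift (al be : K) q : al + be = 1 -> al * be = 1 ->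
  moment al be (1 / 2) (-1) (third_average q) = delta al be * (q.[6^-1] - q.[- 6^-1]).
Proof.
move=> albeD albeM; pose dl := delta al be.
have dl0 : dl != 0 := delta_neq0 albeD albeM.
rewrite /third_average /shift (moment_shift _ _ albeD albeM).
have half : 1 / 2 = (al + be) / 2 by rewrite albeD.
have -> : (be - 1 / 2) / (3 * delta al be) = 6^-1.
  rewrite half (_ : be - _ = dl / 2); last by rewrite /dl /delta; field.
  by rewrite -/dl; field.
have -> : (al - 1 / 2) / (3 * delta al be) = - 6^-1.
  rewrite half (_ : al - _ = - (dl / 2)); last by rewrite /dl /delta; field.
  by rewrite -/dl; field.
by rewrite -/dl !mulN1r opprK -opprD albeD; ring.
Qed.

Lemma det_form_mx_minus1_even (al be : K) m : al + be = 1 -> al * be = 1 ->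
  \det (form_mx (-1 : K) (m + m)) = (-1) ^+ m *
    \prod_(i < m) ((i`!%:R * (3 * i + 1)`!%:R) / (i.*2`!%:R * i.*2.+1`!%:R)) ^+ 4.
Proof.
move=> albeD albeM; pose L := moment al be (1 / 2) (-1); pose dl := delta al be.
have dl0 : dl != 0 := delta_neq0 albeD albeM.
have dl2 : dl ^+ 2 = - 3 := delta2 albeD albeM.
have Ls q : L (third_average q) = dl * (q.[6^-1] - q.[- 6^-1]).
  exact: moment_minus1_shift.
have LD : forall q r, L (q + r) = L q + L r by exact: momentD.
have LZ : forall c q, L (c *: q) = c * L q by exact: momentZ.
pose r i : K := rising_factorial (2 / 3) i * rising_factorial (4 / 3) i.
have := gram_parity (1 / 2) (-1) (1 / 2) (1 / 2) m albeD albeM.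
rewrite -/L (det_parity_gram (E := \matrix_(i, j) (dl / 9 * r i * r j / (i + j + 0).+1%:R))).
- rewrite det_wilson_mx; set C := (X in _ = X * _) => E.
  have C0 : C != 0.
    apply/prodf_neq0 => i _; have f0 := factr_neq0 K.
    by rewrite !mulf_neq0 ?invr_neq0 ?mulf_neq0 ?expf_neq0 ?oppr_eq0 ?f0 ?pnatr_eq0.
  apply: (mulfI C0); rewrite -E [RHS]mulrCA; congr (_ * _).
  rewrite /C -big_split -prodrXl; apply: eq_bigr => i _ /=.
  rewrite -fact_tripleD1 /hilbert_ratio !add0n -/(r i).
  have f0 := factr_neq0 K.
  have t0 : 27 ^+ i != 0 :> K by rewrite expf_neq0 ?pnatr_eq0.
  move: (27 ^+ i) t0 => t t0.
  have -> : (dl / 9 * r i * r i * (i`!%:R ^+ 2 * i`!%:R ^+ 2 / (i.*2`!%:R * (i.*2.+1)`!%:R))) ^+ 2 =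
    dl ^+ 2 * ((r i * r i * (i`!%:R ^+ 2 * i`!%:R ^+ 2 / (i.*2`!%:R * (i.*2.+1)`!%:R))) / 9) ^+ 2.
    by ring.
  by rewrite dl2; field; rewrite !f0 t0.
- move=> i j; rewrite mxE addn0 -(wilson_moment_minus1 LD LZ Ls).
  by rewrite /wilson_moment; congr L; ring.
by move=> i j; apply: (odd_functional_even LD LZ Ls); apply: odd_wilson_product_even.
Qed.

(** The reflection t -> - t changes the sign of the Gram matrix of the powers of t
    and conjugates it by a diagonal matrix of signs. *)
Lemma det_form_mx_minus1_odd (al be : K) n : al + be = 1 -> al * be = 1 ->
  odd n -> \det (form_mx (-1 : K) n) = 0.
Proof.
move=> albeD albeM on; pose L := moment al be (1 / 2) (-1).
have Ls q : L (third_average q) = delta al be * (q.[6^-1] - q.[- 6^-1]).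
  exact: moment_minus1_shift.
have LD : forall q r, L (q + r) = L q + L r by exact: momentD.
have LZ : forall c q, L (c *: q) = c * L q by exact: momentZ.
have sz (i : 'I_n) : size ('X^i : {poly K}) = ((1%g : 'S_n) i).+1 by rewrite perm1 size_polyXn.
have := gram_det (1 / 2) (-1) albeD albeM sz sz.
set M := \matrix_(i, j) _; set C := _ * _ => E.
have detM : \det M = 0.
  have : \det (\matrix_(i < n, j < n) ((-1) ^+ i * (-1) ^+ j * M i j)) = - \det M.
    have -> : \matrix_(i < n, j < n) ((-1) ^+ i * (-1) ^+ j * M i j) = -1 *: M.
      apply/matrixP => i j; rewrite !mxE mulN1r -(odd_functional LD LZ Ls).
      rewrite -LZ; congr L; rewrite comp_polyM !comp_Xn_poly -!mul_polyC polyCM.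
      by rewrite ![(- 'X) ^+ _]exprNn !polyC_exp polyCN polyC1; ring.
    by rewrite detZ -signr_odd on mulN1r.
  rewrite (det_scale_rows_cols (fun i : 'I_n => (-1) ^+ i) (fun i : 'I_n => (-1) ^+ i)).
  rewrite -big_split /= big1 => [|i _]; last by rewrite -expr2 sqrr_sign.
  rewrite mul1r => /eqP; rewrite -subr_eq0 opprK -mulr2n -mulr_natl mulf_eq0 pnatr_eq0 /=.
  by move/eqP.
move: E; rewrite detM => /esym/eqP; rewrite mulf_eq0 => /orP[|/eqP //].
rewrite /C -big_split /= mulf_eq0 => /orP[] /eqP H; exfalso; move: H; apply/eqP.
  by apply/prodf_neq0 => i _; rewrite lead_coefXn mulr1 oner_neq0.
apply/prodf_neq0 => i _.
by rewrite mulf_neq0 ?invr_neq0 ?expf_neq0 ?oppr_eq0 ?factr_neq0 ?pnatr_eq0.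
Qed.

(** * Primitive sixth roots of unity *)

Section SixthRoot.
Variable w : K.
Hypothesis w6 : w ^+ 2 - w + 1 = 0.

Let be := 1 - w.
Let L := moment w be be w.

Lemma sixth_sum : w + be = 1. Proof. by rewrite /be; ring. Qed.
Lemma sixth_prod : w * be = 1.
Proof. by rewrite -[RHS]subr0 -w6 /be; ring. Qed.

Lemma one_plus_sixth_neq0 : 1 + w != 0.
Proof.
apply/eqP => w1; have wE : w = - 1 by rewrite -[w](addKr 1) w1 addr0.
have /eqP := w6; rewrite wE (_ : _ - _ + _ = 3); first by rewrite pnatr_eq0.
by ring.
Qed.

(** For these [w] the functional is not odd, but it differs from a multiple of the
    evaluation at 0 by an odd functional; the evaluation does not see the products
    with an odd factor. *)
Definition sixth_odd_part q : K := q.[0] - L q / (1 + w).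
Let M := sixth_odd_part.

Lemma moment_sixth q : L q = (1 + w) * (q.[0] - M q).
Proof. by rewrite /M /sixth_odd_part; field; rewrite one_plus_sixth_neq0. Qed.

Lemma sixth_odd_partD q r : M (q + r) = M q + M r.
Proof. by rewrite /M /sixth_odd_part /L momentD hornerD; ring. Qed.

Lemma sixth_odd_partZ c q : M (c *: q) = c * M q.
Proof. by rewrite /M /sixth_odd_part /L momentZ hornerZ; ring. Qed.

Lemma sixth_odd_part_shift q : M (third_average q) = 1 * (q.[3^-1] - q.[- 3^-1]).
Proof.
have dl0 := delta_neq0 sixth_sum sixth_prod.
rewrite /M /sixth_odd_part {2}/third_average /L (moment_shift _ _ sixth_sum sixth_prod).
rewrite subrr mul0r.
have -> : (w - be) / (3 * delta w be) = - 3^-1.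
  rewrite (_ : w - be = - delta w be); last by rewrite /delta; ring.
  by field.
have -> : delta w be * ((w - w * be) * q.[0] + (w * w - be) * q.[- 3^-1]) =
   (1 + w) * (q.[0] + 2 * q.[- 3^-1]).
  rewrite sixth_prod (_ : w * w - be = 2 * (w - 1)); last first.
    by rewrite -[RHS]addr0 -w6 /be; ring.
  rewrite (_ : 1 + w = delta w be * (w - 1)); first by ring.
  by rewrite -[RHS](addr0) -[0](mulr0 2) -w6 /delta /be; ring.
rewrite /third_average !hornerD !shift_horner !add0r.
by field; rewrite one_plus_sixth_neq0.
Qed.

Lemma moment_sixth_mixed a b i j :
  L (wilson_basis a i * ('X * wilson_basis b j)) = - (1 + w) * wilson_moment M a b i j.
Proof.
rewrite moment_sixth !hornerM hornerX mul0r mulr0 sub0r mulrN mulNr.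
by rewrite /wilson_moment mulrCA.
Qed.

Lemma sixth_odd_part_even q : q \Po (- 'X) = q -> M q = 0.
Proof.
exact: (odd_functional_even sixth_odd_partD sixth_odd_partZ sixth_odd_part_shift).
Qed.

Lemma det_form_mx_sixth_even m :
  \det (form_mx w (m + m)) = (1 + w) ^+ (m + m) *
    \prod_(i < m) (3^-1 * ((3 * i)`!%:R * (3 * i + 2)`!%:R * i`!%:R ^+ 2 /
       (i.*2`!%:R * i.*2.+1`!%:R) ^+ 2) ^+ 2).
Proof.
pose r i : K := rising_factorial (1 / 3) i * rising_factorial (2 / 3) i.
pose c i : K := rising_factorial (4 / 3) i * rising_factorial (5 / 3) i.
have := gram_parity be w 0 1 m sixth_sum sixth_prod.
rewrite -/L (det_parity_gram (E := \matrix_(i, j)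
  (- (1 + w) * (2 / 9) * r i * c j / (i + j + 0).+1%:R))).
- rewrite det_wilson_mx; set C := (X in _ = X * _) => E.
  have f0 := factr_neq0 K.
  have C0 : C != 0.
    apply/prodf_neq0 => i _.
    by rewrite !mulf_neq0 ?invr_neq0 ?mulf_neq0 ?expf_neq0 ?oppr_eq0 ?f0 ?pnatr_eq0.
  apply: (mulfI C0); rewrite -E.
  have -> : (1 + w) ^+ (m + m) = \prod_(i < m) (1 + w) ^+ 2.
    by rewrite prodr_const card_ord -exprM mul2n addnn.
  have -> : (-1) ^+ m = \prod_(i < m) (-1) :> K by rewrite prodr_const card_ord.
  rewrite /C -prodrXl -!big_split; apply: eq_bigr => i _ /=.
  have -> : (3 * i + 2)`!%:R = 2 * (27 ^+ i * c i * i`!%:R) :> K.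
    by rewrite fact_tripleD2 mulrC divfK // pnatr_eq0.
  rewrite -fact_triple -/(r i) /hilbert_ratio !add0n.
  have t0 : 27 ^+ i != 0 :> K by rewrite expf_neq0 ?pnatr_eq0.
  move: (27 ^+ i) t0 => t t0.
  by field; rewrite !f0 t0.
- move=> i j; rewrite mxE addn0 moment_sixth_mixed.
  rewrite (wilson_moment_sixth sixth_odd_partD sixth_odd_partZ sixth_odd_part_shift) -/(r _) -/(c _).
  by field; nz.
move=> i j; rewrite moment_sixth sixth_odd_part_even; last exact: odd_wilson_product_even.
by rewrite !hornerM hornerX !mul0r subrr mulr0.
Qed.

(** The first element is 1 and all the other even elements vanish at 0, hence are
    orthogonal to it. *)
Definition odd_row_basis m (k : 'I_(1 + (m + m))) : {poly K} :=
  match split k with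
  | inl _ => 1
  | inr k' => match split k' with
    | inl i => wilson_basis 0 i.+1
    | inr j => 'X * wilson_basis 1 j
    end
  end.

(** The constants make the odd elements orthogonal to 1. *)
Definition odd_col_basis m (k : 'I_(1 + (m + m))) : {poly K} :=
  match split k with
  | inl _ => 1
  | inr k' => match split k' with
    | inl i => wilson_basis 0 i.+1
    | inr j => 'X * wilson_basis 1 j + (M ('X * wilson_basis 1 j))%:P
    end
  end.

Lemma sixth_odd_part1 : M 1 = 0.
Proof. by apply: sixth_odd_part_even; rewrite comp_poly1. Qed.

Lemma wilson_basis0S_at0 i : (wilson_basis (0 : K) i.+1).[0] = 0.
Proof.
rewrite /wilson_basis big_ord_recl hornerM hornerD hornerN hornerC hornerXn.
by rewrite addr0 !expr0n subrr mul0r.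
Qed.

(** The first row of the Gram matrix is (1 + w, 0, ..., 0) and the remaining even
    elements are orthogonal to each other; the mixed block is the one of the even
    case without its first row, a Hilbert matrix with shifted index. *)
Lemma det_form_mx_sixth_odd m :
  \det (form_mx w (1 + (m + m))) = (1 + w) ^+ (1 + (m + m)) *
    \prod_(i < m) (3^-1 * ((3 * i + 3)`!%:R * (3 * i + 2)`!%:R * i`!%:R * i.+1`!%:R /
       (i.*2.+1`!%:R * i.*2.+2`!%:R) ^+ 2) ^+ 2).
Proof.
pose r i : K := rising_factorial (1 / 3) i * rising_factorial (2 / 3) i.
pose c i : K := rising_factorial (4 / 3) i * rising_factorial (5 / 3) i.
have [s [s0 s1 s2]] := exists_parity_perm1 m.
have basis_lead k :
    [/\ size (odd_row_basis k) = (s k).+1, size (odd_col_basis k) = (s k).+1 &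
        lead_coef (odd_row_basis k) * lead_coef (odd_col_basis k) = 1].
  rewrite /odd_row_basis /odd_col_basis -(splitK k) unsplitK; case: (split k) => [z|k'] /=.
    by rewrite ord1 s0 size_poly1 lead_coef1 mulr1.
  rewrite -(splitK k') unsplitK; case: (split k') => [i|i] /=.
    by have [-> ->] := size_lead_wilson_basis (0 : K) i.+1; rewrite s1 -expr2 sqrr_sign.
  have := size_lead_odd_wilson_basis (1 : K) i 0; rewrite polyC0 addr0 => -[-> ->].
  have [-> ->] := size_lead_odd_wilson_basis (1 : K) i (M ('X * wilson_basis 1 i)).
  by rewrite s2 -expr2 sqrr_sign.
have szr k : size (odd_row_basis k) = (s k).+1 by have [] := basis_lead k.
have szc k : size (odd_col_basis k) = (s k).+1 by have [] := basis_lead k.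
have := gram_det be w sixth_sum sixth_prod szr szc.
rewrite -/L -[X in _ = X * _ * _]big_split /= big1 ?mul1r; last first.
  by move=> k _; have [] := basis_lead k.
pose E : 'M[K]_m := \matrix_(i, j) (- (1 + w) * (2 / 9) * r i.+1 * c j / (i + j + 1).+1%:R).
have LE (i j : 'I_m) : L (wilson_basis 0 i.+1 * ('X * wilson_basis 1 j)) = E i j.
  rewrite moment_sixth_mixed mxE.
  rewrite (wilson_moment_sixth sixth_odd_partD sixth_odd_partZ sixth_odd_part_shift) -/(r _) -/(c _).
  by rewrite addSn addn1; field; nz.
have L1 i : L (wilson_basis 0 i.+1) = 0.
  rewrite moment_sixth wilson_basis0S_at0 sixth_odd_part_even ?subrr ?mulr0 //.
  exact: wilson_basis_even.
set G := \matrix_(i, j) _.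
have -> : \det G = (1 + w) * ((-1) ^+ m * \det E ^+ 2).
  pose D : 'M[K]_(m + m) := drsubmx G.
  have -> : G = block_mx (1 + w)%:M 0 (dlsubmx G) D.
    rewrite -[LHS]submxK; congr block_mx; apply/matrixP => i j;
      rewrite !mxE /odd_row_basis /odd_col_basis ?split_lshift ?split_rshift.
      rewrite !ord1 eqxx mulr1n mulr1 moment_sixth sixth_odd_part1 subr0.
      by rewrite hornerC mulr1.
    rewrite mul1r -(splitK j) unsplitK; case: (split j) => k /=; first exact: L1.
    rewrite moment_sixth sixth_odd_partD hornerD hornerM hornerX mul0r add0r hornerC.
    rewrite -[(M _)%:P]mulr1 mul_polyC sixth_odd_partZ sixth_odd_part1 mulr0 addr0.
    by rewrite subrr mulr0.
  rewrite det_lblock det_scalar1; congr (_ * _).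
  have -> : D = block_mx 0 E E^T (drsubmx D).
    rewrite -[LHS]submxK; congr block_mx; apply/matrixP => i j;
      rewrite !mxE /odd_row_basis /odd_col_basis !split_rshift ?split_lshift ?split_rshift.
    - rewrite moment_sixth hornerM wilson_basis0S_at0 mul0r sixth_odd_part_even.
        by rewrite subrr mulr0.
      by rewrite comp_polyM !wilson_basis_even.
    - rewrite mulrDr {1}/L momentD -/L LE mxE -[(M _)%:P]mulr1 mul_polyC -scalerAr mulr1.
      by rewrite {1}/L momentZ -/L L1 mulr0 addr0.
    by rewrite mulrC LE mxE.
  by rewrite det_antidiag; [rewrite det_tr expr2 mulrA|left].
rewrite /E (det_wilson_mx (fun i => r i.+1)); set C := (X in _ = X * _) => EQ.
have f0 := factr_neq0 K.
have C0 : C != 0.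
  apply/prodf_neq0 => i _.
  by rewrite !mulf_neq0 ?invr_neq0 ?mulf_neq0 ?expf_neq0 ?oppr_eq0 ?f0 ?pnatr_eq0.
apply: (mulfI C0); rewrite -EQ [(1 + w) ^+ (1 + _)]exprD expr1 -mulrA [RHS]mulrCA; congr (_ * _).
have -> : (1 + w) ^+ (m + m) = \prod_(i < m) (1 + w) ^+ 2.
  by rewrite prodr_const card_ord -exprM mul2n addnn.
have -> : (-1) ^+ m = \prod_(i < m) (-1) :> K by rewrite prodr_const card_ord.
have -> : C = \prod_(i < m) (i.*2.+1`!%:R ^+ 2 * i.*2.+2`!%:R ^+ 2 /
    (- 27 ^+ 3 * (27 ^+ i) ^+ 4)).
  rewrite /C big_ord_recl fact0 expr1n expr0 divr1 mul1r.
  rewrite (prod_pairs _ (fun k => k.+1`!%:R ^+ 2 / (- 27) ^+ k.+1)).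
  apply: eq_bigr => i _; rewrite mulrACA -invfM; congr (_ / _).
  rewrite exprS (exprS _ i.*2.+1).
  transitivity ((- 27) ^+ 2 * ((- 27) ^+ i.*2 * (- 27) ^+ i.*2.+1) : K); first by ring.
  by rewrite exp_m27; ring.
rewrite -prodrXl -!big_split; apply: eq_bigr => i _ /=.
have -> : (3 * i + 2)`!%:R = 2 * (27 ^+ i * c i * i`!%:R) :> K.
  by rewrite fact_tripleD2 mulrC divfK // pnatr_eq0.
have -> : (3 * i + 3)%N = (3 * i.+1)%N by lia.
rewrite -fact_triple -/(r i.+1) /hilbert_ratio (exprS _ i) !add1n.
have t0 : 27 ^+ i != 0 :> K by rewrite expf_neq0 ?pnatr_eq0.
move: (27 ^+ i) t0 => t t0.
by field; rewrite !f0 t0.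
Qed.
End SixthRoot.
End ParityGram.

(** * Telescoping of the products of rising factorials *)

Section Products.
Variable K : numFieldType.
Local Notation rf := (@rising_factorial K).

Lemma rising_factorial_recl (x : K) k : rf x k.+1 = x * rf (x + 1) k.
Proof.
rewrite /rising_factorial big_nat_recl // addr0; congr (_ * _).
by apply: eq_bigr => i _; rewrite -natr1; ring.
Qed.

Lemma rising_factorial_nat n k : rf n.+1%:R k * n`!%:R = (n + k)`!%:R.
Proof.
elim: k => [|k IH]; first by rewrite rising_factorial0 mul1r addn0.
by rewrite rising_factorialS addnS factS natrM -IH; ring.
Qed.

Lemma rising_factorial_half n k :
  rf (n%:R + 1 / 2) k * (4 ^+ k * (n + k)`!%:R * (2 * n)`!%:R) =
  (2 * n + 2 * k)`!%:R * n`!%:R.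
Proof.
elim: k => [|k IH]; first by rewrite rising_factorial0 !mul1r muln0 !addn0 mulrC.
rewrite (_ : 2 * n + 2 * k.+1 = (2 * n + 2 * k).+2)%N; last by lia.
rewrite rising_factorialS addnS !factS exprS !natrM.
transitivity ((2 * n + 2 * k).+2%:R * (2 * n + 2 * k).+1%:R * ((2 * n + 2 * k)`!%:R * n`!%:R) : K).
  by rewrite -IH; field.
by ring.
Qed.

Lemma odd_double_factorial_fact n :
  (odd_double_factorial n)%:R * (2 ^+ n * n`!%:R) = (2 * n)`!%:R :> K.
Proof.
elim: n => [|n IH]; first by rewrite /odd_double_factorial big_geq // muln0 !mulr1.
have -> : odd_double_factorial n.+1 = (odd_double_factorial n * (2 * n).+1)%N.
  by rewrite /odd_double_factorial big_nat_recr //=; congr (_ * _)%N; lia.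
rewrite (_ : 2 * n.+1 = (2 * n).+2)%N; last by lia.
rewrite !factS !natrM -IH exprS; ring.
Qed.

Lemma prod_descending (x : K) g :
  \prod_(0 <= i < g) (x - i%:R) = rf (x - g%:R + 1) g.
Proof.
rewrite /rising_factorial big_nat_rev add0n; apply: eq_big_nat => i /andP[_ ig].
by rewrite natrB // -natr1; ring.
Qed.

Lemma prod_cond_double N m (F : nat -> K) : (uphalf m <= N)%N ->
  \prod_(0 <= i < N | (2 * i < m)%N) F i = \prod_(0 <= i < uphalf m) F i.
Proof.
move=> mN; rewrite (big_nat_widen _ _ _ _ _ mN); apply: eq_bigl => i.
by rewrite /=; lia.
Qed.

Lemma prod_mul_cond N (P : pred nat) (F G H : nat -> K) :
  (forall i, F i = (if P i then H i else 1) * G i) ->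
  \prod_(0 <= i < N) F i = \prod_(0 <= i < N | P i) H i * \prod_(0 <= i < N) G i.
Proof.
move=> E; rewrite [X in X * _]big_mkcond -big_split; apply: eq_bigr => i _; exact: E.
Qed.

Definition third_root_factor a i : K :=
  rf (3 * i%:R + 1) ((a - 4 * i)./2)%N * rf (3 * i%:R + 3) ((a - 4 * i - 3)./2)%N *
  rf (a%:R - i%:R + 1 / 2) ((a - 4 * i - 1)./2)%N *
  rf (a%:R - i%:R - 1 / 2) ((a - 4 * i - 2)./2)%N.

Definition sixth_root_factor a i : K :=
  rf (3 * i%:R + 3 / 2) ((a - 4 * i - 1)./2)%N * rf (3 * i%:R + 5 / 2) ((a - 4 * i - 2)./2)%N *
  rf (a%:R - i%:R) ((a - 4 * i)./2)%N * rf (a%:R - i%:R) ((a - 4 * i - 3)./2)%N.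

(** The mechanism common to the four lemmas below, where f belongs to a and g to
    a + 1.  Of the four families, one acquires the new last factors A i and one is unchanged.
    The bases of the other two contain a - i, which stays the same when a and i both
    increase by 1; so g3 is taken at the next index, which leaves g3 0 and costs the
    factors B i.  The conditions P and Q mark the indices at which the truncated
    subscripts change. *)
Lemma prod_telescope N (f1 f2 f3 f4 g1 g2 g3 g4 : nat -> K) (P Q : pred nat) (A B : nat -> K) :
  (forall i, g1 i = (if P i then A i else 1) * f1 i) ->
  (forall i, g2 i = f2 i) ->
  (forall i, f3 i * f4 i = (if Q i then B i else 1) * (g3 i.+1 * g4 i)) ->
  g1 N = 1 -> g2 N = 1 -> g4 N = 1 ->
  \prod_(0 <= i < N | Q i) B i *
    \prod_(0 <= i < N.+1) (g1 i * g2 i * g3 i * g4 i) =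
  \prod_(0 <= i < N | P i) A i * g3 0%N *
    \prod_(0 <= i < N) (f1 i * f2 i * f3 i * f4 i).
Proof.
move=> E1 E2 E34 z1 z2 z4; rewrite !big_split /=.
rewrite [\prod_(0 <= i < N.+1) g1 i]big_nat_recr // [\prod_(0 <= i < N.+1) g2 i]big_nat_recr //.
rewrite [\prod_(0 <= i < N.+1) g4 i]big_nat_recr // [\prod_(0 <= i < N.+1) g3 i]big_nat_recl //.
rewrite /= z1 z2 z4 !mulr1 (prod_mul_cond _ E1).
have -> : \prod_(0 <= i < N) g2 i = \prod_(0 <= i < N) f2 i by apply: eq_bigr.
have := prod_mul_cond N E34; rewrite !big_split /=.
move: (\prod_(0 <= i < N) f3 i) (\prod_(0 <= i < N) f4 i) => F3 F4 E.
transitivity (\prod_(0 <= i < N | P i) A i * g3 0%N *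
   (\prod_(0 <= i < N) f1 i * \prod_(0 <= i < N) f2 i) * (F3 * F4)); last by ring.
by rewrite E; ring.
Qed.

Lemma sixth_even_step m :
  \prod_(0 <= i < uphalf m) ((m.*2)%:R - i%:R) *
    \prod_(0 <= i < m.*2.+2) sixth_root_factor m.*2.+1 i =
  rf (m%:R + 1 / 2) (uphalf m) * rf (m.*2.+1)%:R m *
    \prod_(0 <= i < m.*2.+1) sixth_root_factor m.*2 i.
Proof.
have gm : (uphalf m <= m.*2.+1)%N by lia.
have := @prod_telescope m.*2.+1
  (fun i => rf (3 * i%:R + 3 / 2) ((m.*2 - 4 * i - 1)./2)%N)
  (fun i => rf (3 * i%:R + 5 / 2) ((m.*2 - 4 * i - 2)./2)%N)
  (fun i => rf ((m.*2)%:R - i%:R) ((m.*2 - 4 * i)./2)%N)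
  (fun i => rf ((m.*2)%:R - i%:R) ((m.*2 - 4 * i - 3)./2)%N)
  (fun i => rf (3 * i%:R + 3 / 2) ((m.*2.+1 - 4 * i - 1)./2)%N)
  (fun i => rf (3 * i%:R + 5 / 2) ((m.*2.+1 - 4 * i - 2)./2)%N)
  (fun i => rf ((m.*2.+1)%:R - i%:R) ((m.*2.+1 - 4 * i)./2)%N)
  (fun i => rf ((m.*2.+1)%:R - i%:R) ((m.*2.+1 - 4 * i - 3)./2)%N)
  (fun i => 2 * i < m)%N (fun i => 2 * i < m)%N
  (fun i => m%:R + 1 / 2 + i%:R) (fun i => (m.*2)%:R - i%:R).
rewrite !prod_cond_double // => ->; [|move=> i..| | |].
- by rewrite /= subr0; congr (_ * rf _ _ * _); lia.
- case: ltnP => im.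
    have -> : ((m.*2.+1 - 4 * i - 1)./2 = ((m.*2 - 4 * i - 1)./2).+1)%N by lia.
    rewrite rising_factorialS mulrC; congr (_ * _).
    have -> : ((m.*2 - 4 * i - 1)./2 = m - 2 * i - 1)%N by lia.
    by rewrite !natrB; [field|lia..].
  by rewrite [1 * rf _ _]mul1r; congr rf; lia.
- by congr rf; lia.
- rewrite (_ : (m.*2.+1 - 4 * i.+1)./2 = (m.*2 - 4 * i - 3)./2)%N; last by lia.
  have -> : (m.*2.+1)%:R - i.+1%:R = (m.*2)%:R - i%:R :> K by rewrite -2!natr1; ring.
  rewrite mulrCA [LHS]mulrC; congr (_ * _).
  case: ltnP => im.
    rewrite (_ : (m.*2 - 4 * i)./2 = ((m.*2.+1 - 4 * i - 3)./2).+1)%N; last by lia.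
    by rewrite rising_factorial_recl; congr (_ * rf _ _); rewrite -natr1; ring.
  rewrite [1 * rf _ _]mul1r (_ : (m.*2 - 4 * i)./2 = 0)%N; last by lia.
  rewrite (_ : (m.*2.+1 - 4 * i - 3)./2 = 0)%N; last by lia.
  by rewrite !rising_factorial0.
- by rewrite (_ : (_)./2 = 0)%N ?rising_factorial0 //; lia.
- by rewrite (_ : (_)./2 = 0)%N ?rising_factorial0 //; lia.
- by rewrite (_ : (_)./2 = 0)%N ?rising_factorial0 //; lia.
Qed.

Lemma sixth_odd_step m :
  \prod_(0 <= i < uphalf m) ((m.*2.+1)%:R - i%:R) *
    \prod_(0 <= i < m.*2.+3) sixth_root_factor m.*2.+2 i =
  rf (m%:R + 3 / 2) (uphalf m) * rf (m.*2.+2)%:R m.+1 *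
    \prod_(0 <= i < m.*2.+2) sixth_root_factor m.*2.+1 i.
Proof.
have gm : (uphalf m <= m.*2.+2)%N by lia.
have E a N : \prod_(0 <= i < N) sixth_root_factor a i = \prod_(0 <= i < N) (
    rf (3 * i%:R + 5 / 2) ((a - 4 * i - 2)./2)%N * rf (3 * i%:R + 3 / 2) ((a - 4 * i - 1)./2)%N *
    rf (a%:R - i%:R) ((a - 4 * i)./2)%N * rf (a%:R - i%:R) ((a - 4 * i - 3)./2)%N).
  by apply: eq_bigr => i _; rewrite /sixth_root_factor; congr (_ * _ * _); rewrite mulrC.
rewrite !E.
have := @prod_telescope m.*2.+2
  (fun i => rf (3 * i%:R + 5 / 2) ((m.*2.+1 - 4 * i - 2)./2)%N)
  (fun i => rf (3 * i%:R + 3 / 2) ((m.*2.+1 - 4 * i - 1)./2)%N)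
  (fun i => rf ((m.*2.+1)%:R - i%:R) ((m.*2.+1 - 4 * i)./2)%N)
  (fun i => rf ((m.*2.+1)%:R - i%:R) ((m.*2.+1 - 4 * i - 3)./2)%N)
  (fun i => rf (3 * i%:R + 5 / 2) ((m.*2.+2 - 4 * i - 2)./2)%N)
  (fun i => rf (3 * i%:R + 3 / 2) ((m.*2.+2 - 4 * i - 1)./2)%N)
  (fun i => rf ((m.*2.+2)%:R - i%:R) ((m.*2.+2 - 4 * i)./2)%N)
  (fun i => rf ((m.*2.+2)%:R - i%:R) ((m.*2.+2 - 4 * i - 3)./2)%N)
  (fun i => 2 * i < m)%N (fun i => 2 * i < m)%N
  (fun i => m%:R + 3 / 2 + i%:R) (fun i => (m.*2.+1)%:R - i%:R).
rewrite !prod_cond_double // => ->; [|move=> i..| | |].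
- by rewrite /= subr0; congr (_ * rf _ _ * _); lia.
- case: ltnP => im.
    have -> : ((m.*2.+2 - 4 * i - 2)./2 = ((m.*2.+1 - 4 * i - 2)./2).+1)%N by lia.
    rewrite rising_factorialS mulrC; congr (_ * _).
    have -> : ((m.*2.+1 - 4 * i - 2)./2 = m - 2 * i - 1)%N by lia.
    by rewrite !natrB; [field|lia..].
  by rewrite [1 * rf _ _]mul1r; congr rf; lia.
- by congr rf; lia.
- rewrite (_ : (m.*2.+2 - 4 * i.+1)./2 = (m.*2.+1 - 4 * i - 3)./2)%N; last by lia.
  have -> : (m.*2.+2)%:R - i.+1%:R = (m.*2.+1)%:R - i%:R :> K by ring.
  rewrite mulrCA [LHS]mulrC; congr (_ * _).
  case: ltnP => im.
    rewrite (_ : (m.*2.+1 - 4 * i)./2 = ((m.*2.+2 - 4 * i - 3)./2).+1)%N; last by lia.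
    by rewrite rising_factorial_recl; congr (_ * rf _ _); ring.
  rewrite [1 * rf _ _]mul1r (_ : (m.*2.+1 - 4 * i)./2 = 0)%N; last by lia.
  rewrite (_ : (m.*2.+2 - 4 * i - 3)./2 = 0)%N; last by lia.
  by rewrite !rising_factorial0.
- by rewrite (_ : (_)./2 = 0)%N ?rising_factorial0 //; lia.
- by rewrite (_ : (_)./2 = 0)%N ?rising_factorial0 //; lia.
- by rewrite (_ : (_)./2 = 0)%N ?rising_factorial0 //; lia.
Qed.

Lemma third_even_step m :
  \prod_(0 <= i < m./2) ((m.*2)%:R - 1 / 2 - i%:R) *
    \prod_(0 <= i < m.*2.+2) third_root_factor m.*2.+1 i =
  rf m.+1%:R m./2 * rf ((m.*2.+1)%:R + 1 / 2) m *
    \prod_(0 <= i < m.*2.+1) third_root_factor m.*2 i.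
Proof.
have mh : m./2 = uphalf m.-1 by lia.
have gm : (uphalf m.-1 <= m.*2.+1)%N by lia.
have E a N : \prod_(0 <= i < N) third_root_factor a i = \prod_(0 <= i < N) (
    rf (3 * i%:R + 3) ((a - 4 * i - 3)./2)%N * rf (3 * i%:R + 1) ((a - 4 * i)./2)%N *
    rf (a%:R - i%:R + 1 / 2) ((a - 4 * i - 1)./2)%N *
    rf (a%:R - i%:R - 1 / 2) ((a - 4 * i - 2)./2)%N).
  by apply: eq_bigr => i _; rewrite /third_root_factor; congr (_ * _ * _); rewrite mulrC.
rewrite !E.
have := @prod_telescope m.*2.+1
  (fun i => rf (3 * i%:R + 3) ((m.*2 - 4 * i - 3)./2)%N)
  (fun i => rf (3 * i%:R + 1) ((m.*2 - 4 * i)./2)%N)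
  (fun i => rf ((m.*2)%:R - i%:R + 1 / 2) ((m.*2 - 4 * i - 1)./2)%N)
  (fun i => rf ((m.*2)%:R - i%:R - 1 / 2) ((m.*2 - 4 * i - 2)./2)%N)
  (fun i => rf (3 * i%:R + 3) ((m.*2.+1 - 4 * i - 3)./2)%N)
  (fun i => rf (3 * i%:R + 1) ((m.*2.+1 - 4 * i)./2)%N)
  (fun i => rf ((m.*2.+1)%:R - i%:R + 1 / 2) ((m.*2.+1 - 4 * i - 1)./2)%N)
  (fun i => rf ((m.*2.+1)%:R - i%:R - 1 / 2) ((m.*2.+1 - 4 * i - 2)./2)%N)
  (fun i => 2 * i < m.-1)%N (fun i => 2 * i < m.-1)%N
  (fun i => m.+1%:R + i%:R) (fun i => (m.*2)%:R - 1 / 2 - i%:R).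
rewrite !prod_cond_double // mh => ->; [|move=> i..| | |].
- by rewrite /= subr0; congr (_ * rf _ _ * _); lia.
- case: ltnP => im.
    have -> : ((m.*2.+1 - 4 * i - 3)./2 = ((m.*2 - 4 * i - 3)./2).+1)%N by lia.
    rewrite rising_factorialS mulrC; congr (_ * _).
    have -> : ((m.*2 - 4 * i - 3)./2 = m - 2 * i - 2)%N by lia.
    by rewrite !natrB; [ring|lia..].
  by rewrite [1 * rf _ _]mul1r; congr rf; lia.
- by congr rf; lia.
- have -> : rf ((m.*2.+1)%:R - i%:R - 1 / 2) ((m.*2.+1 - 4 * i - 2)./2)%N =
    rf ((m.*2)%:R - i%:R + 1 / 2) ((m.*2 - 4 * i - 1)./2)%N.
    by congr rf; [field|lia].
  rewrite [LHS]mulrC mulrA; congr (_ * _).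
  have -> : (m.*2.+1)%:R - i.+1%:R + 1 / 2 = (m.*2)%:R - i%:R + 1 / 2 :> K by ring.
  case: ltnP => im.
    rewrite (_ : (m.*2 - 4 * i - 2)./2 = ((m.*2.+1 - 4 * i.+1 - 1)./2).+1)%N; last by lia.
    by rewrite rising_factorial_recl; congr (_ * rf _ _); field.
  rewrite [1 * rf _ _]mul1r (_ : (m.*2 - 4 * i - 2)./2 = 0)%N; last by lia.
  rewrite (_ : (m.*2.+1 - 4 * i.+1 - 1)./2 = 0)%N; last by lia.
  by rewrite !rising_factorial0.
- by rewrite (_ : (_)./2 = 0)%N ?rising_factorial0 //; lia.
- by rewrite (_ : (_)./2 = 0)%N ?rising_factorial0 //; lia.
- by rewrite (_ : (_)./2 = 0)%N ?rising_factorial0 //; lia.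
Qed.

Lemma third_odd_step m :
  \prod_(0 <= i < m./2) ((m.*2.+1)%:R - 1 / 2 - i%:R) *
    \prod_(0 <= i < m.*2.+3) third_root_factor m.*2.+2 i =
  rf m.+1%:R (m./2).+1 * rf ((m.*2.+2)%:R + 1 / 2) m *
    \prod_(0 <= i < m.*2.+2) third_root_factor m.*2.+1 i.
Proof.
have mh : m./2 = uphalf m.-1 by lia.
have mh1 : (m./2).+1 = uphalf m.+1 by lia.
have gm : (uphalf m.-1 <= m.*2.+2)%N by lia.
have gm1 : (uphalf m.+1 <= m.*2.+2)%N by lia.
have := @prod_telescope m.*2.+2
  (fun i => rf (3 * i%:R + 1) ((m.*2.+1 - 4 * i)./2)%N)
  (fun i => rf (3 * i%:R + 3) ((m.*2.+1 - 4 * i - 3)./2)%N)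
  (fun i => rf ((m.*2.+1)%:R - i%:R + 1 / 2) ((m.*2.+1 - 4 * i - 1)./2)%N)
  (fun i => rf ((m.*2.+1)%:R - i%:R - 1 / 2) ((m.*2.+1 - 4 * i - 2)./2)%N)
  (fun i => rf (3 * i%:R + 1) ((m.*2.+2 - 4 * i)./2)%N)
  (fun i => rf (3 * i%:R + 3) ((m.*2.+2 - 4 * i - 3)./2)%N)
  (fun i => rf ((m.*2.+2)%:R - i%:R + 1 / 2) ((m.*2.+2 - 4 * i - 1)./2)%N)
  (fun i => rf ((m.*2.+2)%:R - i%:R - 1 / 2) ((m.*2.+2 - 4 * i - 2)./2)%N)
  (fun i => 2 * i < m.+1)%N (fun i => 2 * i < m.-1)%N
  (fun i => m.+1%:R + i%:R) (fun i => (m.*2.+1)%:R - 1 / 2 - i%:R).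
rewrite !prod_cond_double // mh1 mh => ->; [|move=> i..| | |].
- by rewrite /= subr0; congr (_ * rf _ _ * _); lia.
- case: ltnP => im.
    have -> : ((m.*2.+2 - 4 * i)./2 = ((m.*2.+1 - 4 * i)./2).+1)%N by lia.
    rewrite rising_factorialS mulrC; congr (_ * _).
    have -> : ((m.*2.+1 - 4 * i)./2 = m - 2 * i)%N by lia.
    by rewrite !natrB; [ring|lia..].
  by rewrite [1 * rf _ _]mul1r; congr rf; lia.
- by congr rf; lia.
- have -> : rf ((m.*2.+2)%:R - i%:R - 1 / 2) ((m.*2.+2 - 4 * i - 2)./2)%N =
    rf ((m.*2.+1)%:R - i%:R + 1 / 2) ((m.*2.+1 - 4 * i - 1)./2)%N.
    by congr rf; [field|lia].
  rewrite [LHS]mulrC mulrA; congr (_ * _).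
  have -> : (m.*2.+2)%:R - i.+1%:R + 1 / 2 = (m.*2.+1)%:R - i%:R + 1 / 2 :> K by ring.
  case: ltnP => im.
    rewrite (_ : (m.*2.+1 - 4 * i - 2)./2 = ((m.*2.+2 - 4 * i.+1 - 1)./2).+1)%N; last by lia.
    by rewrite rising_factorial_recl; congr (_ * rf _ _); field.
  rewrite [1 * rf _ _]mul1r (_ : (m.*2.+1 - 4 * i - 2)./2 = 0)%N; last by lia.
  rewrite (_ : (m.*2.+2 - 4 * i.+1 - 1)./2 = 0)%N; last by lia.
  by rewrite !rising_factorial0.
- by rewrite (_ : (_)./2 = 0)%N ?rising_factorial0 //; lia.
- by rewrite (_ : (_)./2 = 0)%N ?rising_factorial0 //; lia.
- by rewrite (_ : (_)./2 = 0)%N ?rising_factorial0 //; lia.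
Qed.

End Products.

(** * Factorial form of the ratios *)

Section ClosedForms.
Variable K : numFieldType.
Local Notation rf := (@rising_factorial K).
Let f0 := factr_neq0 K.

Lemma rising_factorial_natE n k : rf n.+1%:R k = (n + k)`!%:R / n`!%:R.
Proof. by rewrite -rising_factorial_nat mulfK. Qed.

Lemma rising_factorial_halfE n k : rf (n%:R + 1 / 2) k =
  (2 * n + 2 * k)`!%:R * n`!%:R / (4 ^+ k * (n + k)`!%:R * (2 * n)`!%:R).
Proof. by rewrite -rising_factorial_half mulfK // !mulf_neq0 ?expf_neq0 ?f0 ?pnatr_eq0. Qed.

Lemma odd_double_factorialE n :
  (odd_double_factorial n)%:R = (2 * n)`!%:R / (2 ^+ n * n`!%:R) :> K.
Proof. by rewrite -odd_double_factorial_fact mulfK // !mulf_neq0 ?expf_neq0 ?f0 ?pnatr_eq0. Qed.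

Lemma odd_double_factorial_neq0 n : (odd_double_factorial n)%:R != 0 :> K.
Proof. by rewrite odd_double_factorialE !mulf_neq0 ?invr_neq0 ?mulf_neq0 ?expf_neq0 ?f0 ?pnatr_eq0. Qed.

Lemma exp4 n : 4 ^+ n = 2 ^+ n.*2 :> K.
Proof. by rewrite -mul2n exprM; congr (_ ^+ _); ring. Qed.

(** The factors acquired by the formula for sixth roots of unity in passing from order 2m to 2m + 1, and
    below from 2m + 1 to 2m + 2. *)
Definition sixth_ratio0 m : K := ((3 * m)`!%:R * m`!%:R / (2 * m)`!%:R ^+ 2) ^+ 2.
Definition sixth_ratio1 m : K :=
  3^-1 * ((3 * m + 2)`!%:R * m`!%:R / (2 * m + 1)`!%:R ^+ 2) ^+ 2.

(** The ratio of the numbers of alternating sign matrices of orders a + 1 and a. *)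
Definition third_ratio a : K :=
  (3 * a + 1)`!%:R * a`!%:R / (a.*2`!%:R * a.*2.+1`!%:R).

Lemma sixth_ratio0E m : rf (m%:R + 1 / 2) (uphalf m) * rf (m.*2.+1)%:R m =
  sixth_ratio0 m * (odd_double_factorial m)%:R *
    \prod_(0 <= i < uphalf m) ((m.*2)%:R - i%:R).
Proof.
rewrite prod_descending.
have -> : (m.*2)%:R - (uphalf m)%:R + 1 = (m.*2 - uphalf m).+1%:R :> K.
  by rewrite -[RHS]natr1 natrB //; lia.
rewrite !rising_factorial_natE rising_factorial_halfE odd_double_factorialE /sixth_ratio0.
have t0 n : 2 ^+ n != 0 :> K by rewrite expf_neq0 ?pnatr_eq0.
(* The number of factors is about m / 2: once everything is written with
   factorials the identity depends on the parity of m. *)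
rewrite exp4; have [h [em|em]] : exists h, m = h.*2 \/ m = h.*2.+1 by exists m./2; lia.
  have -> : uphalf m = h by lia.
  have -> : (2 * m + 2 * h = 6 * h)%N by lia.
  have -> : (m + h = 3 * h)%N by lia.
  have -> : (m.*2 + m = 6 * h)%N by lia.
  have -> : (m.*2 - h + h = 2 * m)%N by lia.
  have -> : (m.*2 - h = 3 * h)%N by lia.
  have -> : (m.*2 = 2 * m)%N by lia.
  have -> : (3 * m = 6 * h)%N by lia.
  have -> : h.*2 = m by lia.
  by field; rewrite !f0 t0.
have -> : uphalf m = h.+1 by lia.
have -> : (2 * m + 2 * h.+1 = (6 * h).+4)%N by lia.
have -> : (m + h.+1 = (3 * h).+2)%N by lia.
have -> : (m.*2 + m = (6 * h).+3)%N by lia.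
have -> : (m.*2 - h.+1 + h.+1 = 2 * m)%N by lia.
have -> : (m.*2 - h.+1 = (3 * h).+1)%N by lia.
have -> : (m.*2 = 2 * m)%N by lia.
have -> : (3 * m = (6 * h).+3)%N by lia.
have -> : h.+1.*2 = m.+1 by lia.
rewrite (factS (6 * h).+3) (factS (3 * h).+1) !natrM (exprS 2 m).
by field; rewrite !f0 t0; nz.
Qed.

Lemma sixth_ratio1E m :
  2 / 3 * rf (m%:R + 3 / 2) (uphalf m) * rf (m.*2.+2)%:R m.+1 =
  sixth_ratio1 m * (odd_double_factorial m.+1)%:R *
    \prod_(0 <= i < uphalf m) ((m.*2.+1)%:R - i%:R).
Proof.
rewrite prod_descending.
have -> : m%:R + 3 / 2 = m.+1%:R + 1 / 2 :> K by rewrite -natr1; field.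
have -> : (m.*2.+1)%:R - (uphalf m)%:R + 1 = (m.*2.+1 - uphalf m).+1%:R :> K.
  by rewrite -[RHS]natr1 natrB //; lia.
rewrite !rising_factorial_natE rising_factorial_halfE odd_double_factorialE /sixth_ratio1.
have t0 n : 2 ^+ n != 0 :> K by rewrite expf_neq0 ?pnatr_eq0.
rewrite exp4; have [h [em|em]] : exists h, m = h.*2 \/ m = h.*2.+1 by exists m./2; lia.
  have -> : uphalf m = h by lia.
  have -> : (2 * m.+1 + 2 * h = (6 * h).+2)%N by lia.
  have -> : (m.+1 + h = (3 * h).+1)%N by lia.
  have -> : (m.*2.+1 + m.+1 = (6 * h).+2)%N by lia.
  have -> : (m.*2.+1 - h + h = m.*2.+1)%N by lia.
  have -> : (m.*2.+1 - h = (3 * h).+1)%N by lia.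
  have -> : (2 * m.+1 = m.*2.+2)%N by lia.
  have -> : (2 * m + 1 = m.*2.+1)%N by lia.
  have -> : (3 * m + 2 = (6 * h).+2)%N by lia.
  have -> : h.*2 = m by lia.
  rewrite (factS m.*2.+1) (factS m) !natrM (exprS 2 m).
  have -> : m.*2.+2%:R = 2 * m.+1%:R :> K by rewrite -natrM; congr _%:R; lia.
  by field; rewrite !f0 t0; nz.
have -> : uphalf m = h.+1 by lia.
have -> : (2 * m.+1 + 2 * h.+1 = (6 * h).+4.+2)%N by lia.
have -> : (m.+1 + h.+1 = (3 * h).+3)%N by lia.
have -> : (m.*2.+1 + m.+1 = (6 * h).+4.+1)%N by lia.
have -> : (m.*2.+1 - h.+1 + h.+1 = m.*2.+1)%N by lia.
have -> : (m.*2.+1 - h.+1 = (3 * h).+2)%N by lia.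
have -> : (2 * m.+1 = m.*2.+2)%N by lia.
have -> : (2 * m + 1 = m.*2.+1)%N by lia.
have -> : (3 * m + 2 = (6 * h).+4.+1)%N by lia.
have -> : h.+1.*2 = m.+1 by lia.
rewrite (factS m.*2.+1) (factS m) (factS (6 * h).+4.+1) (factS (3 * h).+2) !natrM (exprS 2 m).
have -> : m.*2.+2%:R = 2 * m.+1%:R :> K by rewrite -natrM; congr _%:R; lia.
have -> : (6 * h).+4.+2%:R = 2 * (3 * h).+3%:R :> K by rewrite -natrM; congr _%:R; lia.
by field; rewrite !f0 t0; nz.
Qed.

Lemma third_ratio_evenE m :
  rf m.+1%:R m./2 * rf ((m.*2.+1)%:R + 1 / 2) m =
  third_ratio m.*2 * (odd_double_factorial m)%:R *
    \prod_(0 <= i < m./2) ((m.*2)%:R - 1 / 2 - i%:R).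
Proof.
rewrite prod_descending.
have -> : (m.*2)%:R - 1 / 2 - (m./2)%:R + 1 = (m.*2 - m./2)%:R + 1 / 2 :> K.
  by rewrite natrB; [field|lia].
rewrite rising_factorial_natE !rising_factorial_halfE odd_double_factorialE /third_ratio.
have t0 n : 2 ^+ n != 0 :> K by rewrite expf_neq0 ?pnatr_eq0.
rewrite !exp4; have [h [em|em]] : exists h, m = h.*2 \/ m = h.*2.+1 by exists m./2; lia.
  have -> : m./2 = h by lia.
  have -> : (m.*2 - h + h = 2 * m)%N by lia.
  have -> : (2 * (m.*2 - h) + 2 * h = m.*2.*2)%N by lia.
  have -> : (2 * (m.*2 - h) = 6 * h)%N by lia.
  have -> : (m.*2 - h = 3 * h)%N by lia.
  have -> : (m + h = 3 * h)%N by lia.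
  have -> : (2 * m.*2.+1 + 2 * m = (12 * h).+2)%N by lia.
  have -> : (m.*2.+1 + m = (6 * h).+1)%N by lia.
  have -> : (3 * m.*2 + 1 = (12 * h).+1)%N by lia.
  have -> : (2 * m.*2.+1 = m.*2.*2.+2)%N by lia.
  have -> : (2 * m = m.*2)%N by lia.
  have -> : h.*2 = m by lia.
  rewrite (factS m.*2) (factS (12 * h).+1) (factS (6 * h)) (factS m.*2.*2.+1) (factS m.*2.*2) !natrM.
  have -> : 2 ^+ m.*2 = 2 ^+ m * 2 ^+ m :> K by rewrite -exprD addnn.
  have -> : m.*2.*2.+2%:R = 2 * m.*2.+1%:R :> K by rewrite -natrM; congr _%:R; lia.
  have -> : (12 * h).+2%:R = 2 * (6 * h).+1%:R :> K by rewrite -natrM; congr _%:R; lia.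
  by field; rewrite !f0 t0; nz.
have -> : m./2 = h by lia.
have -> : (m.*2 - h + h = 2 * m)%N by lia.
have -> : (2 * (m.*2 - h) + 2 * h = m.*2.*2)%N by lia.
have -> : (2 * (m.*2 - h) = (6 * h).+4)%N by lia.
have -> : (m.*2 - h = (3 * h).+2)%N by lia.
have -> : (m + h = (3 * h).+1)%N by lia.
have -> : (2 * m.*2.+1 + 2 * m = (12 * h).+4.+4)%N by lia.
have -> : (m.*2.+1 + m = (6 * h).+4)%N by lia.
have -> : (3 * m.*2 + 1 = (12 * h).+4.+3)%N by lia.
have -> : (2 * m.*2.+1 = m.*2.*2.+2)%N by lia.
have -> : (2 * m = m.*2)%N by lia.
have e2 : m = h.*2.+1 by [].
have -> : 2 ^+ m.*2 = 2 ^+ m * (2 * 2 ^+ h.*2) :> K by rewrite -exprS -exprD; congr (_ ^+ _); lia.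
rewrite (factS m.*2) (factS (12 * h).+4.+3) (factS (3 * h).+1) (factS m.*2.*2.+1) (factS m.*2.*2) !natrM.
have -> : m.*2.*2.+2%:R = 2 * m.*2.+1%:R :> K by rewrite -natrM; congr _%:R; lia.
have -> : (12 * h).+4.+4%:R = 4 * (3 * h).+2%:R :> K by rewrite -natrM; congr _%:R; lia.
by field; rewrite !f0 !t0; nz.
Qed.

Lemma third_ratio_oddE m :
  2 * rf m.+1%:R (m./2).+1 * rf ((m.*2.+2)%:R + 1 / 2) m =
  third_ratio m.*2.+1 * (odd_double_factorial m.+1)%:R *
    \prod_(0 <= i < m./2) ((m.*2.+1)%:R - 1 / 2 - i%:R).
Proof.
rewrite prod_descending.
have -> : (m.*2.+1)%:R - 1 / 2 - (m./2)%:R + 1 = (m.*2.+1 - m./2)%:R + 1 / 2 :> K.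
  by rewrite natrB; [field|lia].
rewrite rising_factorial_natE !rising_factorial_halfE odd_double_factorialE /third_ratio.
have t0 n : 2 ^+ n != 0 :> K by rewrite expf_neq0 ?pnatr_eq0.
rewrite !exp4; have [h [em|em]] : exists h, m = h.*2 \/ m = h.*2.+1 by exists m./2; lia.
  have -> : m./2 = h by lia.
  have -> : (m.*2.+1 - h + h = m.*2.+1)%N by lia.
  have -> : (2 * (m.*2.+1 - h) + 2 * h = m.*2.*2.+2)%N by lia.
  have -> : (2 * (m.*2.+1 - h) = (6 * h).+2)%N by lia.
  have -> : (m.*2.+1 - h = (3 * h).+1)%N by lia.
  have -> : (m + h.+1 = (3 * h).+1)%N by lia.
  have -> : (2 * m.*2.+2 + 2 * m = (12 * h).+4)%N by lia.
  have -> : (m.*2.+2 + m = (6 * h).+2)%N by lia.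
  have -> : (3 * m.*2.+1 + 1 = (12 * h).+4)%N by lia.
  have -> : (2 * m.*2.+2 = m.*2.*2.+4)%N by lia.
  have -> : (2 * m.+1 = m.*2.+2)%N by lia.
  have -> : m.*2.+1.*2 = m.*2.*2.+2 by lia.
  have -> : h.*2 = m by lia.
  rewrite (factS m.*2.+1) (factS m) (factS m.*2.*2.+3) !natrM (exprS 2 m).
  have -> : 2 ^+ m.*2 = 2 ^+ m * 2 ^+ m :> K by rewrite -exprD addnn.
  have -> : m.*2.*2.+4%:R = 4 * m.+1%:R :> K by rewrite -natrM; congr _%:R; lia.
  have -> : m.*2.+2%:R = 2 * m.+1%:R :> K by rewrite -natrM; congr _%:R; lia.
  by field; rewrite !f0 t0; nz.
have -> : m./2 = h by lia.
have -> : (m.*2.+1 - h + h = m.*2.+1)%N by lia.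
have -> : (2 * (m.*2.+1 - h) + 2 * h = m.*2.*2.+2)%N by lia.
have -> : (2 * (m.*2.+1 - h) = (6 * h).+4.+2)%N by lia.
have -> : (m.*2.+1 - h = (3 * h).+3)%N by lia.
have -> : (m + h.+1 = (3 * h).+2)%N by lia.
have -> : (2 * m.*2.+2 + 2 * m = (12 * h).+4.+4.+2)%N by lia.
have -> : (m.*2.+2 + m = (6 * h).+4.+1)%N by lia.
have -> : (3 * m.*2.+1 + 1 = (12 * h).+4.+4.+2)%N by lia.
have -> : (2 * m.*2.+2 = m.*2.*2.+4)%N by lia.
have -> : (2 * m.+1 = m.*2.+2)%N by lia.
have -> : m.*2.+1.*2 = m.*2.*2.+2 by lia.
have e2 : m = h.*2.+1 by [].
have -> : 2 ^+ m.*2 = 2 ^+ m * (2 * 2 ^+ h.*2) :> K by rewrite -exprS -exprD; congr (_ ^+ _); lia.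
rewrite (factS m.*2.+1) (factS m) (factS m.*2.*2.+3) (factS (3 * h).+2) (factS (6 * h).+4.+1) !natrM (exprS 2 m).
have -> : m.*2.*2.+4%:R = 4 * m.+1%:R :> K by rewrite -natrM; congr _%:R; lia.
have -> : m.*2.+2%:R = 2 * m.+1%:R :> K by rewrite -natrM; congr _%:R; lia.
have -> : (6 * h).+4.+2%:R = 2 * (3 * h).+3%:R :> K by rewrite -natrM; congr _%:R; lia.
by field; rewrite !f0 !t0; nz.
Qed.

Definition odd_double_factorial_prod n : K :=
  \prod_(1 <= i < n.+1) (odd_double_factorial i)%:R.

Lemma odd_double_factorial_prodS n :
  odd_double_factorial_prod n.+1 = odd_double_factorial_prod n * (odd_double_factorial n.+1)%:R.
Proof. by rewrite /odd_double_factorial_prod big_nat_recr. Qed.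

Lemma odd_double_factorial_prod_pred n :
  odd_double_factorial_prod n = odd_double_factorial_prod n.-1 * (odd_double_factorial n)%:R.
Proof.
case: n => [|n] /=; last exact: odd_double_factorial_prodS.
by rewrite /odd_double_factorial_prod /odd_double_factorial !big_geq // mulr1.
Qed.

Lemma odd_double_factorial_prod_neq0 n : odd_double_factorial_prod n != 0.
Proof.
rewrite prodf_seq_neq0; apply/allP => i _; exact: odd_double_factorial_neq0.
Qed.

(** The common shape of the two formulas for roots of unity, without (1 + w)^a. *)
Definition root_formula (x : K) (factor : nat -> nat -> K) a : K :=
  x ^+ a./2 / (odd_double_factorial_prod a./2 * odd_double_factorial_prod (a - 1)./2) *
  \prod_(0 <= i < a.+1) factor a i.

(** The two products of double factorials are lengthened alternately, so a single
    double factorial enters at each step. *)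
Lemma root_formula_even_step x factor (r D N : K) m :
  D != 0 ->
  D * \prod_(0 <= i < m.*2.+2) factor m.*2.+1 i = N * \prod_(0 <= i < m.*2.+1) factor m.*2 i ->
  N = r * (odd_double_factorial m)%:R * D ->
  root_formula x factor m.*2.+1 = root_formula x factor m.*2 * r.
Proof.
move=> D0 E NE; rewrite /root_formula.
have -> : (m.*2.+1)./2 = m by lia.
have -> : ((m.*2.+1 - 1)./2 = m)%N by lia.
have -> : (m.*2)./2 = m by lia.
have -> : ((m.*2 - 1)./2 = m.-1)%N by lia.
rewrite [X in _ / (_ * X) * _ = _]odd_double_factorial_prod_pred.
have -> : \prod_(0 <= i < m.*2.+2) factor m.*2.+1 i =
  r * (odd_double_factorial m)%:R * \prod_(0 <= i < m.*2.+1) factor m.*2 i.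
  by apply: (mulfI D0); rewrite E NE; ring.
have n1 := odd_double_factorial_prod_neq0 m; have n2 := odd_double_factorial_prod_neq0 m.-1.
have n3 := odd_double_factorial_neq0 m.
by field; rewrite n1 n2 n3.
Qed.

Lemma root_formula_odd_step x factor (r D N : K) m :
  D != 0 ->
  D * \prod_(0 <= i < m.*2.+3) factor m.*2.+2 i = N * \prod_(0 <= i < m.*2.+2) factor m.*2.+1 i ->
  x * N = r * (odd_double_factorial m.+1)%:R * D ->
  root_formula x factor m.+1.*2 = root_formula x factor m.*2.+1 * r.
Proof.
move=> D0 E NE; rewrite /root_formula doubleS.
have h1 : (m.*2.+2)./2 = m.+1 by lia.
have h2 : ((m.*2.+2 - 1)./2 = m)%N by lia.
have h3 : (m.*2.+1)./2 = m by lia.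
have h4 : ((m.*2.+1 - 1)./2 = m)%N by lia.
rewrite h1 ?h2 ?h3 ?h4 odd_double_factorial_prodS exprS.
have n1 := odd_double_factorial_prod_neq0 m; have n3 := odd_double_factorial_neq0 m.+1.
have H : x * \prod_(0 <= i < m.*2.+3) factor m.*2.+2 i =
  r * (odd_double_factorial m.+1)%:R * \prod_(0 <= i < m.*2.+2) factor m.*2.+1 i.
  by apply: (mulfI D0); rewrite mulrCA E mulrA NE; ring.
transitivity (x ^+ m / (odd_double_factorial_prod m * (odd_double_factorial m.+1)%:R *
   odd_double_factorial_prod m) * (x * \prod_(0 <= i < m.*2.+3) factor m.*2.+2 i)).
  by field; rewrite n1 n3.
by rewrite H; field; rewrite n1 n3.
Qed.

Lemma root_formula0 x factor : factor 0%N 0%N = 1 -> root_formula x factor 0 = 1.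
Proof.
move=> f1; rewrite /root_formula big_nat1 f1 /odd_double_factorial_prod !big_geq //.
by rewrite expr0 !mulr1 divr1.
Qed.

End ClosedForms.

(** * The product formulas *)

Section Formulas.
Variable K : numFieldType.
Let f0 := factr_neq0 K.

Lemma third_root_formula a :
  root_formula 2 (@third_root_factor K) a = \prod_(i < a) third_ratio K i.
Proof.
have half_neq0 n k : rising_factorial (n%:R + 1 / 2) k != 0 :> K.
  by rewrite rising_factorial_halfE !mulf_neq0 ?invr_neq0 ?mulf_neq0 ?expf_neq0 ?f0 ?pnatr_eq0.
have even_step m : root_formula 2 (@third_root_factor K) m.*2.+1 =
    root_formula 2 (@third_root_factor K) m.*2 * third_ratio K m.*2.
  refine (@root_formula_even_step K 2 (@third_root_factor K) _ _ _ m _ (third_even_step K m) _).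
    rewrite prod_descending.
    have -> : (m.*2)%:R - 1 / 2 - (m./2)%:R + 1 = (m.*2 - m./2)%:R + 1 / 2 :> K.
      by rewrite natrB; [field|lia].
    exact: half_neq0.
  exact: third_ratio_evenE.
have odd_step m : root_formula 2 (@third_root_factor K) m.+1.*2 =
    root_formula 2 (@third_root_factor K) m.*2.+1 * third_ratio K m.*2.+1.
  refine (@root_formula_odd_step K 2 (@third_root_factor K) _ _ _ m _ (third_odd_step K m) _).
    rewrite prod_descending.
    have -> : (m.*2.+1)%:R - 1 / 2 - (m./2)%:R + 1 = (m.*2.+1 - m./2)%:R + 1 / 2 :> K.
      by rewrite natrB; [field|lia].
    exact: half_neq0.
  by rewrite mulrA third_ratio_oddE.
have even m : root_formula 2 (@third_root_factor K) m.*2 = \prod_(i < m.*2) third_ratio K i.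
  elim: m => [|m IH].
    by rewrite big_ord0 root_formula0 // /third_root_factor !rising_factorial0 !mulr1.
  by rewrite odd_step even_step IH doubleS !big_ord_recr.
have [m [->|->]] : exists m, a = m.*2 \/ a = m.*2.+1 by exists a./2; lia.
  exact: even.
by rewrite even_step even big_ord_recr.
Qed.

Lemma sixth_root_formula m :
  root_formula (2 / 3) (@sixth_root_factor K) m.*2 =
    \prod_(i < m) (sixth_ratio0 K i * sixth_ratio1 K i) /\
  root_formula (2 / 3) (@sixth_root_factor K) m.*2.+1 =
    \prod_(i < m) (sixth_ratio1 K i * sixth_ratio0 K i.+1).
Proof.
have nat_neq0 n k : rising_factorial n.+1%:R k != 0 :> K.
  by rewrite rising_factorial_natE mulf_neq0 ?invr_neq0 ?f0.
have even_step l : root_formula (2 / 3) (@sixth_root_factor K) l.*2.+1 =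
    root_formula (2 / 3) (@sixth_root_factor K) l.*2 * sixth_ratio0 K l.
  refine (@root_formula_even_step K (2 / 3) (@sixth_root_factor K) _ _ _ l _ (sixth_even_step K l) _).
    rewrite prod_descending.
    have -> : (l.*2)%:R - (uphalf l)%:R + 1 = (l.*2 - uphalf l).+1%:R :> K.
      by rewrite -[RHS]natr1 natrB //; lia.
    exact: nat_neq0.
  exact: sixth_ratio0E.
have odd_step l : root_formula (2 / 3) (@sixth_root_factor K) l.+1.*2 =
    root_formula (2 / 3) (@sixth_root_factor K) l.*2.+1 * sixth_ratio1 K l.
  refine (@root_formula_odd_step K (2 / 3) (@sixth_root_factor K) _ _ _ l _ (sixth_odd_step K l) _).
    rewrite prod_descending.
    have -> : (l.*2.+1)%:R - (uphalf l)%:R + 1 = (l.*2.+1 - uphalf l).+1%:R :> K.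
      by rewrite -[RHS]natr1 natrB //; lia.
    exact: nat_neq0.
  by rewrite mulrA sixth_ratio1E.
elim: m => [|m [IH0 IH1]].
  rewrite (even_step 0%N) !big_ord0 root_formula0; last first.
    by rewrite /sixth_root_factor !rising_factorial0 !mulr1.
  by split=> //; rewrite /sixth_ratio0 !muln0 fact0; field.
by rewrite even_step odd_step IH1 !big_ord_recr /= -IH1 even_step IH0; split; ring.
Qed.

End Formulas.

Lemma weighted_count_form_mx (K : numFieldType) (w : K) a :
  weighted_count w a = \det (form_mx w a).
Proof. by rewrite weighted_count_det /= det_form_mx_tr. Qed.

Lemma third_root_eq (K : fieldType) (w : K) : 3.-primitive_root w -> w ^+ 2 + w + 1 = 0.
Proof.
move=> w3; have w1 : w - 1 != 0.
  by rewrite subr_eq0; have := prim_order_dvd w3 1; rewrite expr1 => <-.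
apply: (mulfI w1); rewrite mulr0.
have -> : (w - 1) * (w ^+ 2 + w + 1) = w ^+ 3 - 1 by ring.
by rewrite (prim_expr_order w3) subrr.
Qed.

Lemma sixth_root_eq (K : fieldType) (w : K) : 6.-primitive_root w -> w ^+ 2 - w + 1 = 0.
Proof.
move=> w6.
have w3 : w ^+ 3 - 1 != 0 by rewrite subr_eq0 -(prim_order_dvd w6).
have w2 : w + 1 != 0.
  apply/eqP => w1; have : w ^+ 2 - 1 = 0.
    by have -> : w ^+ 2 - 1 = (w + 1) * (w - 1) by [ring]; rewrite w1 mul0r.
  by move/eqP; rewrite subr_eq0 -(prim_order_dvd w6).
apply: (mulfI w3); apply: (mulfI w2); rewrite !mulr0.
have -> : (w + 1) * ((w ^+ 3 - 1) * (w ^+ 2 - w + 1)) = w ^+ 6 - 1 by ring.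
by rewrite (prim_expr_order w6) subrr.
Qed.

(* C = R[i] with R the real numbers.  Subtraction inside the subscripts and
   the index bounds is truncated and _./2 is the floor of the half, so that a
   subscript floor(alpha) with alpha < 0 is 0.  For 4 i >= a all the subscripts
   are 0, hence the products over i >= 0 are those over 0 <= i <= a. *)
Theorem corollary8 (R : realType) (a : nat) (omega : R[i]) :
  [/\ omega = -1 ->
        (odd a -> weighted_count omega a = 0) /\
        (~~ odd a ->
          weighted_count omega a =
            (-1) ^+ a./2 *
            \prod_(0 <= i < a./2)
              ((i`!)%:R ^+ 4 * ((3 * i + 1)`!)%:R ^+ 4 /
               (((2 * i)`!)%:R ^+ 4 * ((2 * i + 1)`!)%:R ^+ 4))),
      3.-primitive_root omega ->
        weighted_count omega a =
          (1 + omega) ^+ a * 2 ^+ a./2 /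
          ((\prod_(1 <= i < (a./2).+1) (odd_double_factorial i)%:R) *
           (\prod_(1 <= i < ((a - 1)./2).+1) (odd_double_factorial i)%:R)) *
          \prod_(0 <= i < a.+1)
            (rising_factorial (3 * i%:R + 1) ((a - 4 * i)./2)%N *
             rising_factorial (3 * i%:R + 3) ((a - 4 * i - 3)./2)%N *
             rising_factorial (a%:R - i%:R + 1 / 2) ((a - 4 * i - 1)./2)%N *
             rising_factorial (a%:R - i%:R - 1 / 2) ((a - 4 * i - 2)./2)%N)
    & 6.-primitive_root omega ->
        weighted_count omega a =
          (1 + omega) ^+ a * (2 / 3) ^+ a./2 /
          ((\prod_(1 <= i < (a./2).+1) (odd_double_factorial i)%:R) *
           (\prod_(1 <= i < ((a - 1)./2).+1) (odd_double_factorial i)%:R)) *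
          \prod_(0 <= i < a.+1)
            (rising_factorial (3 * i%:R + 3 / 2) ((a - 4 * i - 1)./2)%N *
             rising_factorial (3 * i%:R + 5 / 2) ((a - 4 * i - 2)./2)%N *
             rising_factorial (a%:R - i%:R) ((a - 4 * i)./2)%N *
             rising_factorial (a%:R - i%:R) ((a - 4 * i - 3)./2)%N)].
Proof.
split.
- move=> ->.
  (* Here the roots of X^2 - X + 1 are not provided by [omega]. *)
  pose al : R[i] := (1 + sqrtC (- 3)) / 2; pose be := 1 - al.
  have albeD : al + be = 1 by rewrite /be; ring.
  have albeM : al * be = 1.
    have -> : al * be = (1 - sqrtC (- 3) ^+ 2) / 4 by rewrite /be /al; field.
    by rewrite sqrtCK; field.
  split=> [a_odd|a_even]; rewrite weighted_count_form_mx.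
    exact: det_form_mx_minus1_odd albeD albeM a_odd.
  have -> : \det (form_mx (-1 : R[i]) a) = \det (form_mx (-1 : R[i]) (a./2 + a./2)).
    by rewrite addnn even_halfK.
  rewrite (det_form_mx_minus1_even _ albeD albeM) big_mkord; congr (_ * _).
  by apply: eq_bigr => i _; rewrite !exprMn exprVn !exprMn !addn1 !mul2n.
- move=> w3; rewrite weighted_count_form_mx (det_form_mx_third_root _ (third_root_eq w3)).
  have := third_root_formula R[i] a; rewrite /third_ratio => <-.
  by rewrite /root_formula !mulrA.
move=> w6; rewrite weighted_count_form_mx.
have [m am] : exists m, a = (m + m)%N \/ a = (1 + (m + m))%N by exists a./2; lia.
have [E0 E1] := sixth_root_formula R[i] m.
transitivity ((1 + omega) ^+ a * root_formula (2 / 3) (@sixth_root_factor R[i]) a); last first.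
  by rewrite /root_formula !mulrA.
case: am => ->.
  rewrite (det_form_mx_sixth_even (sixth_root_eq w6)) addnn E0; congr (_ * _).
  apply: eq_bigr => i _; rewrite /sixth_ratio0 /sixth_ratio1 addn1 mul2n.
  have f0 := factr_neq0 R[i]; by field; rewrite !f0.
rewrite (det_form_mx_sixth_odd (sixth_root_eq w6)) addnn add1n E1; congr (_ * _).
apply: eq_bigr => i _; rewrite /sixth_ratio0 /sixth_ratio1 addn1 !mul2n doubleS.
have -> : (3 * i + 3 = 3 * i.+1)%N by lia.
have f0 := factr_neq0 R[i]; by field; rewrite !f0.
Qed.
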